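(* Let $P$ be a Markov chain kernel on a measurable space $(\mathcal{X},\mathcal{F})$ with unique stationary distribution $\pi(\cdot)$, and suppose $P$ is reversible with respect to $\pi(\cdot)$. Then $P$ is variance bounding if and only if every measurable $h:\mathcal{X}\to\mathbf{R}$ with $\pi(h^2)<\infty$ satisfies a usual central limit theorem for $P$.
   Context: Let $\{X_n\}_{n\ge 0}$ be the Markov chain with kernel $P$ started in stationarity ($X_0\sim\pi$), and write $\pi(f)=\int_{\mathcal{X}}f(x)\,\pi(dx)$. For measurable $h:\mathcal{X}\to\mathbf{R}$, $\operatorname{Var}_\pi(h)=\mathbf{E}[(h(X_0)-\mathbf{E}[h(X_0)])^2]$ is the stationary variance, and $\operatorname{Var}(h,P)=\lim_{n\to\infty}\frac1n\operatorname{Var}\left(\sum_{i=1}^n h(X_i)\right)$ is the asymptotic variance (for reversible $P$ and $h\in L^2(\pi)$ the limit always exists, though it may be infinite). $P$ is variance bounding if there is $K<\infty$ such that $\operatorname{Var}(h,P)\le K\operatorname{Var}_\pi(h)$ for all measurable $h:\mathcal{X}\to\mathbf{R}$ (the inequality holds automatically when $\operatorname{Var}_\pi(h)=\infty$). $P$ is reversible with respect to $\pi$ if $\int_{x\in A}\pi(dx)P(x,B)=\int_{x\in B}\pi(dx)P(x,A)$ for all $A,B\in\mathcal{F}$. A measurable functional $h:\mathcal{X}\to\mathbf{R}$ with $\pi(|h|)<\infty$ satisfies a usual central limit theorem for $P$ if, as $n\to\infty$, the distribution of $n^{-1/2}\sum_{i=1}^n[h(X_i)-\pi(h)]$ converges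 weakly to $N(0,v)$, where (with $\{X_n\}$ in stationarity) $$v=\operatorname{Var}(h(X_0))+2\sum_{i=1}^\infty\operatorname{Cov}(h(X_0),h(X_i))<\infty .$$
   Formalization: In the usual CLT, the sum of Cov(h(X_0),h(X_i)) is taken in the Cesàro (C,1) sense, with ordinary convergence required whenever the covariances tend to 0; with ordinary summation always, the claim fails for the periodic flip on {-1,1}. *)

(* Defs.v *)
From HB Require Import structures.
From mathcomp Require Import all_boot all_order all_algebra.
From mathcomp Require Import all_classical all_reals all_analysis.
Set Implicit Arguments.
Unset Strict Implicit.
Unset Printing Implicit Defensive.
Import Order.TTheory GRing.Theory Num.Theory.
Import numFieldNormedType.Exports.
Local Open Scope classical_set_scope.
Local Open Scope ring_scope.

Definition stationary (R : realType) (d : measure_display)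
    (T : measurableType d) (P : R.-pker T ~> T) (mu : probability T R) : Prop :=
  forall B : set T, measurable B -> (\int[mu]_x P x B)%E = mu B.

Definition unique_stationary (R : realType) (d : measure_display)
    (T : measurableType d) (P : R.-pker T ~> T) (pi : probability T R) : Prop :=
  stationary P pi /\
  forall mu : probability T R, stationary P mu ->
    forall B : set T, measurable B -> mu B = pi B.

Definition reversible (R : realType) (d : measure_display)
    (T : measurableType d) (P : R.-pker T ~> T) (pi : probability T R) : Prop :=
  forall A B : set T, measurable A -> measurable B ->
    (\int[pi]_(x in A) P x B)%E = (\int[pi]_(x in B) P x A)%E.

Definition history (d d' : measure_display) (T : measurableType d)
    (W : measurableType d') (X : nat -> W -> T) (n : nat) : set_system W :=
  <<s \bigcup_(k in `I_n.+1) preimage_set_system setT (X k) measurable >>.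

(* [X] has initial law [pi] and is Markov with kernel [P] with respect to its
   natural filtration: Pr(X_{n+1} \in B | X_0, ..., X_n) = P(X_n, B). This
   determines the law of the whole sequence from [P] and [pi]. *)
Definition markov_chain (R : realType) (d d' : measure_display)
    (T : measurableType d) (W : measurableType d')
    (P : R.-pker T ~> T) (pi : probability T R)
    (Pr : probability W R) (X : nat -> {RV Pr >-> T}) : Prop :=
  (forall B : set T, measurable B -> distribution Pr (X 0%N) B = pi B) /\
  (forall (n : nat) (E : set W) (B : set T),
     history (fun k w => X k w) n E -> measurable B ->
     Pr (E `&` X n.+1 @^-1` B) = (\int[Pr]_(w in E) P (X n w) B)%E).

Definition asymptotic_variance (R : realType) (d d' : measure_display)
    (T : measurableType d) (W : measurableType d')
    (Pr : probability W R) (X : nat -> {RV Pr >-> T}) (h : T -> R) : \bar R :=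
  limn (fun n : nat =>
    ((n%:R^-1)%:E * 'V_Pr[fun w => (\sum_(1 <= i < n.+1) h (X i w))%R])%E).

(* For measurable [h] that is not square-integrable, the library variance is
   +oo, so with K > 0 the inequality constrains square-integrable [h] only. *)
Definition variance_bounding (R : realType) (d d' : measure_display)
    (T : measurableType d) (W : measurableType d')
    (Pr : probability W R) (X : nat -> {RV Pr >-> T}) : Prop :=
  exists K : R, forall h : T -> R, measurable_fun setT h ->
    (asymptotic_variance X h <= K%:E * 'V_Pr[fun w => h (X 0%N w)])%E.

(* N(0, v), with N(0, 0) the point mass at 0; [normal_prob] takes a standard
   deviation and is a different law when the latter vanishes. *)
Definition centered_normal (R : realType) (v : R) :
    probability (measurableTypeR R) R :=
  if v == 0 then (\d_(0 : measurableTypeR R) : probability (measurableTypeR R) R)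
  else (normal_prob 0 (Num.sqrt v) : probability (measurableTypeR R) R).

Definition converges_in_law (R : realType) (d' : measure_display)
    (W : measurableType d') (Pr : probability W R) (Z : nat -> W -> R)
    (Q : probability (measurableTypeR R) R) : Prop :=
  forall f : R -> R, continuous f -> bounded_fun f ->
    'E_Pr[f \o Z n]%E @[n --> \oo] --> (\int[Q]_x (f x)%:E)%E.

(* Ordinary summation when u_n --> 0. Otherwise the series has no ordinary sum,
   and its (C,1) (Cesaro) sum is used, which agrees with the ordinary sum
   whenever the latter exists. The second case is needed for the autocovariances
   of a periodic reversible chain, where they need not tend to 0: for the
   deterministic flip on {-1, 1} and h(x) = x they are (-1)^n, and
   Var(h(X_0)) + 2 \sum_{i >= 1} Cov(h(X_0), h(X_i)) is then, in the (C,1) sense,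
   1 + 2 (-1/2) = 0 = lim Var(h(X_1) + ... + h(X_n)) / n. *)
Definition series_sum (R : realType) (u : nat -> R) (s : R) : Prop :=
  (u @ \oo --> 0 -> series u @ \oo --> s) /\
  arithmetic_mean (series u) @ \oo --> s.

(* The displayed equation makes Var(h(X_0)) finite, hence also every covariance
   below, so that [fine] is harmless. *)
Definition usual_clt (R : realType) (d d' : measure_display)
    (T : measurableType d) (W : measurableType d') (pi : probability T R)
    (Pr : probability W R) (X : nat -> {RV Pr >-> T}) (h : T -> R) : Prop :=
  pi.-integrable setT (EFin \o h) /\
  exists v s : R,
    [/\ series_sum (fun i : nat =>
          fine (covariance Pr (fun w => h (X 0%N w)) (fun w => h (X i.+1 w)))) s,
        v%:E = ('V_Pr[fun w => h (X 0%N w)] + 2%:E * s%:E)%E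
      & converges_in_law Pr
          (fun (n : nat) (w : W) =>
             (Num.sqrt n%:R)^-1 *
             \sum_(1 <= i < n.+1) (h (X i w) - (\int[pi]_x h x)%R))
          (centered_normal v)].

(* Main.v *)
(* For a centred square-integrable h, reversibility makes the autocovariances
   a_k = <h, P^k h> satisfy: both a_(2k) and a_(2k) + a_(2k+1) are nonnegative and
   nonincreasing in k. Hence Var(S_n) / n either converges, and then the
   autocovariance series is (C,1)-summable, or tends to +oo. This replaces the
   spectral theorem.

   If P is variance bounding, the partial sums of the autocovariances are bounded
   by a multiple of |h|^2, and h is close to the coboundary obtained by
   subtracting from it the average of its iterates under P. So every h is
   L^2-close to some g - P g with g bounded, at a cost controlled in asymptotic
   variance, and S_n is then close to a martingale M_n with bounded increments.
   The conditional variance of these increments minus its mean is itself close to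
   a coboundary r - P r; telescoping it turns E cos(t M_k + c) into an approximate
   geometric recursion in k, whose limit is the normal characteristic function.

   Conversely, the central limit theorem for every h in L^2 makes Var(S_n) / n
   convergent for every such h, and the uniform boundedness principle applied to
   the seminorms sqrt(Var(S_n) / n) yields the variance bound. *)
Require Import Defs.
From HB Require Import structures.
From mathcomp Require Import all_boot all_order all_algebra.
From mathcomp Require Import all_classical all_reals all_analysis.
From mathcomp Require Import measurable_realfun ring lra zify.
Set Implicit Arguments.
Unset Strict Implicit.
Unset Printing Implicit Defensive.
Import Order.TTheory GRing.Theory Num.Theory.
Import numFieldNormedType.Exports.
Local Open Scope classical_set_scope.
Local Open Scope ring_scope.

(** [Pop] is a genuine integral at every point for bounded measurable functions; for a
    square-integrable one it would be defined only almost everywhere. Statements involving the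
    iterates of [P] are therefore proved for bounded functions and reach [L^2] through the scalar
    products of [h (X i)] and [h (X j)], which stationarity makes continuous in [h] uniformly in [i]
    and [j]. For a periodic chain the iterates of a centred function under [P] need not tend to 0;
    only their averages do. Hence the Cesaro averages in the coboundary approximation, which is used
    a second time, for the centred conditional variance, where an ergodic theorem might be expected.
    The phase [c] in [cos (l * x + c)] covers cosine and sine at once, so no complex exponentials
    occur. Tightness is not argued separately: the second moments are bounded uniformly in [n], and
    this bound absorbs the quadratic error of a trigonometric approximation. Uniform boundedness is
    obtained by a gliding hump because this asks only for monotone limits in [L^2], not for a
    complete metric space of classes of functions. *)

HB.lock Definition mean (R : realType) (d : measure_display)
  (T : measurableType d) (P : probability T R) (f : T -> R) : R := \int[P]_x f x.
Canonical mean_unlockable := Unlockable mean.unlock.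

(** * Square-integrable functions on a probability space *)

Section SquareIntegrable.
Context (R : realType) (d : measure_display) (T : measurableType d).
Implicit Types f g h : T -> R.

Definition bounded_measurable f : Prop :=
  measurable_fun setT f /\ exists b : R, forall x, `|f x| <= b.

Variable P : probability T R.

Definition integr f : Prop := P.-integrable setT (EFin \o f).
Local Notation mean := (@mean R d T P).
Definition sqint f : Prop :=
  measurable_fun setT f /\ integr (fun x => f x ^+ 2).
Definition ip f g : R := mean (fun x => f x * g x).
Definition nrm f : R := Num.sqrt (ip f f).

Lemma integr_meas f : integr f -> measurable_fun setT f.
Proof. by move/measurable_int/measurable_EFinP. Qed.

Lemma le_integr f g : measurable_fun setT f -> (forall x, `|f x| <= g x) ->
  integr g -> integr f.
Proof.
move=> mf fg; apply: le_integrable => //; first exact/measurable_EFinP.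
by move=> x _ /=; rewrite lee_fin (le_trans (fg x))// ler_norm.
Qed.

Lemma integr_cst c : integr (fun=> c).
Proof. exact: finite_measure_integrable_cst. Qed.

Lemma integrD f g : integr f -> integr g -> integr (fun x => f x + g x).
Proof. by move=> i1 i2; have := integrableD measurableT i1 i2. Qed.

Lemma integrZ c f : integr f -> integr (fun x => c * f x).
Proof. by move=> i1; have := integrableZl measurableT c i1. Qed.

Lemma integr_norm f : integr f -> integr (fun x => `|f x|).
Proof. exact: integrable_norm. Qed.

Lemma mean_fine f : mean f = fine (\int[P]_x (f x)%:E).
Proof. by rewrite unlock. Qed.

Lemma meanD f g : integr f -> integr g ->
  mean (fun x => f x + g x) = mean f + mean g.
Proof. by move=> *; rewrite unlock RintegralD. Qed.

Lemma meanB f g : integr f -> integr g ->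
  mean (fun x => f x - g x) = mean f - mean g.
Proof. by move=> *; rewrite unlock RintegralB. Qed.

Lemma meanZ c f : integr f -> mean (fun x => c * f x) = c * mean f.
Proof. by move=> *; rewrite unlock RintegralZl. Qed.

Lemma mean_cst c : mean (fun=> c) = c.
Proof.
rewrite unlock Rintegral_cst// (_ : fine _ = 1) ?mulr1//.
by have /(congr1 fine) := probability_setT P.
Qed.

Lemma eq_mean f g : f =1 g -> mean f = mean g.
Proof. by move=> fg; congr mean; apply: funext. Qed.

Lemma le_mean f g : integr f -> integr g -> (forall x, f x <= g x) ->
  mean f <= mean g.
Proof. by move=> i1 i2 fg; rewrite unlock; apply: le_Rintegral. Qed.

Lemma mean_ge0 f : (forall x, 0 <= f x) -> 0 <= mean f.
Proof. by move=> f0; rewrite unlock; apply: Rintegral_ge0. Qed.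

Lemma meanE f : integr f -> (\int[P]_x (f x)%:E)%E = (mean f)%:E.
Proof. by move=> i; rewrite mean_fine fineK// integrable_fin_num. Qed.

Lemma norm_mean_le f g : integr f -> integr g -> (forall x, `|f x| <= g x) ->
  `|mean f| <= mean g.
Proof.
move=> i1 i2 fg; rewrite (mean_fine f).
apply: (le_trans (le_normr_Rintegral measurableT i1)).
have := le_mean (integr_norm i1) i2 fg; by rewrite mean_fine.
Qed.

Lemma bm_meas f : bounded_measurable f -> measurable_fun setT f.
Proof. by case. Qed.

Lemma bm_integr f : bounded_measurable f -> integr f.
Proof.
by move=> [mf [b fb]]; apply: (le_integr mf fb); exact: integr_cst.
Qed.

Lemma bmD f g : bounded_measurable f -> bounded_measurable g ->
  bounded_measurable (fun x => f x + g x).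
Proof.
move=> [mf [a fa]] [mg [b gb]]; split; first exact: measurable_funD.
by exists (a + b) => x; rewrite (le_trans (ler_normD _ _))// lerD.
Qed.

Lemma bmM f g : bounded_measurable f -> bounded_measurable g ->
  bounded_measurable (fun x => f x * g x).
Proof.
move=> [mf [a fa]] [mg [b gb]]; split; first exact: measurable_funM.
by exists (a * b) => x; rewrite normrM ler_pM.
Qed.

Lemma bm_cst c : bounded_measurable (fun=> c).
Proof. by split; [exact: measurable_cst|exists `|c|]. Qed.

Lemma bmN f : bounded_measurable f -> bounded_measurable (fun x => - f x).
Proof.
move=> [mf [a fa]]; split; last by exists a => x; rewrite normrN.
exact: measurableT_comp.
Qed.

Lemma bmB f g : bounded_measurable f -> bounded_measurable g ->
  bounded_measurable (fun x => f x - g x).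
Proof. by move=> *; apply: bmD => //; apply: bmN. Qed.

Lemma bmX2 f : bounded_measurable f -> bounded_measurable (fun x => f x ^+ 2).
Proof. by move=> bf; have := bmM bf bf. Qed.

Lemma bm_sqint f : bounded_measurable f -> sqint f.
Proof. by move=> bf; split; [exact: bm_meas|apply: bm_integr; exact: bmX2]. Qed.

Lemma sqint_meas f : sqint f -> measurable_fun setT f. Proof. by case. Qed.

Lemma sqintM f g : sqint f -> sqint g -> integr (fun x => f x * g x).
Proof.
move=> [mf f2] [mg g2]; apply: le_integr (integrD f2 g2) => /=.
  exact: measurable_funM.
move=> x; rewrite ler_norml; apply/andP; split.
  by have := sqr_ge0 (f x + g x); have := sqr_ge0 (f x);
     have := sqr_ge0 (g x); nra.
by have := sqr_ge0 (f x - g x); have := sqr_ge0 (f x);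
   have := sqr_ge0 (g x); nra.
Qed.

Lemma sqint_cst c : sqint (fun=> c).
Proof. exact/bm_sqint/bm_cst. Qed.

Lemma sqint_integr f : sqint f -> integr f.
Proof.
move=> f2; have := sqintM f2 (sqint_cst 1).
by congr integr; apply: funext => x; rewrite mulr1.
Qed.

Lemma sqintD f g : sqint f -> sqint g -> sqint (fun x => f x + g x).
Proof.
move=> f2 g2; split; first by apply: measurable_funD; apply: sqint_meas.
have := integrD (integrD f2.2 g2.2) (integrZ 2 (sqintM f2 g2)).
by congr integr; apply: funext => x /=; ring.
Qed.

Lemma sqintZ c f : sqint f -> sqint (fun x => c * f x).
Proof.
move=> f2; split; first by apply: measurable_funM => //; exact: sqint_meas.
have := integrZ (c ^+ 2) f2.2.
by congr integr; apply: funext => x /=; rewrite exprMn.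
Qed.

Lemma sqintN f : sqint f -> sqint (fun x => - f x).
Proof.
by move=> /(sqintZ (- 1)); congr sqint; apply: funext => x; rewrite mulN1r.
Qed.

Lemma sqintB f g : sqint f -> sqint g -> sqint (fun x => f x - g x).
Proof. by move=> *; apply: sqintD => //; apply: sqintN. Qed.

Lemma sqint_sum (I : Type) (r : seq I) (p : pred I) (F : I -> T -> R) :
  (forall i, sqint (F i)) -> sqint (fun x => \sum_(i <- r | p i) F i x).
Proof.
move=> h; elim: r => [|i r ih].
  by under eq_fun do rewrite big_nil; exact: sqint_cst.
under eq_fun do rewrite big_cons.
by case: (p i) => //; apply: sqintD.
Qed.

Lemma le_sqint f g : measurable_fun setT f -> (forall x, `|f x| <= `|g x|) ->
  sqint g -> sqint f.
Proof.
move=> mf fg [mg g2]; split => //.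
apply: le_integr g2; first exact: measurable_funX.
by move=> x; rewrite ger0_norm ?sqr_ge0// -real_normK ?num_real//
  -[leRHS]real_normK ?num_real// lerXn2r// nnegrE.
Qed.

Lemma ipC f g : ip f g = ip g f.
Proof. by apply: eq_mean => x; rewrite mulrC. Qed.

Lemma ip_ge0 f : 0 <= ip f f.
Proof. by apply: mean_ge0 => x; rewrite -expr2 sqr_ge0. Qed.

Lemma ipDl f g h : sqint f -> sqint g -> sqint h ->
  ip (fun x => f x + g x) h = ip f h + ip g h.
Proof.
move=> f2 g2 h2; rewrite /ip -meanD; try exact: sqintM.
by apply: eq_mean => x; rewrite mulrDl.
Qed.

Lemma ipZl c f h : sqint f -> sqint h -> ip (fun x => c * f x) h = c * ip f h.
Proof.
move=> f2 h2; rewrite /ip -meanZ; last exact: sqintM.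
by apply: eq_mean => x; rewrite mulrA.
Qed.

Lemma ipNl f h : sqint f -> sqint h -> ip (fun x => - f x) h = - ip f h.
Proof.
move=> f2 h2; rewrite -mulN1r -ipZl//; congr ip.
by apply: funext => x; rewrite mulN1r.
Qed.

Lemma ipBl f g h : sqint f -> sqint g -> sqint h ->
  ip (fun x => f x - g x) h = ip f h - ip g h.
Proof. by move=> f2 g2 h2; rewrite ipDl ?ipNl//; exact: sqintN. Qed.

Lemma ipDr f g h : sqint f -> sqint g -> sqint h ->
  ip h (fun x => f x + g x) = ip h f + ip h g.
Proof. by move=> *; rewrite ipC ipDl// !(ipC h). Qed.

Lemma ipBr f g h : sqint f -> sqint g -> sqint h ->
  ip h (fun x => f x - g x) = ip h f - ip h g.
Proof. by move=> *; rewrite ipC ipBl// !(ipC h). Qed.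

Lemma ipZr c f h : sqint f -> sqint h -> ip h (fun x => c * f x) = c * ip h f.
Proof. by move=> *; rewrite ipC ipZl// ipC. Qed.

Lemma ip_suml (I : Type) (r : seq I) (F : I -> T -> R) h :
  (forall i, sqint (F i)) -> sqint h ->
  ip (fun x => \sum_(i <- r) F i x) h = \sum_(i <- r) ip (F i) h.
Proof.
move=> F2 h2; elim: r => [|i r ih].
  rewrite big_nil /ip; under eq_mean do rewrite big_nil mul0r.
  exact: mean_cst.
by rewrite big_cons -ih -ipDl//; [under eq_fun do rewrite big_cons|
  exact: sqint_sum].
Qed.

Lemma ipDD f g : sqint f -> sqint g ->
  ip (fun x => f x + g x) (fun x => f x + g x) = ip f f + 2 * ip f g + ip g g.
Proof.
move=> f2 g2; have fg2 := sqintD f2 g2.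
by rewrite ipDl// !ipDr// (ipC g f); ring.
Qed.

Lemma ipBB f g : sqint f -> sqint g ->
  ip (fun x => f x - g x) (fun x => f x - g x) = ip f f - 2 * ip f g + ip g g.
Proof.
move=> f2 g2; have fg2 := sqintB f2 g2.
by rewrite ipBl// !ipBr// (ipC g f); ring.
Qed.

Lemma ip_sqr_le f g : sqint f -> sqint g -> ip f g ^+ 2 <= ip f f * ip g g.
Proof.
move=> f2 g2.
have H t : 0 <= ip f f + 2 * t * ip f g + t ^+ 2 * ip g g.
  have tg2 := sqintZ t g2.
  have := ip_ge0 (fun x => f x + t * g x).
  by rewrite ipDD// !ipZr// ipZl//; congr (_ <= _); ring.
move: (ip_ge0 f) (ip_ge0 g) H.
move: (ip f f) (ip f g) (ip g g) => a c b a0 b0 H.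
have [b0'|bn0] := eqVneq b 0.
  have [->|cn0] := eqVneq c 0; first by rewrite b0' expr0n/= mulr0.
  (* When [b = 0] the quadratic degenerates to [a + 2 t c], to which this [t] gives the value [-1].
     In the other case the minimiser [t = - c / b] is used. *)
  have := H (- (a + 1) / (2 * c)); rewrite b0' mulr0 addr0.
  have -> : 2 * (- (a + 1) / (2 * c)) * c = - (a + 1) by field.
  lra.
have bp : 0 < b by rewrite lt0r bn0.
have := H (- c / b).
have -> : a + 2 * (- c / b) * c + (- c / b) ^+ 2 * b = (a * b - c ^+ 2) / b.
  by field.
by rewrite pmulr_lge0 ?invr_gt0// subr_ge0.
Qed.

Lemma nrm_ge0 f : 0 <= nrm f. Proof. exact: sqrtr_ge0. Qed.

Lemma nrm_sqr f : nrm f ^+ 2 = ip f f.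
Proof. by rewrite sqr_sqrtr// ip_ge0. Qed.

Lemma ip_le f g : sqint f -> sqint g -> `|ip f g| <= nrm f * nrm g.
Proof.
move=> f2 g2; rewrite -sqrtrM ?ip_ge0// -sqrtr_sqr ler_sqrt ?ip_sqr_le//.
by rewrite mulr_ge0 ?ip_ge0.
Qed.

Lemma nrmD f g : sqint f -> sqint g ->
  nrm (fun x => f x + g x) <= nrm f + nrm g.
Proof.
move=> f2 g2; rewrite -(@ler_pXn2r _ 2)// ?nnegrE ?addr_ge0 ?nrm_ge0//.
rewrite nrm_sqr ipDD// -!nrm_sqr.
have := ip_le f2 g2; have := ler_norm (ip f g); nra.
Qed.

Lemma nrmZ c f : sqint f -> nrm (fun x => c * f x) = `|c| * nrm f.
Proof.
move=> f2; rewrite /nrm ipZl ?ipZr//; last exact: sqintZ.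
by rewrite mulrA -expr2 sqrtrM ?sqr_ge0// sqrtr_sqr.
Qed.

Lemma nrmN f : nrm (fun x => - f x) = nrm f.
Proof. by congr Num.sqrt; apply: eq_mean => x; rewrite mulrNN. Qed.

Lemma nrmB f g : sqint f -> sqint g ->
  nrm (fun x => f x - g x) <= nrm f + nrm g.
Proof.
by move=> f2 g2; rewrite -(nrmN g) nrmD//; exact: sqintN.
Qed.

Lemma nrm_sum (I : Type) (r : seq I) (F : I -> T -> R) :
  (forall i, sqint (F i)) ->
  nrm (fun x => \sum_(i <- r) F i x) <= \sum_(i <- r) nrm (F i).
Proof.
move=> F2; elim: r => [|i r ih].
  rewrite big_nil /nrm /ip; under eq_mean do rewrite big_nil mul0r.
  by rewrite mean_cst sqrtr0.
rewrite big_cons; under eq_fun do rewrite big_cons.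
by rewrite (le_trans (nrmD _ _))// ?lerD2l//; exact: sqint_sum.
Qed.

Lemma mean_sqr_le f : sqint f -> mean f ^+ 2 <= ip f f.
Proof.
move=> f2; have := ip_sqr_le f2 (sqint_cst 1).
rewrite /ip mean_cst mulr1 mulr1; congr (_ ^+ 2 <= _).
by apply: eq_mean => x; rewrite mulr1.
Qed.

Lemma norm_mean_nrm f : sqint f -> mean (fun x => `|f x|) <= nrm f.
Proof.
move=> f2; have g2 : sqint (fun x => `|f x|).
  apply: (le_sqint _ _ f2); last by move=> x; rewrite normr_id.
  exact: measurableT_comp (sqint_meas f2).
rewrite (le_trans (ler_norm _))// -sqrtr_sqr ler_sqrt ?ip_ge0//.
rewrite (le_trans (mean_sqr_le g2))// le_eqVlt; apply/orP; left; apply/eqP.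
by apply: eq_mean => x; rewrite -!expr2 real_normK ?num_real.
Qed.

Lemma sqint_cov f g : sqint f -> sqint g ->
  covariance P f g =
  (ip (fun x => f x - mean f) (fun x => g x - mean g))%:E.
Proof.
move=> f2 g2; rewrite covariance.unlock expectation.unlock -!mean_fine.
apply: (@meanE (fun x => (f x - mean f) * (g x - mean g))).
by apply: sqintM; apply: sqintB => //; exact: sqint_cst.
Qed.

End SquareIntegrable.

(** * Monotone limits and bounded approximation in [L^2] *)

Section SquareIntegrableLimits.
Context (R : realType) (d : measure_display) (T : measurableType d).
Variable P : probability T R.
Implicit Types f g h : T -> R.

Lemma integral_sqr_sqint f c : measurable_fun setT f ->
  (\int[P]_x (f x ^+ 2)%:E <= (c ^+ 2)%:E)%E -> 0 <= c ->
  sqint P f /\ nrm P f <= c.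
Proof.
move=> mf fc c0.
have f2 : sqint P f.
  split=> //; apply/integrableP; split.
    by apply/measurable_EFinP; exact: measurable_funX.
  apply: le_lt_trans (ltry (c ^+ 2)); apply: le_trans fc.
  apply: ge0_le_integral => //.
  - by apply/measurableT_comp => //; apply/measurable_EFinP; exact: measurable_funX.
  - by apply/measurable_EFinP; exact: measurable_funX.
  - by move=> x _ /=; rewrite lee_fin ger0_norm ?sqr_ge0.
split=> //; rewrite -(@ler_pXn2r _ 2)// ?nnegrE ?nrm_ge0// nrm_sqr -lee_fin.
by rewrite -meanE; [exact: fc|exact: f2.2].
Qed.

Lemma limn_einf_le (u : (\bar R)^nat) (c : \bar R) k :
  (forall m, (k <= m)%N -> (u m <= c)%E) -> (limn_einf u <= c)%E.
Proof.
move=> uc; rewrite limn_einf_lim; apply: lime_le.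
  exact: is_cvg_einfs.
apply: nearW => n; apply: le_trans (uc (maxn n k) (leq_maxr _ _)).
by apply: ereal_inf_lbound; exists (maxn n k) => //=; exact: leq_maxl.
Qed.

(* On the null set where the increasing sequence diverges, [h] is the junk value
   [fine +oo = 0]; Fatou's lemma still applies there because the right-hand side
   of the pointwise inequality is infinite. *)
Lemma sqint_nondecreasing_limit (F : nat -> T -> R) (eps : nat -> R) :
  (forall n, sqint P (F n)) -> (forall x, nondecreasing_seq (F ^~ x)) ->
  (forall k, 0 <= eps k) ->
  (forall k m, (k <= m)%N -> nrm P (fun x => F m x - F k x) <= eps k) ->
  exists2 h, sqint P h & forall k, nrm P (fun x => h x - F k x) <= eps k.
Proof.
move=> F2 ndF e0 Fe.
pose g x := ereal_sup (range (fun m => (F m x)%:E)).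
have Fg x : (F m x)%:E @[m --> \oo] --> g x.
  by apply: ereal_nondecreasing_cvgn => m n mn; rewrite lee_fin; exact: ndF.
have mg : measurable_fun setT g.
  apply: (emeasurable_fun_cvg (fun m x => (F m x)%:E)) => //.
  by move=> m; apply/measurable_EFinP; case: (F2 m).
pose h x := fine (g x).
have mh : measurable_fun setT h by apply: measurableT_comp => //; exact: fine_measurable.
have H k : sqint P (fun x => h x - F k x) /\ nrm P (fun x => h x - F k x) <= eps k.
  apply: integral_sqr_sqint => //.
    by apply: measurable_funB => //; case: (F2 k).
  have m2 m : measurable_fun setT (fun x => ((F m x - F k x) ^+ 2)%:E).
    apply/measurable_EFinP/measurable_funX/measurable_funB.
      by case: (F2 m).
    by case: (F2 k).
  apply: (@le_trans _ _ (\int[P]_x limn_einf (fun m => ((F m x - F k x)%R ^+ 2)%:E))%E).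
    apply: ge0_le_integral => //.
    - by move=> x _; rewrite lee_fin sqr_ge0.
    - apply/measurable_EFinP/measurable_funX/measurable_funB => //.
      by case: (F2 k).
    - under eq_fun do rewrite limn_einf_lim.
      apply: (emeasurable_fun_cvg (fun n x => einfs (fun m => ((F m x - F k x) ^+ 2)%:E) n)).
        by move=> n; apply: measurable_fun_einfs.
      by move=> x _; exact: is_cvg_einfs.
    move=> x _; have gF : ((F 0%N x)%:E <= g x)%E.
      by apply: ereal_sup_ubound; exists 0%N.
    have := Fg x; move: gF; rewrite /h; case: (g x) => [r||//] _ Fr /=.
      have /fine_cvgP[_ {}Fr] := Fr.
      rewrite (_ : limn_einf _ = ((r - F k x) ^+ 2)%:E) ?lexx//.
      apply: (cvg_limn_einf_sup _).1; apply: cvg_EFin; first exact: nearW.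
      rewrite /comp/= expr2; under eq_fun do rewrite expr2.
      by apply: cvgM; apply: cvgB => //; exact: cvg_cst.
    rewrite (_ : limn_einf _ = +oo%E) ?leey//.
    apply: (cvg_limn_einf_sup _).1; apply/cvgeyPge => A.
    (* A difference [F m x - F k x] of at least [|A| + 1] is at least 1, so its square is at least
       [|A|]. *)
    move: Fr => /cvgeyPge/(_ (F k x + `|A| + 1)); apply: filterS => m.
    rewrite !lee_fin => Fm; rewrite (le_trans (ler_norm A))//.
    by have := normr_ge0 A; nra.
  apply: (le_trans (fatou P measurableT m2 _)).
    by move=> m x _; rewrite lee_fin sqr_ge0.
  apply: (@limn_einf_le _ _ k) => m km.
  rewrite meanE; last by apply: (sqintB (F2 m) (F2 k)).2.
  rewrite lee_fin (_ : mean _ _ = nrm P (fun x => F m x - F k x) ^+ 2).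
    by rewrite lerXn2r ?nnegrE ?nrm_ge0// Fe.
  by rewrite nrm_sqr.
exists h => [|k]; last exact: (H k).2.
have := sqintD (H 0%N).1 (F2 0%N); congr sqint.
by apply: funext => x; rewrite subrK.
Qed.

Definition clip (n : nat) (x : R) : R := Num.max (- n%:R) (Num.min x n%:R).

Lemma bm_clip n f : measurable_fun setT f -> bounded_measurable (clip n \o f).
Proof.
move=> mf; split.
  apply: (@measurable_maxr _ _ _ _ (fun=> - n%:R) (fun x => Num.min (f x) n%:R)) => //.
  exact: (@measurable_minr _ _ _ _ f (fun=> n%:R)).
exists n%:R => x; rewrite ler_norml /clip/= le_max lexx/= ge_max ge_min lexx orbT andbT.
by rewrite (@le_trans _ _ 0)// ?ler0n// oppr_le0 ler0n.
Qed.

Lemma clip_dist n x : `|x - clip n x| <= `|x|.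
Proof.
rewrite /clip; have n0 : 0 <= n%:R :> R by rewrite ler0n.
rewrite maxElt minElt; have [h1|h1] := ltP x n%:R; case: ltP => h2;
  by rewrite ler_norml; have := ler_norm x; have := ler_norm (- x); rewrite normrN; lra.
Qed.

Lemma clip_norm_le n x : `|clip n x| <= `|x|.
Proof.
rewrite /clip; have n0 : 0 <= n%:R :> R by rewrite ler0n.
rewrite maxElt minElt; have [h1|h1] := ltP x n%:R; case: ltP => h2;
  by rewrite ler_norml; have := ler_norm x; have := ler_norm (- x); rewrite normrN; lra.
Qed.

Lemma clip_id n x : `|x| <= n%:R -> clip n x = x.
Proof.
rewrite ler_norml => /andP[h1 h2]; rewrite /clip (min_idPl h2).
exact/max_idPr.
Qed.

(** Truncations converge pointwise, and by [clip_dist] their squared errors are dominated by the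
    square of [f]. *)
Lemma bounded_measurable_dense f e : sqint P f -> 0 < e ->
  exists2 g, bounded_measurable g & nrm P (fun x => f x - g x) < e.
Proof.
move=> f2 e0.
have mc n : bounded_measurable (clip n \o f) by apply: bm_clip; case: f2.
have : (\int[P]_x ((f x - clip n (f x)) ^+ 2)%:E)%E @[n --> \oo] --> (\int[P]_x (cst 0 x))%E.
  apply: (@dominated_cvg _ _ _ _ _ measurableT _ _ (fun x => (f x ^+ 2)%:E)) => //.
  - move=> n; apply/measurable_EFinP/measurable_funX/measurable_funB; first by case: f2.
    by case: (mc n).
  - move=> x _; apply: cvg_near_cst.
    near=> n; rewrite clip_id ?subrr ?expr0n//.
    near: n; exact: nbhs_infty_ger.
  - exact: f2.2.
  - move=> n x _; rewrite lee_fin ger0_norm ?sqr_ge0//.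
    by rewrite -real_normK ?num_real// -[leRHS]real_normK ?num_real// lerXn2r ?nnegrE// clip_dist.
rewrite integral0 => /fine_cvgP[_] /cvgrPdist_lt/(_ (e ^+ 2)).
rewrite exprn_gt0// => /(_ isT)[N _ /(_ N (leqnn N))] /=.
rewrite sub0r normrN => H; exists (clip N \o f) => //.
rewrite -(@ltr_pXn2r _ 2)// ?nnegrE ?nrm_ge0// ?ltW// nrm_sqr.
rewrite /ip mean_fine; apply: le_lt_trans H.
exact: ler_norm.
Unshelve. all: by end_near. Qed.

End SquareIntegrableLimits.

(** * Autocovariances of a reversible chain *)

Section AutocovarianceSeries.
Context (R : realType).
Implicit Types a u : nat -> R.

Lemma cvg_half u (l : R) : u @ \oo --> l -> (u (n./2)) @[n --> \oo] --> l.
Proof.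
move=> ul; have h2 : (n./2) @[n --> \oo] --> \oo.
  apply/cvgnyPge => A; exists A.*2 => //= n /half_leq.
  by rewrite doubleK.
exact: (@cvg_comp _ _ _ _ u _ _ _ h2 ul).
Qed.

Lemma cvg_even_odd u (l : R) :
  u (k.*2) @[k --> \oo] --> l -> u (k.*2.+1) @[k --> \oo] --> l ->
  u @ \oo --> l.
Proof.
move=> /cvg_half u0 /cvg_half u1.
apply/cvgrPdist_lt => e e0.
move/cvgrPdist_lt : u0 => /(_ _ e0) u0; move/cvgrPdist_lt : u1 => /(_ _ e0) u1.
near=> n; have [on|en] := boolP (odd n).
  rewrite -(odd_double_half n) on add1n; near: n; exact: u1.
rewrite -(odd_double_half n) (negbTE en) add0n; near: n; exact: u0.
Unshelve. all: by end_near. Qed.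

Lemma arithmetic_meanE u n :
  arithmetic_mean u n = n.+1%:R^-1 * \sum_(0 <= k < n.+1) u k.
Proof. by []. Qed.

Lemma arithmetic_mean_sign : arithmetic_mean (fun n => (-1) ^+ n) @ \oo --> (0 : R).
Proof.
have E n : \sum_(0 <= k < n) (-1) ^+ k = (odd n)%:R :> R.
  elim: n => [|n ih]; first by rewrite big_geq.
  by rewrite big_nat_recr//= ih -signr_odd; case: (odd n); rewrite ?expr1 ?addrN ?add0r.
apply: (@squeeze_cvgr _ _ _ _ (fun=> 0) (@harmonic R)).
- apply: nearW => n; rewrite arithmetic_meanE E mulr_ge0//=.
  by rewrite ler_piMr// lern1 leq_b1.
- exact: cvg_cst.
- exact: cvg_harmonic.
Qed.

(** If [a k] is the integral of [x^k] against a positive measure on [[-1, 1]], this says that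
    [x^(2k)] and [x^(2k) (1 + x)] are nonnegative there and nonincreasing in [k]. An odd term alone
    has no sign, whence the pairing. *)
Definition even_odd_monotone a : Prop := forall k,
  [/\ 0 <= a k.*2, a k.*2.+2 <= a k.*2, 0 <= a k.*2 + a k.*2.+1 &
      a k.*2.+2 + a k.*2.+3 <= a k.*2 + a k.*2.+1].

(* If [a] is the autocovariance sequence of [h], this is
   [Var(h(X_1) + ... + h(X_(n+1))) / (n+1)]. *)
Definition avg_variance a (n : nat) : R :=
  a 0%N + 2 * arithmetic_mean (series (fun k => a k.+1)) n.

Lemma series_shift a n : series (fun k => a k.+1) n = series a n.+1 - a 0%N.
Proof. by rewrite !seriesEnat/= big_nat_recl// addrC addKr. Qed.

Lemma avg_varianceE a n :
  avg_variance a n =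
  2 * (n.+1%:R^-1 * \sum_(0 <= j < n.+1) series a j.+1) - a 0%N.
Proof.
rewrite /avg_variance arithmetic_meanE.
under eq_bigr do rewrite series_shift.
rewrite sumrB sumr_const_nat subn0 -[X in _ - X]mulr_natl.
by field.
Qed.

Lemma series_even_nd a : even_odd_monotone a ->
  nondecreasing_seq (fun m => series a m.*2).
Proof.
move=> ha; apply/nondecreasing_seqP => m; rewrite doubleS !seriesSr.
by have [_ _ + _] := ha m; lra.
Qed.

Lemma series_ge_even a : even_odd_monotone a ->
  forall n, series a (n./2).*2 <= series a n.
Proof.
move=> ha n; rewrite -{2}(odd_double_half n); case: (odd n); rewrite ?add0n//.
by rewrite add1n seriesSr; have [+ _ _ _] := ha n./2; lra.
Qed.

Lemma series_le_even a : even_odd_monotone a ->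
  forall n, series a n <= series a (n./2).*2 + a 0%N.
Proof.
move=> ha n.
have a0 k : a k.*2 <= a 0%N.
  elim: k => [//|k ih]; rewrite doubleS.
  by have [_ + _ _] := ha k; lra.
rewrite -{1}(odd_double_half n); case: (odd n).
  by rewrite add1n seriesSr lerD2l.
by rewrite add0n; have [+ _ _ _] := ha 0%N; rewrite double0; lra.
Qed.

Lemma series_ge0 a : even_odd_monotone a -> forall n, 0 <= series a n.
Proof.
move=> ha n; apply: le_trans (series_ge_even ha n).
have := series_even_nd ha (leq0n n./2).
by rewrite double0 /series/= big_geq.
Qed.

(** At least half of the [n + 1] partial sums in the Cesaro mean have index beyond [n / 2], and each
    of these is at least [t]. The others are nonnegative, and the factor 2 in [avg_varianceE]
    compensates for dropping them. *)
Lemma avg_variance_lower a : even_odd_monotone a ->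
  forall n, series a (n./2./2).*2 - a 0%N <= avg_variance a n.
Proof.
move=> ha n; rewrite avg_varianceE lerD2r mulrCA ler_pdivlMl ?ltr0n//.
set t := series a _.
have t0 : 0 <= t by exact: series_ge0.
rewrite (@big_cat_nat _ _ _ n./2) //=; last first.
  by lia.
have h1 : 0 <= \sum_(0 <= j < n./2) series a j.+1.
  by apply: sumr_ge0 => j _; exact: series_ge0.
have h2 : (n.+1 - n./2)%:R * t <= \sum_(n./2 <= j < n.+1) series a j.+1.
  rewrite mulr_natl -sumr_const_nat; apply: ler_sum_nat => j /andP[nj _].
  apply: le_trans (series_ge_even ha _); apply: (series_even_nd ha).
  by apply: half_leq; rewrite leqW.
have h3 : n.+1%:R <= 2 * (n.+1 - n./2)%:R :> R.
  by rewrite -natrM ler_nat mul2n; lia.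
nra.
Qed.

(** The even partial sums are nondecreasing, so they converge or tend to infinity, and the average
    variance follows them. The explicit upper bounds hold for every [n], not only in the limit; this
    makes the later approximations uniform in [n]. *)
Lemma avg_variance_cvg a : even_odd_monotone a ->
  (avg_variance a @ \oo --> +oo) \/
  exists s, [/\ series_sum (fun k => a k.+1) s,
    avg_variance a @ \oo --> a 0%N + 2 * s,
    forall n, avg_variance a n <= (a 0%N + 2 * s) + 2 * a 0%N &
    forall n, 0 <= series a n <= ((a 0%N + 2 * s) + 3 * a 0%N) / 2].
Proof.
move=> ha; have ndt := series_even_nd ha.
have [ct|dt] := pselect (cvgn (fun m => series a m.*2)); last first.
  left; have toy := nondecreasing_dvgn_lt ndt dt.
  apply/cvgryPge => A; move/cvgryPge : toy => /(_ (A + a 0%N)) [N _ HN].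
  exists (N.*2.*2) => //= n Nn.
  apply: le_trans (avg_variance_lower ha n); rewrite lerBrDr; apply: HN => /=.
  by rewrite -(doubleK N) -(doubleK N.*2) half_leq// half_leq.
right; set L := limn (fun m => series a m.*2) in ct.
have tL m : series a m.*2 <= L by apply: (nondecreasing_cvgn_le ndt ct).
have ca : cvgn (fun k => a k.*2).
  apply: nonincreasing_is_cvgn.
    by apply/nonincreasing_seqP => k; rewrite doubleS; have [] := ha k.
  by exists 0 => _ [k _ <-]; have [] := ha k.
set al := limn (fun k => a k.*2) in ca.
have al0 : 0 <= al by apply: limr_ge => //; apply: nearW => k; have [] := ha k.
(* The partial sums of [a 1 + a 2 + ...] tend to [L + al - a 0] along even indices and to [L - a 0]
   along odd ones. [l] is the midpoint, and [w] removes the alternating part, whose Cesaro means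
   vanish. *)
pose l := L + al / 2 - a 0%N.
pose w j := series (fun k => a k.+1) j - al / 2 * (-1) ^+ j.
have sgn_even k : (-1) ^+ k.*2 = 1 :> R by rewrite -mul2n exprM sqrrN !expr1n.
have wl : w @ \oo --> l.
  apply: cvg_even_odd.
    rewrite /w; under eq_fun do rewrite series_shift seriesSr sgn_even mulr1.
    rewrite (_ : l = L + al - a 0%N - al / 2); last by rewrite /l; field.
    apply: cvgB; last exact: cvg_cst.
    by apply: cvgB; [exact: cvgD|exact: cvg_cst].
  rewrite /w; under eq_fun do rewrite series_shift exprS sgn_even mulr1 mulrN1 opprK -doubleS.
  rewrite (_ : l = L - a 0%N + al / 2); last by rewrite /l; field.
  apply: cvgD; last exact: cvg_cst.
  apply: cvgB; last exact: cvg_cst.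
  by rewrite (cvg_shiftS (fun m => series a m.*2)).
have Cl : arithmetic_mean (series (fun k => a k.+1)) @ \oo --> l.
  rewrite (_ : arithmetic_mean _ = (fun n => arithmetic_mean w n +
     al / 2 * arithmetic_mean (fun n => (-1) ^+ n) n)); last first.
    apply/funext => n; rewrite !arithmetic_meanE /w sumrB mulrBr -mulr_sumr.
    by ring.
  rewrite -[l]addr0; apply: cvgD; first exact: cesaro.
  rewrite -[0](mulr0 (al / 2)); apply: cvgM; first exact: cvg_cst.
  exact: arithmetic_mean_sign.
have Ql : avg_variance a @ \oo --> a 0%N + 2 * l.
  apply: cvgD; first exact: cvg_cst.
  by apply: cvgM => //; exact: cvg_cst.
(* With [v = a 0 + 2 * l], in fact [2 L = v + a 0 - al]. Both upper bounds follow, since every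
   partial sum is at most [L + a 0]. *)
have LE : L <= ((a 0%N + 2 * l) + a 0%N) / 2 by rewrite /l; lra.
exists l; split => //.
- split=> // u0.
  have al00 : al = 0.
    apply: (@cvg_unique _ _ ((fun k => a k.*2) @ \oo)) => //=.
    rewrite -(cvg_shiftS (fun k => a k.*2)) /=.
    apply: (@cvg_comp _ _ _ (fun k => k.*2.+1) (fun k => a k.+1) _ _ _ _ u0).
    apply/cvgnyPge => A; exists A => // n /= An.
    by apply: leq_trans An _; rewrite -addnn ltnW// ltnS leq_addr.
  by move: wl; rewrite /w al00; under eq_fun do rewrite mul0r mul0r subr0.
- move=> n; rewrite avg_varianceE.
  have : n.+1%:R^-1 * \sum_(0 <= j < n.+1) series a j.+1 <= L + a 0%N.
    rewrite ler_pdivrMl ?ltr0n// -[n.+1 in leRHS]subn0 mulr_natl -sumr_const_nat.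
    apply: ler_sum_nat => j _; apply: (le_trans (series_le_even ha _)).
    by rewrite lerD2r.
  by move: (_ * \sum_(_ <= _ < _) _) => m; lra.
- move=> n; rewrite series_ge0//=.
  apply: (le_trans (series_le_even ha _)).
  by have := tL (n./2); lra.
Qed.

End AutocovarianceSeries.

(* [P x] itself is canonically a measure only. *)
Definition transition (R : realType) (d : measure_display)
    (T : measurableType d) (P : R.-pker T ~> T) (x : T) : set T -> \bar R := P x.

HB.instance Definition _ (R : realType) (d : measure_display)
    (T : measurableType d) (P : R.-pker T ~> T) (x : T) :=
  Measure.copy (transition P x) (P x).

HB.instance Definition _ (R : realType) (d : measure_display)
    (T : measurableType d) (P : R.-pker T ~> T) (x : T) :=
  Measure_isProbability.Build _ _ _ (transition P x) (@prob_kernel _ _ _ _ _ P x).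

(** * Induction over bounded measurable functions *)

Section BoundedMeasurableInduction.
Context (R : realType) (d : measure_display) (T : measurableType d).
Implicit Types f g : T -> R.

Lemma sum_indic_floor (y : R) M : 0 <= y -> y <= M%:R ->
  `|y - \sum_(1 <= j < M.+1) (j%:R <= y :> R)%:R| <= 1.
Proof.
move=> y0 yM; pose t := Num.trunc y.
have /andP[ty yt] := truncn_itv y0.
have tM : (t <= M)%N by rewrite -(ler_nat R); exact: le_trans ty yM.
have -> : \sum_(1 <= j < M.+1) (j%:R <= y :> R)%:R = t%:R :> R.
  rewrite (@big_cat_nat _ _ _ t.+1)//= [X in _ + X]big_nat_cond [X in _ + X]big1 ?addr0.
    rewrite big_nat_cond (eq_bigr (fun=> 1)).
      by rewrite -big_nat_cond sumr_const_nat subn1.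
    by move=> j /andP[/andP[_ jt] _]; rewrite -truncn_ge_nat// -ltnS jt.
  by move=> j /andP[/andP[tj _] _]; rewrite -truncn_ge_nat// leqNgt tj.
rewrite ger0_norm ?subr_ge0// lerBlDr.
by rewrite -natr1 addrC in yt; exact: ltW.
Qed.

(** Uniform approximation by finite step functions takes the place of a monotone class argument, so
    the principle applies to functionals for which no monotone continuity has been established. *)
Lemma bounded_measurable_ind (H : (T -> R) -> Prop) :
  (forall A, measurable A -> H (\1_A : T -> R)) ->
  (forall f g, bounded_measurable f -> bounded_measurable g -> H f -> H g ->
     H (fun x => f x + g x)) ->
  (forall c f, bounded_measurable f -> H f -> H (fun x => c * f x)) ->
  (forall f, bounded_measurable f -> (forall e : R, 0 < e -> exists g,
     [/\ bounded_measurable g, H g & forall x, `|f x - g x| <= e]) -> H f) ->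
  forall f, bounded_measurable f -> H f.
Proof.
move=> HI HD HZ HL f bf; apply: HL => // e e0.
have [mf [b fb]] := bf.
pose N := (Num.trunc e^-1).+1; have N0 : 0 < N%:R :> R by rewrite ltr0n.
have Ne : N%:R^-1 <= e.
  by rewrite -[leRHS]invrK lef_pV2 ?posrE ?invr_gt0// ltW// truncnS_gt.
have bI A : measurable A -> bounded_measurable (\1_A : T -> R).
  move=> mA; split; first exact: measurable_indic.
  by exists 1 => x; rewrite indicE; case: (x \in A); rewrite ?normr1 ?normr0.
pose M := (Num.trunc (N%:R * (b + b))).+1.
pose A j := [set x | j%:R <= N%:R * (f x + b)].
have mA j : measurable (A j).
  rewrite -[A j]setTI; apply: (@measurable_fun_le _ _ _ setT (fun=> j%:R) (fun x => N%:R * (f x + b))) => //.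
  by apply: measurable_funM => //; exact: measurable_funD.
have bS r : bounded_measurable (fun x => \sum_(j <- r) (\1_(A j) : T -> R) x) /\
    H (fun x => \sum_(j <- r) (\1_(A j) : T -> R) x).
  elim: r => [|j r [ih1 ih2]].
    under eq_fun do rewrite big_nil; split; first exact: bm_cst.
    have -> : (fun=> 0) = (fun x => 0 * (\1_setT : T -> R) x).
      by apply: funext => x; rewrite mul0r.
    by apply: HZ; [exact: bI|exact: HI].
  under eq_fun do rewrite big_cons; split; first by apply: bmD => //; exact: bI.
  by apply: HD => //; [exact: bI|exact: HI].
(* For [j >= 1] the level sets [A j] count the integer part of [N (f + b)]. Dividing by [N] and
   subtracting [b] recovers [f] up to [1 / N <= e]. *)
pose S x := \sum_(j <- index_iota 1 M.+1) (\1_(A j) : T -> R) x.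
exists (fun x => N%:R^-1 * S x + (- b) * (\1_setT : T -> R) x); split.
- apply: bmD; first by apply: bmM; [exact: bm_cst|exact: (bS _).1].
  by apply: bmM; [exact: bm_cst|exact: bI].
- apply: HD.
  + by apply: bmM; [exact: bm_cst|exact: (bS _).1].
  + by apply: bmM; [exact: bm_cst|exact: bI].
  + by apply: HZ; [exact: (bS _).1|exact: (bS _).2].
  + by apply: HZ; [exact: bI|exact: HI].
move=> x; rewrite indicT/= mulr1; apply: le_trans Ne.
have -> : f x - (N%:R^-1 * S x + - b) = N%:R^-1 * (N%:R * (f x + b) - S x).
  by field; rewrite gt_eqF.
have N1 : 0 <= N%:R^-1 :> R by rewrite invr_ge0 ltW.
rewrite normrM ger0_norm// ler_piMr//.
have -> : S x = \sum_(1 <= j < M.+1) (j%:R <= N%:R * (f x + b) :> R)%:R.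
  apply: eq_bigr => j _; rewrite indicE; congr (_%:R); congr nat_of_bool.
  by apply/idP/idP; rewrite inE.
have /andP[f1 f2] : - b <= f x <= b by rewrite -ler_norml.
apply: sum_indic_floor.
  by apply: mulr_ge0; [exact: ltW|lra].
apply: (@le_trans _ _ (N%:R * (b + b))); first by apply: ler_wpM2l; [exact: ltW|lra].
by rewrite ltW// truncnS_gt.
Qed.

End BoundedMeasurableInduction.

Section MeanApproximation.
Context (R : realType) (d : measure_display) (T : measurableType d).
Variable P : probability T R.
Implicit Types f g : T -> R.

Lemma mean_indic A : measurable A -> mean P (\1_A : T -> R) = fine (P A).
Proof. by move=> mA; rewrite mean_fine integral_indic// setIT. Qed.

Lemma mean_unif f g e : bounded_measurable f -> bounded_measurable g ->
  (forall x, `|f x - g x| <= e) -> `|mean P f - mean P g| <= e.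
Proof.
move=> bf bg fg; rewrite -meanB; try exact: bm_integr.
rewrite -[leRHS](mean_cst P); apply: norm_mean_le => //.
  by apply: bm_integr; exact: bmB.
exact: integr_cst.
Qed.

End MeanApproximation.

(** * Markov operators and stationary chains *)

Section BoundedFunctionals.
Context (R : realType) (d : measure_display) (T : measurableType d).
Implicit Types (f g : T -> R) (L : (T -> R) -> R).

Definition bounded_functional L : Prop := [/\
  forall f g, bounded_measurable f -> bounded_measurable g ->
    L (fun x => f x + g x) = L f + L g,
  forall c f, bounded_measurable f -> L (fun x => c * f x) = c * L f &
  exists C : R, forall f g (e : R), bounded_measurable f -> bounded_measurable g ->
    (forall x, `|f x - g x| <= e) -> `|L f - L g| <= C * e].

(** Reversibility and the Markov property are given for sets. Both sides of the corresponding
    identities for functions are such functionals in each argument separately, so two applications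
    extend them from pairs of indicators. *)
Lemma bounded_functional_ext L1 L2 :
  bounded_functional L1 -> bounded_functional L2 ->
  (forall A, measurable A -> L1 (\1_A : T -> R) = L2 (\1_A : T -> R)) ->
  forall f, bounded_measurable f -> L1 f = L2 f.
Proof.
move=> [D1 Z1 [C1 B1]] [D2 Z2 [C2 B2]] LI.
apply: bounded_measurable_ind => //.
- by move=> f g bf bg Hf Hg; rewrite D1// D2// Hf Hg.
- by move=> c f bf Hf; rewrite Z1// Z2// Hf.
move=> f bf Hf; apply/eqP; rewrite -subr_eq0 -normr_le0.
apply/ler_addgt0Pr => e e0; rewrite add0r.
pose C := `|C1| + `|C2| + 1.
have C0 : 0 < C by rewrite /C ltr_pwDr// addr_ge0.
have [g [bg Lg fg]] := Hf (e / C) (divr_gt0 e0 C0).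
have -> : L1 f - L2 f = (L1 f - L1 g) - (L2 f - L2 g) by rewrite Lg; ring.
apply: (le_trans (ler_normB _ _)).
apply: (@le_trans _ _ (C1 * (e / C) + C2 * (e / C))).
  by apply: lerD; [exact: B1|exact: B2].
rewrite -mulrDl -[leRHS](@divfK _ C) ?gt_eqF// [leRHS]mulrC.
apply: ler_wpM2r; first by rewrite ltW// divr_gt0.
by rewrite /C; have := ler_norm C1; have := ler_norm C2; lra.
Qed.

Lemma bounded_functional_mul (d' : measure_display) (T' : measurableType d')
    (P : probability T' R) (F : (T -> R) -> T' -> R) (h : T' -> R) :
  bounded_measurable h ->
  (forall f, bounded_measurable f -> bounded_measurable (F f)) ->
  (forall f g, bounded_measurable f -> bounded_measurable g ->
    F (fun x => f x + g x) = (fun x => F f x + F g x)) ->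
  (forall c f, bounded_measurable f -> F (fun x => c * f x) = (fun x => c * F f x)) ->
  (exists C : R, forall f g (e : R), bounded_measurable f -> bounded_measurable g ->
    (forall x, `|f x - g x| <= e) -> forall x, `|F f x - F g x| <= C * e) ->
  bounded_functional (fun f => mean P (fun x => F f x * h x)).
Proof.
move=> bh Fb FD FZ [C FC]; have [mh [b hb]] := bh; split.
- move=> f g bf bg; rewrite FD// -meanD; try by apply: bm_integr; apply: bmM => //; exact: Fb.
  by apply: eq_mean => x; rewrite mulrDl.
- move=> c f bf; rewrite FZ// -meanZ; last by apply: bm_integr; apply: bmM => //; exact: Fb.
  by apply: eq_mean => x; rewrite mulrA.
exists (b * C) => f g e bf bg fg; rewrite -mulrA mulrC.
apply: mean_unif; try by apply: bmM => //; exact: Fb.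
by move=> x; rewrite -mulrBl normrM ler_pM//; exact: FC.
Qed.

End BoundedFunctionals.

Section MarkovOperator.
Context (R : realType) (d : measure_display) (T : measurableType d).
Variables (P : R.-pker T ~> T) (pi : probability T R).
Implicit Types f g : T -> R.

Definition Pop f (x : T) : R := mean (transition P x) f.

Lemma Pop_indic A x : measurable A -> Pop (\1_A) x = fine (P x A).
Proof. by move=> mA; rewrite /Pop mean_indic. Qed.

Lemma Pop_unif f g e : bounded_measurable f -> bounded_measurable g ->
  (forall x, `|f x - g x| <= e) -> forall x, `|Pop f x - Pop g x| <= e.
Proof. by move=> *; exact: mean_unif. Qed.

Lemma PopD f g : bounded_measurable f -> bounded_measurable g ->
  Pop (fun x => f x + g x) = (fun x => Pop f x + Pop g x).
Proof. by move=> *; apply: funext => x; apply: meanD; exact: bm_integr. Qed.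

Lemma PopZ c f : bounded_measurable f ->
  Pop (fun x => c * f x) = (fun x => c * Pop f x).
Proof. by move=> *; apply: funext => x; apply: meanZ; exact: bm_integr. Qed.

Lemma Pop_cst c : Pop (fun=> c) = (fun=> c).
Proof. by apply: funext => x; exact: mean_cst. Qed.

Lemma Pop_norm_le f b : bounded_measurable f -> (forall x, `|f x| <= b) ->
  forall x, `|Pop f x| <= b.
Proof.
move=> bf fb x; rewrite -[Pop f x]subr0 -[0](mean_cst (transition P x)).
by apply: mean_unif => //; [exact: bm_cst|move=> y; rewrite subr0].
Qed.

Lemma bm_Pop f : bounded_measurable f -> bounded_measurable (Pop f).
Proof.
move=> bf; have [mf [b fb]] := bf; split; last by exists b; exact: Pop_norm_le.
(* Shifting by [b] makes the integrand nonnegative, as [measurable_fun_integral_kernel] requires. *)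
have -> : Pop f = (fun x => Pop (fun y => f y + b) x - b).
  by apply: funext => x; rewrite PopD ?Pop_cst ?addrK//; exact: bm_cst.
apply: measurable_funB => //.
rewrite /Pop; under eq_fun do rewrite mean_fine.
apply: measurableT_comp; first exact: fine_measurable.
apply: (measurable_fun_integral_kernel (l := P)).
- by move=> U mU; exact: measurable_kernel.
- by move=> y; rewrite lee_fin; have := fb y; rewrite ler_norml; lra.
- by apply/measurable_EFinP; exact: measurable_funD.
Qed.

Lemma Pop_sqr_le f x : bounded_measurable f ->
  Pop f x ^+ 2 <= Pop (fun y => f y ^+ 2) x.
Proof. by move=> bf; apply: mean_sqr_le; exact: bm_sqint. Qed.

Hypothesis hrev : reversible P pi.

Lemma Pop_sym f g : bounded_measurable f -> bounded_measurable g ->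
  ip pi (Pop f) g = ip pi f (Pop g).
Proof.
move=> bf bg.
have bI A : measurable A -> bounded_measurable (\1_A : T -> R).
  move=> mA; split; first exact: measurable_indic.
  by exists 1 => x; rewrite indicE; case: (x \in A); rewrite ?normr1 ?normr0.
have FL h : bounded_measurable h ->
    bounded_functional (fun f => ip pi (Pop f) h) /\
    bounded_functional (fun f => ip pi f h).
  move=> bh; split.
    apply: bounded_functional_mul => //.
    - exact: bm_Pop.
    - exact: PopD.
    - exact: PopZ.
    - by exists 1 => f1 f2 e b1 b2 fe x; rewrite mul1r; exact: Pop_unif.
  apply: bounded_functional_mul => //.
  by exists 1 => f1 f2 e b1 b2 fe x; rewrite mul1r.
have FLr h : bounded_measurable h ->
    bounded_functional (fun f => ip pi h (Pop f)) /\
    bounded_functional (fun f => ip pi h f).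
  move=> bh; have [] := FL _ bh.
  rewrite (_ : (fun f => ip pi (Pop f) h) = (fun f => ip pi h (Pop f))).
    rewrite (_ : (fun f => ip pi f h) = (fun f => ip pi h f)) => [//|].
    by apply: funext => f'; rewrite ipC.
  by apply: funext => f'; rewrite ipC.
move: f bf; apply: bounded_functional_ext.
- exact: (FL _ bg).1.
- exact: (FL _ (bm_Pop bg)).2.
move=> A mA; move: g bg; apply: bounded_functional_ext.
- exact: (FLr _ (bm_Pop (bI _ mA))).2.
- exact: (FLr _ (bI _ mA)).1.
move=> B mB.
have E (A1 B1 : set T) : measurable A1 -> measurable B1 ->
    ip pi (Pop \1_A1) \1_B1 = fine (\int[pi]_(x in B1) P x A1)%E.
  move=> mA1 mB1; rewrite integral_mkcond /ip mean_fine; congr fine.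
  apply: eq_integral => x _; rewrite Pop_indic// patchE indicE.
  case: ifPn => _ /=; last by rewrite mulr0.
  by rewrite mulr1 fineK// (fin_num_measure (transition P x)).
by rewrite E// [RHS]ipC E// hrev.
Qed.

Lemma mean_Pop f : bounded_measurable f -> mean pi (Pop f) = mean pi f.
Proof.
move=> bf; have := Pop_sym bf (bm_cst T 1); rewrite /ip Pop_cst.
by under [LHS]eq_mean do rewrite mulr1; under [RHS]eq_mean do rewrite mulr1.
Qed.

(** Jensen's inequality for each [P x], followed by invariance of [pi]. *)
Lemma ip_Pop_le f : bounded_measurable f -> ip pi (Pop f) (Pop f) <= ip pi f f.
Proof.
move=> bf; have b2 := bmX2 bf.
apply: (@le_trans _ _ (mean pi (Pop (fun x => f x ^+ 2)))).
  apply: le_mean.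
  - by apply: bm_integr; apply: bmM; exact: bm_Pop.
  - by apply: bm_integr; exact: bm_Pop.
  - by move=> x; rewrite -expr2 Pop_sqr_le.
by rewrite mean_Pop.
Qed.

Lemma ip_Pop_norm_le f : bounded_measurable f -> `|ip pi (Pop f) f| <= ip pi f f.
Proof.
move=> bf; apply: le_trans (ip_le (bm_sqint _ (bm_Pop bf)) (bm_sqint _ bf)) _.
rewrite -[leRHS]nrm_sqr expr2 ler_wpM2r ?nrm_ge0// ler_sqrt ?ip_ge0//.
exact: ip_Pop_le.
Qed.

Lemma bm_iter_Pop k f : bounded_measurable f -> bounded_measurable (iter k Pop f).
Proof. by move=> bf; elim: k => //= k; exact: bm_Pop. Qed.

Lemma ip_iter_Pop i j f g : bounded_measurable f -> bounded_measurable g ->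
  ip pi (iter i Pop f) (iter j Pop g) = ip pi (iter (i + j) Pop f) g.
Proof.
move=> bf bg; elim: j i => [|j ih] i; first by rewrite addn0.
rewrite iterS -Pop_sym; try exact: bm_iter_Pop.
by rewrite -iterS ih addSnnS.
Qed.

Lemma even_odd_monotone_bm f : bounded_measurable f ->
  even_odd_monotone (fun k => ip pi (iter k Pop f) f).
Proof.
move=> bf k.
have E i j n : (i + j)%N = n ->
    ip pi (iter n Pop f) f = ip pi (iter i Pop f) (iter j Pop f).
  by move=> <-; rewrite ip_iter_Pop.
pose u := iter k Pop f; have bu : bounded_measurable u by exact: bm_iter_Pop.
have bPu := bm_Pop bu; have bPPu := bm_Pop bPu.
have su := bm_sqint pi bu; have sPu := bm_sqint pi bPu; have sPPu := bm_sqint pi bPPu.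
have E0 := E k k k.*2 (addnn k).
have E1 := E k.+1 k k.*2.+1 (congr1 S (addnn k)).
have E2 : ip pi (iter k.*2.+2 Pop f) f = ip pi (Pop u) (Pop u).
  by apply: (E k.+1 k.+1); rewrite addSn addnS addnn.
have E3 : ip pi (iter k.*2.+3 Pop f) f = ip pi (Pop (Pop u)) (Pop u).
  by apply: (E k.+2 k.+1); rewrite !addSn addnS addnn.
rewrite /= -/u in E0 E1.
have h0 := ip_ge0 pi u; have h1 := ip_Pop_le bu; have h2 := ip_Pop_norm_le bu.
(* For [w = u + P u], expanding [<P w, w> <= <w, w>] and cancelling gives exactly the monotonicity
   of [a (2k) + a (2k+1)]. The lower bound [- <u, u> <= <P u, u>] gives its nonnegativity. *)
have bw := bmD bu bPu; have := ip_Pop_norm_le bw.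
rewrite PopD// ipDD//.
have swPu : sqint pi (fun x => u x + Pop u x) by exact: sqintD.
rewrite ipDl// !ipDr//.
have s1 := Pop_sym bPu bu; have s2 := ipC pi u (Pop u).
move: E0 E1 E2 E3 h0 h1 h2 s1 s2.
move: (ip _ (iter k.*2 _ _) _) (ip _ (iter k.*2.+1 _ _) _) (ip _ (iter k.*2.+2 _ _) _)
  (ip _ (iter k.*2.+3 _ _) _) => a0 a1 a2 a3.
move: (ip pi u u) (ip pi u (Pop u)) (ip pi (Pop u) u) (ip pi (Pop u) (Pop u))
  (ip pi (Pop (Pop u)) u) (ip pi (Pop (Pop u)) (Pop u)) => x1 x2 x3 x4 x5 x6.
move=> -> -> -> -> h0 h1; rewrite !ler_norml => /andP[h2 _] s1 s2 /andP[_ h3].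
by split; lra.
Qed.

End MarkovOperator.

Section StationaryChain.
Context (R : realType) (d d' : measure_display).
Context (T : measurableType d) (W : measurableType d').
Variables (P : R.-pker T ~> T) (pi : probability T R) (Pr : probability W R).
Variable X : nat -> {RV Pr >-> T}.
Hypotheses (hrev : reversible P pi) (hX : markov_chain P pi X).
Implicit Types f g h : T -> R.

(** The sample space with the sigma-algebra of [X 0, ..., X n] is made a type of its own, so that a
    type ascription [Phi : past n -> R] expresses measurability with respect to the past. *)
Definition past (n : nat) : measurableType _ :=
  g_sigma_algebraType (\bigcup_(k in `I_n.+1) preimage_set_system setT (X k) measurable).

Lemma historyE n (E : set W) :
  history (fun k w => X k w) n E = measurable (E : set (past n)).
Proof. by []. Qed.

Lemma history_measurable n (E : set W) :
  history (fun k w => X k w) n E -> measurable E.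
Proof.
apply: smallest_sub; first exact: sigma_algebra_measurable.
by move=> _ [k _ [B mB <-]]; exact: measurable_funPT.
Qed.

Lemma past_measurable_X n k : (k <= n)%N ->
  measurable_fun setT (X k : past n -> T).
Proof.
move=> kn _ B mB; apply: sub_sigma_algebra; exists k => //=.
by exists B.
Qed.

Lemma past_measurable_fun n (Phi : W -> R) :
  measurable_fun setT (Phi : past n -> R) -> measurable_fun setT Phi.
Proof.
move=> mPhi mT B mB; apply: (@history_measurable n).
exact: mPhi.
Qed.

Lemma past_bm n (Phi : W -> R) :
  bounded_measurable (Phi : past n -> R) -> bounded_measurable Phi.
Proof. by move=> [mPhi ?]; split => //; exact: past_measurable_fun mPhi. Qed.

Lemma chain_law n (B : set T) : measurable B -> Pr (X n @^-1` B) = pi B.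
Proof.
elim: n B => [|n ih] B mB; first exact: hX.1.
have := hX.2 n setT B; rewrite setTI => -> //; last first.
  by rewrite historyE; exact: measurableT.
transitivity (\int[distribution Pr (X n)]_y P y B)%E.
  rewrite ge0_integral_distribution//.
  exact: measurable_kernel.
rewrite (eq_measure_integral pi); last by move=> A mA _; exact: ih.
(* Reversibility against the whole space is invariance, because [P x] has total mass 1. *)
have := hrev measurableT mB; rewrite /= => ->.
under eq_integral do rewrite prob_kernel.
by rewrite integral_cst// mul1e.
Qed.

Lemma chain_integral n (F : T -> \bar R) : measurable_fun setT F ->
  (forall x, 0 <= F x)%E -> (\int[Pr]_w F (X n w) = \int[pi]_x F x)%E.
Proof.
move=> mF F0; rewrite -[LHS](ge0_integral_distribution (X n) mF F0).
by apply: eq_measure_integral => A mA _; exact: chain_law.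
Qed.

Lemma chain_comp_meas n f : measurable_fun setT f -> measurable_fun setT (f \o X n).
Proof. by move=> mf; exact: measurableT_comp. Qed.

Lemma chain_integr n f : measurable_fun setT f ->
  integr Pr (f \o X n) <-> integr pi f.
Proof.
move=> mf; have mF : measurable_fun setT (fun x => `|(f x)%:E|)%E.
  by apply: measurableT_comp => //; exact/measurable_EFinP.
split=> /integrableP[_ fi]; apply/integrableP; split.
- exact/measurable_EFinP.
- by rewrite -(chain_integral n mF).
- exact/measurable_EFinP/chain_comp_meas.
- by rewrite (chain_integral n mF).
Qed.

Lemma chain_mean n f : integr pi f -> mean Pr (f \o X n) = mean pi f.
Proof.
move=> fi; have mf := integr_meas fi; rewrite !mean_fine; congr fine.
rewrite -[LHS](integral_distribution (f := EFin \o f)) //.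
- by apply: eq_measure_integral => A mA _; exact: chain_law.
- exact/measurable_EFinP.
- by apply/(chain_integr n mf).
Qed.

Lemma chain_sqint n f : measurable_fun setT f ->
  sqint Pr (f \o X n) <-> sqint pi f.
Proof.
move=> mf; have m2 : measurable_fun setT (fun x => f x ^+ 2) by exact: measurable_funX.
split=> -[m fi]; split => //.
- exact: (chain_integr n m2).1 fi.
- exact: chain_comp_meas.
- exact: (chain_integr n m2).2 fi.
Qed.

Lemma chain_bm n f : bounded_measurable f -> bounded_measurable (f \o X n).
Proof.
by move=> [mf [b fb]]; split; [exact: chain_comp_meas|exists b => w; exact: fb].
Qed.

Lemma chain_ip n f g : sqint pi f -> sqint pi g ->
  ip Pr (f \o X n) (g \o X n) = ip pi f g.
Proof. by move=> f2 g2; apply: (chain_mean n); exact: sqintM. Qed.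

Lemma chain_nrm n f : sqint pi f -> nrm Pr (f \o X n) = nrm pi f.
Proof. by move=> f2; rewrite /nrm chain_ip. Qed.

Lemma markov_property n (Phi : W -> R) f :
  bounded_measurable (Phi : past n -> R) -> bounded_measurable f ->
  mean Pr (fun w => Phi w * f (X n.+1 w)) = mean Pr (fun w => Phi w * Pop P f (X n w)).
Proof.
move=> bPhi bf.
have bI (A : set (past n)) : measurable A -> bounded_measurable (\1_A : past n -> R).
  move=> mA; split; first exact: measurable_indic.
  by exists 1 => x; rewrite indicE; case: (x \in A); rewrite ?normr1 ?normr0.
have FT (Psi : W -> R) : bounded_measurable Psi ->
    bounded_functional (fun f => mean Pr (fun w => Psi w * f (X n.+1 w))) /\
    bounded_functional (fun f => mean Pr (fun w => Psi w * Pop P f (X n w))).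
  move=> bPsi.
  rewrite (_ : (fun f => mean Pr (fun w => Psi w * f (X n.+1 w))) =
     (fun f => mean Pr (fun w => f (X n.+1 w) * Psi w))); last first.
    by apply: funext => f'; apply: eq_mean => w; rewrite mulrC.
  rewrite (_ : (fun f => mean Pr (fun w => Psi w * Pop P f (X n w))) =
     (fun f => mean Pr (fun w => Pop P f (X n w) * Psi w))); last first.
    by apply: funext => f'; apply: eq_mean => w; rewrite mulrC.
  split; apply: bounded_functional_mul => //.
  - by move=> f' bf'; exact: chain_bm.
  - by exists 1 => f1 f2 e _ _ fe w; rewrite mul1r.
  - by move=> f' bf'; apply: chain_bm; exact: bm_Pop.
  - by move=> f1 f2 b1 b2; rewrite PopD.
  - by move=> c f1 b1; rewrite PopZ.
  - by exists 1 => f1 f2 e b1 b2 fe w; rewrite mul1r; exact: Pop_unif.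
have FW (g : W -> R) : bounded_measurable g ->
    bounded_functional (fun Phi : past n -> R => mean Pr (fun w => Phi w * g w)).
  move=> bg; apply: (@bounded_functional_mul R _ (past n) _ W Pr (fun Phi => Phi)) => //.
    by move=> f'; exact: past_bm.
  by exists 1 => f1 f2 e _ _ fe w; rewrite mul1r.
move: Phi bPhi; apply: (@bounded_functional_ext R _ (past n)
  (fun Phi => mean Pr (fun w => Phi w * f (X n.+1 w)))
  (fun Phi => mean Pr (fun w => Phi w * Pop P f (X n w)))).
- by apply: FW; exact: chain_bm.
- by apply: FW; apply: chain_bm; exact: bm_Pop.
move=> E mE; have mE' : measurable (E : set W) by exact: (@history_measurable n).
move: f bf; apply: (@bounded_functional_ext R _ T
  (fun f => mean Pr (fun w => (\1_E : past n -> R) w * f (X n.+1 w)))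
  (fun f => mean Pr (fun w => (\1_E : past n -> R) w * Pop P f (X n w)))).
- by apply: (FT _ _).1; apply: past_bm; exact: bI.
- by apply: (FT _ _).2; apply: past_bm; exact: bI.
move=> B mB.
transitivity (fine (Pr (E `&` X n.+1 @^-1` B))).
  rewrite -mean_indic; last first.
    by apply: measurableI => //; exact: measurable_funPTI.
  by apply: eq_mean => w; rewrite indicI/= !indicE.
rewrite (hX.2 n E B)// integral_mkcond mean_fine; congr fine.
apply: eq_integral => w _; rewrite Pop_indic// patchE indicE.
case: ifPn => _ /=; last by rewrite mul0r.
by rewrite mul1r fineK// (fin_num_measure (transition P _)).
Qed.

Lemma chain_cov_bm i k f g : bounded_measurable f -> bounded_measurable g ->
  ip Pr (f \o X i) (g \o X (i + k)%N) = ip pi (iter k (Pop P) g) f.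
Proof.
elim: k g => [|k ih] g bf bg.
  by rewrite addn0 (chain_ip i (bm_sqint pi bf) (bm_sqint pi bg)) ipC.
rewrite iterSr -(ih (Pop P g) bf (bm_Pop P bg)) addnS.
have bfi : bounded_measurable ((f \o X i) : past (i + k) -> R).
  have [mf [b fb]] := bf; split; last by exists b => w; exact: fb.
  by apply: measurableT_comp => //; apply: past_measurable_X; exact: leq_addr.
exact: (markov_property bfi bg).
Qed.

(** A product moment without centring: it is the autocovariance when [h] has mean zero, so general
    [h] enter through [center h]. *)
Definition acov h (k : nat) : R := ip Pr (h \o X 0%N) (h \o X k).

Lemma chain_cov_bm_acov i k f : bounded_measurable f ->
  ip Pr (f \o X i) (f \o X (i + k)%N) = acov f k.
Proof. by move=> bf; rewrite chain_cov_bm// /acov -[k in RHS]add0n chain_cov_bm. Qed.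

(** One [f] serves all [i] and [j], because [h (X i) - f (X i)] has the same norm for every [i].
    Closed relations between finitely many covariances thus pass from bounded to square-integrable
    functions. *)
Lemma chain_ip_approx h e : sqint pi h -> 0 < e ->
  exists2 f, bounded_measurable f &
  forall i j, `|ip Pr (h \o X i) (h \o X j) - ip Pr (f \o X i) (f \o X j)| <= e.
Proof.
(* The error will be at most [dl |h| + (|h| + dl) dl], hence at most [dl * C] as soon as
   [dl <= 1]. *)
move=> h2 e0; pose C := 2 * nrm pi h + 1.
have C0 : 0 < C by rewrite /C ltr_wpDl// mulr_ge0// nrm_ge0.
pose dl := Num.min 1 (e / C).
have dl0 : 0 < dl by rewrite lt_min ltr01 divr_gt0.
have [f bf hf] := bounded_measurable_dense h2 dl0.
have f2 := bm_sqint pi bf.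
have nf : nrm pi f <= nrm pi h + dl.
  have -> : nrm pi f = nrm pi (fun x => h x - (h x - f x)).
    by congr nrm; apply: funext => x; rewrite subKr.
  by apply: le_trans (nrmB h2 (sqintB h2 f2)) _; rewrite lerD2l ltW.
exists f => // i j.
have sh k : sqint Pr (h \o X k) by apply/chain_sqint => //; case: h2.
have sf k : sqint Pr (f \o X k) by apply/chain_sqint => //; case: f2.
have sd k : sqint Pr (fun w => h (X k w) - f (X k w)) by apply: sqintB; [exact: sh|exact: sf].
have nd k : nrm Pr (fun w => h (X k w) - f (X k w)) <= dl.
  by rewrite (chain_nrm k (sqintB h2 f2)) ltW.
have -> : ip Pr (h \o X i) (h \o X j) - ip Pr (f \o X i) (f \o X j) =
    ip Pr (fun w => h (X i w) - f (X i w)) (h \o X j) +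
    ip Pr (f \o X i) (fun w => h (X j w) - f (X j w)).
  rewrite (@ipBl _ _ _ Pr (h \o X i) (f \o X i)) ?(@ipBr _ _ _ Pr (h \o X j) (f \o X j))//.
  by ring.
apply: (le_trans (ler_normD _ _)).
apply: (@le_trans _ _ (dl * nrm pi h + (nrm pi h + dl) * dl)).
  apply: lerD.
    apply: (le_trans (ip_le (sd i) (sh j))); rewrite (chain_nrm j h2).
    by rewrite ler_wpM2r ?nrm_ge0.
  apply: (le_trans (ip_le (sf i) (sd j))); rewrite (chain_nrm i f2).
  by apply: ler_pM; rewrite ?nrm_ge0.
have dl1 : dl <= 1 by rewrite ge_min lexx.
have : dl * C <= e by rewrite -ler_pdivlMr// ge_min lexx orbT.
by rewrite /C; have := nrm_ge0 pi h; nra.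
Qed.

Lemma chain_stationary_cov i k h : sqint pi h ->
  ip Pr (h \o X i) (h \o X (i + k)%N) = acov h k.
Proof.
move=> h2; apply/eqP; rewrite -subr_eq0 -normr_le0.
apply/ler_addgt0Pr => e e0; rewrite add0r.
have e2 : 0 < e / 2 by rewrite divr_gt0.
have [f bf fh] := chain_ip_approx h2 e2.
have := fh i (i + k)%N; rewrite (chain_cov_bm_acov i k bf).
have := fh 0%N k; rewrite -/(acov h k) -/(acov f k).
by rewrite !ler_norml => /andP[a1 a2] /andP[b1 b2]; apply/andP; split; lra.
Qed.

Lemma acov_bmE f k : bounded_measurable f -> acov f k = ip pi (iter k (Pop P) f) f.
Proof. by move=> bf; rewrite /acov -[k in LHS]add0n chain_cov_bm. Qed.

Lemma acov0 h : sqint pi h -> acov h 0 = ip pi h h.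
Proof. by move=> h2; rewrite /acov chain_ip. Qed.

Lemma even_odd_monotone_acov h : sqint pi h -> even_odd_monotone (acov h).
Proof.
move=> h2 k.
have K e : 0 < e -> [/\ - e <= acov h k.*2, acov h k.*2.+2 <= acov h k.*2 + e,
    - e <= acov h k.*2 + acov h k.*2.+1 &
    acov h k.*2.+2 + acov h k.*2.+3 <= acov h k.*2 + acov h k.*2.+1 + e].
  (* The longest of the inequalities involves four covariances, each displaced by at most
     [e / 4]. *)
  move=> e0; have e4 : 0 < e / 4 by rewrite divr_gt0.
  have [f bf fh] := chain_ip_approx h2 e4.
  have := even_odd_monotone_bm hrev bf k; rewrite -!acov_bmE//.
  have := fh 0%N k.*2; have := fh 0%N k.*2.+1.
  have := fh 0%N k.*2.+2; have := fh 0%N k.*2.+3.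
  rewrite -!/(acov _ _) !ler_norml.
  move=> /andP[? ?] /andP[? ?] /andP[? ?] /andP[? ?] [? ? ? ?].
  by split; lra.
split; apply/ler_addgt0Pr => e /K[]; lra.
Qed.

Definition partial_sum h (n : nat) (w : W) : R := \sum_(1 <= i < n.+1) h (X i w).

Lemma partial_sum_sqint h n : sqint pi h -> sqint Pr (partial_sum h n).
Proof.
move=> h2; apply: sqint_sum => i; apply/(chain_sqint i) => //.
by case: h2.
Qed.

Lemma partial_sumS h n w : partial_sum h n.+1 w = partial_sum h n w + h (X n.+1 w).
Proof. by rewrite /partial_sum big_nat_recr. Qed.

Lemma partial_sum_nrm h n : sqint pi h -> nrm Pr (partial_sum h n) <= n%:R * nrm pi h.
Proof.
move=> h2; have sh k : sqint Pr (h \o X k) by apply/chain_sqint => //; case: h2.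
apply: le_trans (nrm_sum _ sh) _.
under eq_bigr do rewrite chain_nrm//.
by rewrite sumr_const_nat subn1 mulr_natl.
Qed.

Lemma partial_sum_sqr h n : sqint pi h ->
  ip Pr (partial_sum h n) (partial_sum h n) =
  n%:R * acov h 0 + 2 * \sum_(0 <= j < n) series (fun k => acov h k.+1) j.
Proof.
move=> h2; have sh k : sqint Pr (h \o X k) by apply/chain_sqint => //; case: h2.
elim: n => [|n ih].
  rewrite big_geq// mulr0 addr0 mul0r /ip -[RHS](mean_cst Pr).
  by apply: eq_mean => w; rewrite /partial_sum big_geq// mulr0.
have -> : partial_sum h n.+1 = (fun w => partial_sum h n w + h (X n.+1 w)).
  by apply: funext => w; exact: partial_sumS.
rewrite (ipDD (partial_sum_sqint n h2) (sh n.+1)) ih big_nat_recr//=.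
rewrite (chain_ip n.+1 h2 h2) -acov0// (ip_suml _ sh (sh n.+1)).
have -> : \sum_(1 <= i < n.+1) ip Pr (h \o X i) (h \o X n.+1) =
    series (fun k => acov h k.+1) n.
  rewrite seriesEnat/= [RHS]big_nat_rev/= big_add1 add0n.
  rewrite big_nat [RHS]big_nat; apply: eq_bigr => i /andP[_ ni].
  rewrite -(chain_stationary_cov i.+1)//; congr (ip Pr _ (h \o X _)).
  by lia.
rewrite -natr1; ring.
Qed.

Lemma avg_variance_partial_sum h n : sqint pi h ->
  ip Pr (partial_sum h n.+1) (partial_sum h n.+1) = n.+1%:R * avg_variance (acov h) n.
Proof.
move=> h2; rewrite partial_sum_sqr// /avg_variance arithmetic_meanE.
by field.
Qed.

End StationaryChain.

(** * Martingale approximation of the characteristic function *)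

Section TrigonometricBounds.
Context (R : realType).
Implicit Types x y t c : R.

(** Locating [c] by [|c| <= |b|] treats both signs of [b] alike. Starting from [sin], each Taylor
    bound below follows from the previous one by this lemma, with constants that are not sharp. *)
Lemma mean_value (f df : R -> R) (b : R) : (forall x, is_derive x 1 f (df x)) ->
  exists2 c, `|c| <= `|b| & f b - f 0 = df c * b.
Proof.
move=> fd; have cf (A : set R) : {within A, continuous f}.
  by apply: continuous_subspaceT => x; apply: differentiable_continuous;
     apply/derivable1_diffP; exact: ex_derive.
have [b0|b0] := leP 0 b.
  have [c + E] := MVT_segment b0 (fun x _ => fd x) (cf _).
  rewrite in_itv/= => /andP[c0 cb]; exists c; last by rewrite E subr0.
  by rewrite !ger0_norm.
have [c + E] := MVT_segment (ltW b0) (fun x _ => fd x) (cf _).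
rewrite in_itv/= => /andP[cb c0]; exists c.
  by rewrite !ler0_norm// ?lerN2// ltW.
by rewrite -[LHS]opprB E; ring.
Qed.

Lemma norm_sin_le t : `|sin t| <= `|t|.
Proof.
have [c _] := @mean_value sin cos t (fun x => is_derive_sin x).
rewrite sin0 subr0 => ->; rewrite normrM ler_piMl//.
exact: cos_max.
Qed.

Lemma norm_cosB1_le t : `|cos t - 1| <= t ^+ 2.
Proof.
have [c ct] := @mean_value cos (fun x => - sin x) t (fun x => is_derive_cos x).
rewrite cos0 => ->; rewrite normrM normrN -[leRHS]real_normK ?num_real// expr2.
by rewrite ler_wpM2r// (le_trans (norm_sin_le c)).
Qed.

Lemma norm_sinB_le t : `|sin t - t| <= `|t| ^+ 3.
Proof.
have D x : is_derive x 1 (fun t => sin t - t) (cos x - 1).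
  by apply: is_deriveB.
have [c ct] := mean_value t D.
rewrite sin0 !subr0 => ->; rewrite normrM [leRHS]exprSr.
rewrite ler_wpM2r// (le_trans (norm_cosB1_le c))//.
by rewrite -real_normK ?num_real// lerXn2r// nnegrE.
Qed.

Lemma norm_cos_taylor2_le t : `|cos t - (1 - t ^+ 2 / 2)| <= `|t| ^+ 4.
Proof.
have D x : is_derive x 1 (fun t => cos t - (1 - t ^+ 2 / 2)) (- (sin x - x)).
  apply: is_derive_eq.
  by rewrite /GRing.scale/= !mulr0 add0r; field.
have [c ct] := mean_value t D.
rewrite cos0 expr0n/= mul0r subr0 subrr subr0 => ->.
rewrite normrM normrN [leRHS]exprSr ler_wpM2r//.
by rewrite (le_trans (norm_sinB_le c))// lerXn2r// nnegrE.
Qed.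

Lemma norm_cosB_le x y : `|cos x - cos y| <= `|x - y|.
Proof.
have D (z : R) : is_derive z 1 (fun t => cos (t + y)) (- sin (z + y)).
  apply: is_derive_eq.
  by rewrite /GRing.scale/= addr0 mulr1.
have [c _] := mean_value (x - y) D; rewrite subrK add0r => ->.
by rewrite normrM normrN ler_piMl// sin_max.
Qed.

Lemma norm_expRN_taylor1_le x : 0 <= x -> `|expR (- x) - (1 - x)| <= x ^+ 2.
Proof.
move=> x0; have h1 : 1 - x <= expR (- x) by exact: expR_ge1Dx.
rewrite ger0_norm ?subr_ge0// lerBlDr.
have h2 : 1 + x <= expR x by exact: expR_ge1Dx.
rewrite expRN; apply: (@le_trans _ _ (1 + x)^-1).
  by rewrite lef_pV2 ?posrE ?expR_gt0//; lra.
rewrite -[(1 + x)^-1]mul1r ler_pdivrMr; last by lra.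
have : 0 <= x ^+ 2 * x by rewrite mulr_ge0// sqr_ge0.
lra.
Qed.

Lemma cos_increment_taylor x t : `|cos (x + t) - (cos x - t * sin x - t ^+ 2 / 2 * cos x)|
  <= `|t| ^+ 3 + `|t| ^+ 4.
Proof.
rewrite cosD.
have -> : cos x * cos t - sin x * sin t - (cos x - t * sin x - t ^+ 2 / 2 * cos x) =
  - (sin x * (sin t - t)) + cos x * (cos t - (1 - t ^+ 2 / 2)) by ring.
apply: (le_trans (ler_normD _ _)); rewrite normrN !normrM; apply: lerD.
  by apply: le_trans (norm_sinB_le t); rewrite ler_piMl// sin_max.
by apply: le_trans (norm_cos_taylor2_le t); rewrite ler_piMl// cos_max.
Qed.

(** Since [0 <= q <= 1], the errors of an approximate geometric recursion add up without being
    amplified. *)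
Lemma contraction_iter (x : nat -> R) q e n : 0 <= q -> q <= 1 ->
  (forall k, (k < n)%N -> `|x k.+1 - q * x k| <= e) -> `|x n - q ^+ n * x 0%N| <= n%:R * e.
Proof.
move=> q0 q1; elim: n => [|n ih] H; first by rewrite mul0r expr0 mul1r subrr normr0.
have -> : x n.+1 - q ^+ n.+1 * x 0%N =
  (x n.+1 - q * x n) + q * (x n - q ^+ n * x 0%N) by rewrite exprS; ring.
apply: (le_trans (ler_normD _ _)); rewrite -natr1 mulrDl mul1r addrC lerD ?H//.
rewrite normrM ger0_norm//.
have {}ih := ih (fun k kn => H k (ltnW kn)).
by apply: le_trans ih; rewrite ler_piMl.
Qed.

Lemma cvg_invsqrt (C : R) : C / Num.sqrt n%:R @[n --> \oo] --> 0.
Proof.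
rewrite -[0](mulr0 C); apply: cvgM; first exact: cvg_cst.
apply/cvgrPdist_le => e e0; near=> n.
have n0 : 0 < n%:R :> R by near: n; exact: nbhs_infty_gtr.
rewrite sub0r normrN ger0_norm ?invr_ge0 ?sqrtr_ge0//.
rewrite -[leRHS]invrK lef_pV2 ?posrE ?invr_gt0 ?sqrtr_gt0//.
rewrite -(ger0_norm (ltW _ : 0 <= e^-1)) ?invr_gt0// -sqrtr_sqr ler_sqrt//.
near: n; exact: nbhs_infty_ger.
Unshelve. all: by end_near. Qed.

Lemma cvg_divn (C : R) : C / n%:R @[n --> \oo] --> 0.
Proof.
rewrite -[0](mulr0 C); apply: cvgM; first exact: cvg_cst.
apply/cvgrPdist_le => e e0; near=> n.
have n0 : 0 < n%:R :> R by near: n; exact: nbhs_infty_gtr.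
rewrite sub0r normrN ger0_norm ?invr_ge0 ?ler0n//.
rewrite -[leRHS]invrK lef_pV2 ?posrE ?invr_gt0//.
near: n; exact: nbhs_infty_ger.
Unshelve. all: by end_near. Qed.

End TrigonometricBounds.

Section MartingaleLimit.
Context (R : realType) (d d' : measure_display).
Context (T : measurableType d) (W : measurableType d').
Variables (P : R.-pker T ~> T) (pi : probability T R) (Pr : probability W R).
Variable X : nat -> {RV Pr >-> T}.
Hypotheses (hrev : reversible P pi) (hX : markov_chain P pi X).

Local Ltac bmt := repeat first [assumption | apply: bmB | apply: bmD | apply: bmN |
  apply: bmM | apply: bmX2 | apply: bm_Pop | apply: bm_cst].

Lemma bm_comp_continuous (d0 : measure_display) (T0 : measurableType d0)
    (F : R -> R) (f : T0 -> R) : continuous F -> (forall x, `|F x| <= 1) ->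
  measurable_fun setT f -> bounded_measurable (fun x => F (f x)).
Proof.
move=> cF F1 mf; split; last by exists 1.
by apply: measurableT_comp => //; exact: continuous_measurable_fun.
Qed.

Definition mdiff (g : T -> R) k (w : W) : R := g (X k.+1 w) - Pop P g (X k w).

Definition martingale (g : T -> R) n (w : W) : R := \sum_(0 <= k < n) mdiff g k w.

Lemma martingaleS g n w : martingale g n.+1 w = martingale g n w + mdiff g n w.
Proof. by rewrite /martingale big_nat_recr. Qed.

(** The variance of one increment in stationarity: [Pop P g (X k)] is the conditional expectation of
    [g (X k.+1)], and Pythagoras applies. *)
Definition mdiff_var (g : T -> R) : R := ip pi g g - ip pi (Pop P g) (Pop P g).

Lemma past_bm_X n k f : (k <= n)%N -> bounded_measurable f ->
  bounded_measurable ((fun w => f (X k w)) : past X n -> R).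
Proof.
move=> kn [mf [b fb]]; split; last by exists b => w; exact: fb.
by apply: measurableT_comp => //; exact: past_measurable_X.
Qed.

Lemma past_bm_martingale g n m : (m <= n)%N -> bounded_measurable g ->
  bounded_measurable (martingale g m : past X n -> R).
Proof.
move=> + bg; elim: m => [_|m ih mn].
  rewrite (_ : martingale g 0 = (fun=> 0)); first exact: (bm_cst (past X n)).
  by apply: funext => w; rewrite /martingale big_geq.
rewrite (_ : martingale g m.+1 = (fun w => martingale g m w +
    (g (X m.+1 w) - Pop P g (X m w)))); last first.
  by apply: funext => w; rewrite martingaleS.
apply: (@bmD _ _ (past X n)); first exact: ih (ltnW mn).
apply: (@bmB _ _ (past X n) (fun w => g (X m.+1 w))); first exact: past_bm_X.
by apply: past_bm_X; [exact: ltnW|exact: bm_Pop].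
Qed.

Section Step.
Variables (g r : T -> R) (B : R).
Hypotheses (bg : bounded_measurable g) (br : bounded_measurable r).
Hypotheses (B1 : 1 <= B) (gB : forall k w, `|mdiff g k w| <= B).
Hypothesis rB : forall x, `|r x| <= B.
Variables (th c dl : R).
Hypothesis th1 : `|th| <= 1.

Let v x := Pop P (fun y => g y ^+ 2) x - Pop P g x ^+ 2.
Let s := mdiff_var g.
Hypothesis approx : nrm pi (fun x => (v x - s) - (r x - Pop P r x)) <= dl.

Let y k (w : W) := th * martingale g k w + c.
Let phi k := mean Pr (fun w => cos (y k w)).
Let rho k := mean Pr (fun w => cos (y k w) * r (X k w)).

Let bmX (f : T -> R) k : bounded_measurable f -> bounded_measurable (fun w => f (X k w)).
Proof. exact: chain_bm. Qed.

Let my k : measurable_fun setT (y k : past X k -> R).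
Proof.
apply: measurable_funD => //; apply: measurable_funM => //.
by apply: bm_meas; exact: past_bm_martingale.
Qed.

Let bcos k : bounded_measurable ((fun w => cos (y k w)) : past X k -> R).
Proof.
exact: (@bm_comp_continuous _ (past X k) cos _ (@continuous_cos R) (@cos_max R) (@my k)).
Qed.

Let bsin k : bounded_measurable ((fun w => sin (y k w)) : past X k -> R).
Proof.
exact: (@bm_comp_continuous _ (past X k) sin _ (@continuous_sin R) (@sin_max R) (@my k)).
Qed.

Let bcosW k : bounded_measurable (fun w => cos (y k w)).
Proof. exact: past_bm (bcos k). Qed.

Let bsinW k : bounded_measurable (fun w => sin (y k w)).
Proof. exact: past_bm (bsin k). Qed.

Let bD k : bounded_measurable (mdiff g k).
Proof.
apply: (@bmB _ _ W (fun w => g (X k.+1 w))); apply: bmX => //; exact: bm_Pop.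
Qed.

Let bv : bounded_measurable v.
Proof. by rewrite /v; bmt. Qed.

Let sin_mdiff k : mean Pr (fun w => sin (y k w) * mdiff g k w) = 0.
Proof.
have := markov_property hX (bsin k) bg => E.
transitivity (mean Pr (fun w => sin (y k w) * g (X k.+1 w) -
    sin (y k w) * Pop P g (X k w))).
  by apply: eq_mean => w; rewrite mulrBr.
rewrite meanB ?E ?subrr//; apply: bm_integr; apply: bmM => //; apply: bmX => //.
exact: bm_Pop.
Qed.

(** [v (X k)] is the conditional variance of the increment given the past, and [cos (y k)] depends
    on the past only. *)
Let cos_mdiff2 k : mean Pr (fun w => cos (y k w) * mdiff g k w ^+ 2) =
  mean Pr (fun w => cos (y k w) * v (X k w)).
Proof.
have bPg := bm_Pop P bg.
have bPhi : bounded_measurable ((fun w => cos (y k w) * Pop P g (X k w)) : past X k -> R).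
  apply: (@bmM _ _ (past X k) (fun w => cos (y k w))); first exact: bcos.
  exact: (past_bm_X (leqnn k) bPg).
have E1 := markov_property hX (bcos k) (bmX2 bg).
have E2 := markov_property hX bPhi bg.
have b1 : bounded_measurable (fun w => cos (y k w) * g (X k.+1 w) ^+ 2).
  by apply: bmM => //; apply: bmX2; exact: bmX.
have b2 : bounded_measurable (fun w => cos (y k w) * Pop P g (X k w) * g (X k.+1 w)).
  by apply: bmM; [exact: past_bm bPhi|exact: bmX].
have b3 : bounded_measurable (fun w => cos (y k w) * Pop P g (X k w) * Pop P g (X k w)).
  by apply: bmM; [exact: past_bm bPhi|exact: bmX].
have b4 : bounded_measurable (fun w => cos (y k w) * Pop P (fun x => g x ^+ 2) (X k w)).
  by apply: bmM => //; apply: bmX; apply: bm_Pop; exact: bmX2.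
transitivity (mean Pr (fun w => (cos (y k w) * g (X k.+1 w) ^+ 2 -
   2 * (cos (y k w) * Pop P g (X k w) * g (X k.+1 w))) +
   cos (y k w) * Pop P g (X k w) * Pop P g (X k w))).
  by apply: eq_mean => w; rewrite /mdiff; ring.
transitivity (mean Pr (fun w => cos (y k w) * Pop P (fun x => g x ^+ 2) (X k w) -
   cos (y k w) * Pop P g (X k w) * Pop P g (X k w))); last first.
  by apply: eq_mean => w; rewrite /v; ring.
have b2' : bounded_measurable (fun w => 2 * (cos (y k w) * Pop P g (X k w) * g (X k.+1 w))).
  by apply: bmM => //; exact: bm_cst.
rewrite meanD ?meanB ?meanZ ?E1 ?E2; try by apply: bm_integr; bmt.
by ring.
Qed.

Let taylor_error k (w : W) := cos (y k.+1 w) -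
  (cos (y k w) - th * (sin (y k w) * mdiff g k w) -
   th ^+ 2 / 2 * (cos (y k w) * mdiff g k w ^+ 2)).

(** The assumptions [|th| <= 1 <= B] merge the cubic and the quartic remainder into one term. *)
Let taylor_error_le k w : `|taylor_error k w| <= 2 * B ^+ 4 * `|th| ^+ 3.
Proof.
have yS : y k.+1 w = y k w + th * mdiff g k w by rewrite /y martingaleS; ring.
have := cos_increment_taylor (y k w) (th * mdiff g k w).
rewrite -yS /taylor_error.
have -> : cos (y k w) - th * (sin (y k w) * mdiff g k w) -
   th ^+ 2 / 2 * (cos (y k w) * mdiff g k w ^+ 2) =
   cos (y k w) - th * mdiff g k w * sin (y k w) - (th * mdiff g k w) ^+ 2 / 2 * cos (y k w).
  by rewrite exprMn; ring.
move=> /le_trans; apply.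
rewrite normrM !exprMn.
have t0 := normr_ge0 th; have d0 := normr_ge0 (mdiff g k w); have dB := gB k w.
move: (`|th|) (`|mdiff g k w|) t0 d0 dB th1 => t e t0 e0 eB t1.
have B0 : 0 <= B by lra.
have e3 : e ^+ 3 <= B ^+ 4.
  apply: (@le_trans _ _ (B ^+ 3)); first by rewrite lerXn2r// nnegrE.
  by rewrite [leRHS]exprSr ler_peMr// exprn_ge0.
have e4 : e ^+ 4 <= B ^+ 4 by rewrite lerXn2r// nnegrE.
have t4 : t ^+ 4 <= t ^+ 3 by rewrite exprSr ler_piMr// exprn_ge0.
have t3 : 0 <= t ^+ 3 by exact: exprn_ge0.
have h1 : t ^+ 3 * e ^+ 3 <= t ^+ 3 * B ^+ 4 by rewrite ler_wpM2l.
have h2 : t ^+ 4 * e ^+ 4 <= t ^+ 3 * B ^+ 4.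
  by apply: ler_pM => //; exact: exprn_ge0.
lra.
Qed.

Let phi_step k : `|phi k.+1 - (phi k - th ^+ 2 / 2 * mean Pr (fun w => cos (y k w) * v (X k w)))|
  <= 2 * B ^+ 4 * `|th| ^+ 3.
Proof.
have b1 : bounded_measurable (fun w => sin (y k w) * mdiff g k w) by exact: bmM.
have b2 : bounded_measurable (fun w => cos (y k w) * mdiff g k w ^+ 2).
  by apply: bmM => //; exact: bmX2.
have b3 : bounded_measurable (fun w => cos (y k w) - th * (sin (y k w) * mdiff g k w)) by bmt.
have b4 : bounded_measurable (fun w => th ^+ 2 / 2 * (cos (y k w) * mdiff g k w ^+ 2)).
  by apply: bmM => //; exact: bm_cst.
have b5 : bounded_measurable (fun w => th * (sin (y k w) * mdiff g k w)).
  by apply: bmM => //; exact: bm_cst.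
have E : mean Pr (fun w => cos (y k w) - th * (sin (y k w) * mdiff g k w) -
   th ^+ 2 / 2 * (cos (y k w) * mdiff g k w ^+ 2)) =
   phi k - th ^+ 2 / 2 * mean Pr (fun w => cos (y k w) * v (X k w)).
  rewrite meanB; [|exact: bm_integr|exact: bm_integr].
  rewrite meanB; [|exact: bm_integr|exact: bm_integr].
  rewrite !meanZ; [|exact: bm_integr|exact: bm_integr].
  by rewrite sin_mdiff cos_mdiff2 mulr0 subr0.
rewrite -E; apply: mean_unif => //; first exact: bmB.
by move=> w; exact: taylor_error_le.
Qed.

(** By the Markov property [P r (X k)] may be replaced by [r (X k.+1)] next to [cos (y k)]. Passing
    then from [cos (y k)] to [cos (y k.+1)] costs [B^2 |th|] and produces the telescoping difference
    [rho k - rho k.+1]. *)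
Let cos_v k : `|mean Pr (fun w => cos (y k w) * v (X k w)) -
   (s * phi k + rho k - rho k.+1)| <= dl + B ^+ 2 * `|th|.
Proof.
have bPr := bm_Pop P br.
pose psi x := (v x - s) - (r x - Pop P r x).
have bpsi : bounded_measurable psi by rewrite /psi; bmt.
have b1 : bounded_measurable (fun w => cos (y k w) * psi (X k w)).
  by apply: bmM => //; exact: bmX.
have b2 : bounded_measurable (fun w => cos (y k w) * r (X k w)).
  by apply: bmM => //; exact: bmX.
have b3 : bounded_measurable (fun w => cos (y k w) * Pop P r (X k w)).
  by apply: bmM => //; exact: bmX.
have b4 : bounded_measurable (fun w => cos (y k w) * r (X k.+1 w)).
  by apply: bmM => //; exact: bmX.
have b5 : bounded_measurable (fun w => cos (y k.+1 w) * r (X k.+1 w)).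
  by apply: bmM => //; exact: bmX.
have b6 : bounded_measurable (fun w => s * cos (y k w)) by bmt.
have E : mean Pr (fun w => cos (y k w) * v (X k w)) =
    mean Pr (fun w => cos (y k w) * psi (X k w)) + s * phi k + rho k -
    mean Pr (fun w => cos (y k w) * r (X k.+1 w)).
  rewrite (markov_property hX (bcos k) br).
  rewrite -meanZ; last exact: bm_integr.
  rewrite -meanD; [|exact: bm_integr|exact: bm_integr].
  rewrite -meanD; [|apply: bm_integr; exact: bmD|exact: bm_integr].
  rewrite -meanB; [|apply: bm_integr; apply: bmD => //; exact: bmD|exact: bm_integr].
  by apply: eq_mean => w; rewrite /psi; ring.
have h1 : `|mean Pr (fun w => cos (y k w) * psi (X k w))| <= dl.
  apply: le_trans approx.
  apply: (@le_trans _ _ (mean Pr (fun w => `|psi (X k w)|))).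
    apply: norm_mean_le.
    - exact: bm_integr.
    - by apply: integr_norm; apply: bm_integr; exact: bmX.
    - by move=> w; rewrite normrM ler_piMl// cos_max.
  apply: (@le_trans _ _ (nrm Pr (fun w => psi (X k w)))).
    by apply: norm_mean_nrm; apply: bm_sqint; exact: bmX.
  by rewrite (chain_nrm hrev hX k (bm_sqint pi bpsi)).
have h2 : `|mean Pr (fun w => cos (y k w) * r (X k.+1 w)) - rho k.+1| <= B ^+ 2 * `|th|.
  apply: mean_unif => // w; rewrite -mulrBl normrM.
  have B0 : 0 <= B by move: B1; lra.
  rewrite expr2 -mulrA mulrC ler_pM//.
  apply: le_trans (norm_cosB_le _ _) _.
  have -> : y k w - y k.+1 w = - (th * mdiff g k w) by rewrite /y martingaleS; ring.
  by rewrite normrN normrM mulrC ler_wpM2r.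
rewrite E.
have -> : mean Pr (fun w => cos (y k w) * psi (X k w)) + s * phi k + rho k -
    mean Pr (fun w => cos (y k w) * r (X k.+1 w)) - (s * phi k + rho k - rho k.+1) =
  mean Pr (fun w => cos (y k w) * psi (X k w)) -
  (mean Pr (fun w => cos (y k w) * r (X k.+1 w)) - rho k.+1) by ring.
by apply: (le_trans (ler_normB _ _)); exact: lerD.
Qed.

Let norm_phi k : `|phi k| <= 1.
Proof.
rewrite -(subr0 (phi k)) -[0](mean_cst Pr); apply: mean_unif => //; first exact: bm_cst.
by move=> w; rewrite subr0; exact: cos_max.
Qed.

Let norm_rho k : `|rho k| <= B.
Proof.
rewrite -(subr0 (rho k)) -[0](mean_cst Pr); apply: mean_unif => //.
- by apply: bmM => //; exact: bmX.
- exact: bm_cst.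
move=> w; rewrite subr0 normrM -[leRHS]mul1r ler_pM//; exact: cos_max.
Qed.

Hypothesis s0 : 0 <= s.
Let q := expR (- (th ^+ 2 * s / 2)).
(** Substituting [cos_v] into [phi_step] gives [phi k.+1 - th^2/2 rho k.+1] close to
    [(1 - th^2 s/2) phi k - th^2/2 rho k]. Subtracting the [rho] term on both sides therefore leaves
    a recursion with ratio [q], up to [th^2/2 (1 - q) rho k], of order [th^4]. *)
Let x k := phi k - th ^+ 2 / 2 * rho k.

Let step_le k : `|x k.+1 - q * x k| <=
  (2 * B ^+ 4 + B ^+ 2 + s ^+ 2 + B * s) * `|th| ^+ 3 + dl * th ^+ 2.
Proof.
have q1 : `|q - (1 - th ^+ 2 * s / 2)| <= (th ^+ 2 * s / 2) ^+ 2.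
  by apply: norm_expRN_taylor1_le; rewrite divr_ge0// mulr_ge0// sqr_ge0.
have q2 : `|1 - q| <= th ^+ 2 * s / 2.
  have h1 : 1 - th ^+ 2 * s / 2 <= q by exact: expR_ge1Dx.
  have h2 : q <= 1 by rewrite /q -expR0 ler_expR oppr_le0 divr_ge0// mulr_ge0// sqr_ge0.
  by rewrite ger0_norm; lra.
have h1 := phi_step k; have h2 := cos_v k.
set m := mean Pr (fun w => cos (y k w) * v (X k w)) in h1 h2.
have -> : x k.+1 - q * x k = (phi k.+1 - (phi k - th ^+ 2 / 2 * m)) -
   th ^+ 2 / 2 * (m - (s * phi k + rho k - rho k.+1)) -
   phi k * (q - (1 - th ^+ 2 * s / 2)) - th ^+ 2 / 2 * ((1 - q) * rho k).
  by rewrite /x; field.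
have t2 : 0 <= th ^+ 2 / 2 by rewrite divr_ge0// sqr_ge0.
have th2E : th ^+ 2 = `|th| ^+ 2 by rewrite real_normK ?num_real.
apply: (le_trans (ler_normB _ _)).
apply: (@le_trans _ _ (2 * B ^+ 4 * `|th| ^+ 3 +
  th ^+ 2 / 2 * (dl + B ^+ 2 * `|th|) + (th ^+ 2 * s / 2) ^+ 2 +
  th ^+ 2 / 2 * ((th ^+ 2 * s / 2) * B))).
  apply: lerD; last first.
    rewrite normrM ger0_norm// ler_wpM2l// normrM ler_pM//; exact: norm_rho.
  apply: (le_trans (ler_normB _ _)); apply: lerD; last first.
    rewrite normrM; apply: le_trans q1; rewrite ler_piMl//; exact: norm_phi.
  apply: (le_trans (ler_normB _ _)); apply: lerD => //.
  by rewrite normrM ger0_norm// ler_wpM2l.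
have dl0 : 0 <= dl by apply: le_trans approx; exact: nrm_ge0.
have t0 := normr_ge0 th; rewrite th2E.
have B0 : 0 <= B by move: B1; lra.
move: (`|th|) t0 th1 => t t0 t1.
have t3 : 0 <= t ^+ 3 by exact: exprn_ge0.
have t4 : t ^+ 4 <= t ^+ 3 by rewrite exprSr ler_piMr// exprn_ge0.
have e1 : t ^+ 2 / 2 * (dl + B ^+ 2 * t) = dl * t ^+ 2 / 2 + B ^+ 2 * t ^+ 3 / 2 by field.
have e2 : (t ^+ 2 * s / 2) ^+ 2 = s ^+ 2 * t ^+ 4 / 4 by field.
have e3 : t ^+ 2 / 2 * (t ^+ 2 * s / 2 * B) = B * s * t ^+ 4 / 4 by field.
rewrite e1 e2 e3.
have f1 : 0 <= dl * t ^+ 2 by rewrite mulr_ge0// exprn_ge0.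
have f2 : 0 <= B ^+ 2 * t ^+ 3 by rewrite mulr_ge0// exprn_ge0.
have f3 : s ^+ 2 * t ^+ 4 <= s ^+ 2 * t ^+ 3 by rewrite ler_wpM2l// sqr_ge0.
have f4 : B * s * t ^+ 4 <= B * s * t ^+ 3 by rewrite ler_wpM2l// mulr_ge0.
have f5 : 0 <= s ^+ 2 * t ^+ 3 by rewrite mulr_ge0// sqr_ge0.
have f6 : 0 <= B * s * t ^+ 3 by rewrite !mulr_ge0.
move: e1 e2 e3 f1 f2 f3 f4 f5 f6; rewrite !mulrDl.
move: (dl * t ^+ 2) (B ^+ 2 * t ^+ 3) (s ^+ 2 * t ^+ 4) (s ^+ 2 * t ^+ 3)
  (B * s * t ^+ 4) (B * s * t ^+ 3) (2 * B ^+ 4 * t ^+ 3) => *; lra.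
Qed.

(** The last term, [B * th ^+ 2], is the price of returning from [x] to [phi] at the two ends. For
    [th] of order [n^(-1/2)] everything tends to 0 except [n * dl * th ^+ 2], which stays of order
    [dl]. *)
Lemma martingale_cos_bound n :
  `|mean Pr (fun w => cos (th * martingale g n w + c)) -
    expR (- (th ^+ 2 * s / 2)) ^+ n * cos c| <=
  n%:R * ((2 * B ^+ 4 + B ^+ 2 + s ^+ 2 + B * s) * `|th| ^+ 3 + dl * th ^+ 2) +
  B * th ^+ 2.
Proof.
have q0 : 0 <= q by exact: expR_ge0.
have q1 : q <= 1 by rewrite /q -expR0 ler_expR oppr_le0 divr_ge0// mulr_ge0// sqr_ge0.
have := @contraction_iter _ x _ _ n q0 q1 (fun k _ => step_le k).
have phi0 : phi 0%N = cos c.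
  rewrite /phi (_ : (fun w => _) = (fun=> cos c)) ?mean_cst//.
  by apply: funext => w; rewrite /y /martingale big_geq// mulr0 add0r.
set K := n%:R * _ => H.
have -> : mean Pr (fun w => cos (th * martingale g n w + c)) - q ^+ n * cos c =
   (x n - q ^+ n * x 0%N) + th ^+ 2 / 2 * (rho n - q ^+ n * rho 0%N).
  by rewrite /x phi0 -/(phi n); ring.
apply: (le_trans (ler_normD _ _)); apply: lerD => //.
have t2 : 0 <= th ^+ 2 / 2 by rewrite divr_ge0// sqr_ge0.
rewrite normrM ger0_norm//.
have qn : `|q ^+ n * rho 0%N| <= B.
  rewrite normrM -[leRHS]mul1r ler_pM//.
  by rewrite ger0_norm ?exprn_ge0// exprn_ile1.
have : `|rho n - q ^+ n * rho 0%N| <= B + B.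
  by apply: (le_trans (ler_normB _ _)); apply: lerD => //; exact: norm_rho.
move=> /(ler_wpM2l t2) /le_trans; apply; lra.
Qed.

End Step.

End MartingaleLimit.

Section CharacteristicFunctionLimit.
Context (R : realType) (d d' : measure_display).
Context (T : measurableType d) (W : measurableType d').
Variables (P : R.-pker T ~> T) (pi : probability T R) (Pr : probability W R).
Variable X : nat -> {RV Pr >-> T}.
Hypotheses (hrev : reversible P pi) (hX : markov_chain P pi X).

Lemma bm_sum (d0 : measure_display) (T0 : measurableType d0) (F : nat -> T0 -> R) n :
  (forall k, bounded_measurable (F k)) ->
  bounded_measurable (fun x => \sum_(0 <= k < n) F k x).
Proof.
move=> bF; elim: n => [|n ih].
  by under eq_fun do rewrite big_geq//; exact: bm_cst.
by under eq_fun do rewrite big_nat_recr//=; apply: bmD.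
Qed.

Lemma mean_sub_Pop g : bounded_measurable g -> mean pi (fun x => g x - Pop P g x) = 0.
Proof.
move=> bg; have bPg := bm_Pop P bg.
by rewrite meanB ?mean_Pop ?subrr//; exact: bm_integr.
Qed.

(** Boundedness of [g] gives bounded martingale increments; it also makes their centred conditional
    variance bounded with mean zero, hence a legitimate [psi] in its turn. *)
Definition dense_coboundaries : Prop := forall psi, bounded_measurable psi ->
  mean pi psi = 0 -> forall e : R, 0 < e -> exists2 g, bounded_measurable g &
  nrm pi (fun x => psi x - (g x - Pop P g x)) <= e.

(* [psi] minus the average of its first [n] iterates under [P] is a coboundary,
   and this average has squared norm [n^-2 \sum_(i, j < n) a_(i + j)], where [a]
   is the autocovariance sequence, so it is at most [C / n]. *)
Lemma coboundary_approx psi C e : bounded_measurable psi ->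
  (forall n, 0 <= series (acov X psi) n <= C) -> 0 < e ->
  exists2 g, bounded_measurable g & nrm pi (fun x => psi x - (g x - Pop P g x)) <= e.
Proof.
move=> bpsi hC e0.
have bit k : bounded_measurable (iter k (Pop P) psi) by exact: bm_iter_Pop.
pose U n x := \sum_(0 <= k < n) iter k (Pop P) psi x.
(* Summing [U k - P (U k) = psi - P^k psi] over [k < n] gives [V n - P (V n) = n psi - U n], so
   [V n / n] is the required [g], with error [U n / n]. *)
pose V n x := \sum_(0 <= k < n) U k x.
have bU n : bounded_measurable (U n) by exact: bm_sum.
have bV n : bounded_measurable (V n) by exact: bm_sum.
have PU n x : U n x - Pop P (U n) x = psi x - iter n (Pop P) psi x.
  elim: n => [|n ih].
    rewrite (_ : U 0%N = (fun=> 0)) ?Pop_cst ?subrr//.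
    by apply: funext => z; rewrite /U big_geq.
  have -> : U n.+1 = (fun z => U n z + iter n (Pop P) psi z).
    by apply: funext => z; rewrite /U big_nat_recr.
  rewrite PopD// iterS; move: ih; lra.
have PV n x : V n x - Pop P (V n) x = n%:R * psi x - U n x.
  elim: n => [|n ih].
    rewrite (_ : V 0%N = (fun=> 0)); last by apply: funext => z; rewrite /V big_geq.
    by rewrite Pop_cst /U big_geq// mul0r.
  have -> : V n.+1 = (fun z => V n z + U n z).
    by apply: funext => z; rewrite /V big_nat_recr.
  have -> : U n.+1 x = U n x + iter n (Pop P) psi x by rewrite /U big_nat_recr.
  rewrite PopD// -natr1; move: ih (PU n x); rewrite mulrDl mul1r; lra.
have sit k := bm_sqint pi (bit k); have sU n := bm_sqint pi (bU n).
have ipUU n : ip pi (U n) (U n) <= n%:R * C.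
  rewrite ip_suml// -[n in leRHS]subn0 mulr_natl -sumr_const_nat.
  apply: ler_sum_nat => i _; rewrite ipC ip_suml//.
  under eq_bigr do rewrite ip_iter_Pop// -(acov_bmE hrev hX)//.
  have -> : \sum_(0 <= j < n) acov X psi (j + i) =
      series (acov X psi) (n + i) - series (acov X psi) i.
    rewrite !seriesEnat/= [X in _ = X - _](@big_cat_nat _ _ _ i)//= ?leq_addl//.
    by rewrite [RHS]addrC addKr -{2}[i]add0n big_addn addnK.
  by have /andP[? ?] := hC (n + i)%N; have /andP[? ?] := hC i; lra.
pose n := (Num.trunc (C / e ^+ 2)).+1.
have n0 : 0 < n%:R :> R by rewrite ltr0n.
have nC : C / e ^+ 2 <= n%:R by rewrite ltW// truncnS_gt.
exists (fun x => n%:R^-1 * V n x); first by apply: bmM => //; exact: bm_cst.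
rewrite (_ : (fun x => _) = (fun x => n%:R^-1 * U n x)); last first.
  apply: funext => x; rewrite PopZ//.
  have -> : psi x = n%:R^-1 * (n%:R * psi x) by rewrite mulKf ?gt_eqF.
  by rewrite -!mulrBr PV; ring.
rewrite nrmZ// -(@ler_pXn2r _ 2)// ?nnegrE ?mulr_ge0 ?nrm_ge0// ?(ltW e0)//.
rewrite exprMn nrm_sqr real_normK ?num_real// exprVn.
rewrite ler_pdivrMl ?exprn_gt0//; apply: (le_trans (ipUU n)).
rewrite expr2 -mulrA ler_wpM2l ?(ltW n0)//.
by rewrite -ler_pdivrMr// exprn_gt0.
Qed.

Lemma mean_mdiff_sqr g k : bounded_measurable g ->
  mean Pr (fun w => mdiff P X g k w ^+ 2) = mdiff_var P pi g.
Proof.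
move=> bg; have bPg := bm_Pop P bg.
have bX (f : T -> R) j : bounded_measurable f -> bounded_measurable (fun w => f (X j w)).
  exact: chain_bm.
have b1 := bX _ k.+1 (bmX2 bg).
have b2 : bounded_measurable (fun w => Pop P g (X k w) * g (X k.+1 w)).
  by apply: bmM; exact: bX.
have b3 : bounded_measurable (fun w => Pop P g (X k w) * Pop P g (X k w)).
  by apply: bmM; exact: bX.
have b2' : bounded_measurable (fun w => 2 * (Pop P g (X k w) * g (X k.+1 w))).
  by apply: bmM => //; exact: bm_cst.
transitivity (mean Pr (fun w => (g (X k.+1 w) ^+ 2 -
   2 * (Pop P g (X k w) * g (X k.+1 w))) + Pop P g (X k w) * Pop P g (X k w))).
  by apply: eq_mean => w; rewrite /mdiff; ring.
rewrite meanD; [|apply: bm_integr; exact: bmB|exact: bm_integr].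
rewrite meanB; [|exact: bm_integr|exact: bm_integr].
rewrite meanZ; last exact: bm_integr.
rewrite (markov_property hX (past_bm_X X (leqnn k) bPg) bg).
rewrite (chain_mean hrev hX k.+1 (bm_integr pi (bmX2 bg))).
rewrite (chain_mean hrev hX k (bm_integr pi (bmM bPg bPg))).
by rewrite /mdiff_var /ip; under [in RHS]eq_mean do rewrite -expr2; ring.
Qed.

Lemma mdiff_var_ge0 g : bounded_measurable g -> 0 <= mdiff_var P pi g.
Proof.
by move=> bg; rewrite -(mean_mdiff_sqr 0 bg); apply: mean_ge0 => w; exact: sqr_ge0.
Qed.

Lemma bm_mdiff g k : bounded_measurable g -> bounded_measurable (mdiff P X g k).
Proof.
move=> bg; apply: (@bmB _ _ W (fun w => g (X k.+1 w))).
  exact: (chain_bm X k.+1 bg).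
exact: (chain_bm X k (bm_Pop P bg)).
Qed.

Lemma bm_martingale g n : bounded_measurable g -> bounded_measurable (martingale P X g n).
Proof. by move=> bg; exact: past_bm (past_bm_martingale P X (leqnn n) bg). Qed.

Lemma martingale_sqr g n : bounded_measurable g ->
  ip Pr (martingale P X g n) (martingale P X g n) = n%:R * mdiff_var P pi g.
Proof.
move=> bg; elim: n => [|n ih].
  rewrite mul0r /ip -[RHS](mean_cst Pr); apply: eq_mean => w.
  by rewrite /martingale big_geq// mulr0.
have -> : martingale P X g n.+1 = (fun w => martingale P X g n w + mdiff P X g n w).
  by apply: funext => w; rewrite martingaleS.
have bM := bm_martingale n bg; have bD := bm_mdiff n bg.
rewrite ipDD; [|exact: bm_sqint|exact: bm_sqint].
rewrite ih (_ : ip Pr (mdiff P X g n) _ = mdiff_var P pi g); last first.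
  by rewrite -(mean_mdiff_sqr n bg); apply: eq_mean => w; rewrite expr2.
rewrite (_ : ip Pr _ _ = 0); first by rewrite -natr1; ring.
have E := markov_property hX (past_bm_martingale P X (leqnn n) bg) bg.
transitivity (mean Pr (fun w => martingale P X g n w * g (X n.+1 w) -
    martingale P X g n w * Pop P g (X n w))).
  by apply: eq_mean => w; rewrite mulrBr.
rewrite meanB ?E ?subrr//; apply: bm_integr; apply: bmM => //.
  exact: (chain_bm X n.+1 bg).
exact: (chain_bm X n (bm_Pop P bg)).
Qed.

Lemma martingale_partial_sum g n w :
  partial_sum X (fun x => g x - Pop P g x) n w =
  martingale P X g n w + Pop P g (X 0%N w) - Pop P g (X n w).
Proof.
elim: n => [|n ih]; first by rewrite /partial_sum /martingale !big_geq// add0r subrr.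
by rewrite partial_sumS martingaleS ih /mdiff; ring.
Qed.

Lemma sqrt_div_sqr (l : R) n : (0 < n)%N -> (l / Num.sqrt n%:R) ^+ 2 = l ^+ 2 / n%:R.
Proof. by move=> n0; rewrite exprMn exprVn sqr_sqrtr ?ler0n. Qed.

Lemma martingale_cos_cvg g (l c : R) : dense_coboundaries -> bounded_measurable g ->
  mean Pr (fun w => cos (l / Num.sqrt n%:R * martingale P X g n w + c)) @[n --> \oo]
    --> expR (- (l ^+ 2 * mdiff_var P pi g / 2)) * cos c.
Proof.
move=> dc bg; set s := mdiff_var P pi g; have s0 : 0 <= s := mdiff_var_ge0 bg.
have [_ [b gb]] := bg; have bPg := bm_Pop P bg.
pose v x := Pop P (fun y => g y ^+ 2) x - Pop P g x ^+ 2.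
have bv1 : bounded_measurable (Pop P (fun y => g y ^+ 2)) by apply: bm_Pop; exact: bmX2.
have bv2 : bounded_measurable (fun x => Pop P g x ^+ 2) by exact: bmX2.
have bv : bounded_measurable (fun x => v x - s).
  by apply: bmB; [exact: bmB|exact: bm_cst].
have mv : mean pi (fun x => v x - s) = 0.
  rewrite meanB; [|by apply: bm_integr; exact: bmB|exact: integr_cst].
  rewrite meanB; [|exact: bm_integr|exact: bm_integr].
  rewrite mean_cst (mean_Pop hrev (bmX2 bg)) /s /mdiff_var /ip.
  by under eq_mean do rewrite expr2; under [X in _ - X - _]eq_mean do rewrite expr2; ring.
apply/cvgrPdist_le => e e0.
(* For [th = l / sqrt n] the term [n * dl * th^2 = dl * l^2] does not depend on [n], so it must be
   below [e / 2] from the outset. The other two terms vanish as [n] grows and get [e / 4] each. *)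
pose dl := e / 2 / (l ^+ 2 + 1).
have l1 : 0 < l ^+ 2 + 1 by rewrite ltr_wpDl// sqr_ge0.
have dl0 : 0 < dl by rewrite !divr_gt0.
have [r br rdl] := dc _ bv mv _ dl0.
have [_ [b' rb]] := br.
(* A single bound for 1, for the increments [g - P g] taken at successive times, and for [r]. *)
pose B := 1 + `|b| + `|b| + `|b'|.
have B1 : 1 <= B by rewrite /B -!addrA lerDl !addr_ge0.
have gB k w : `|mdiff P X g k w| <= B.
  apply: (le_trans (ler_normB _ _)).
  have h1 := gb (X k.+1 w); have h2 := Pop_norm_le P bg gb (X k w).
  have := ler_norm b; have := normr_ge0 b'; rewrite /B; lra.
have rB x : `|r x| <= B.
  by apply: (le_trans (rb x)); rewrite /B; have := ler_norm b'; have := normr_ge0 b; lra.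
pose C := 2 * B ^+ 4 + B ^+ 2 + s ^+ 2 + B * s.
near=> n.
have n0 : (0 < n)%N by near: n; exact: nbhs_infty_gt.
have n0R : 0 < n%:R :> R by rewrite ltr0n.
pose th := l / Num.sqrt n%:R.
have thE : th ^+ 2 = l ^+ 2 / n%:R by exact: sqrt_div_sqr.
have th1 : `|th| <= 1.
  rewrite -(@ler_pXn2r _ 2)// ?nnegrE// real_normK ?num_real// thE expr1n.
  rewrite ler_pdivrMr// mul1r; near: n; exact: nbhs_infty_ger.
have := martingale_cos_bound hrev hX bg br B1 gB rB c th1 rdl s0 n.
rewrite -/s -/C.
have -> : expR (- (th ^+ 2 * s / 2)) ^+ n = expR (- (l ^+ 2 * s / 2)).
  rewrite -expRM_natl; congr expR; rewrite thE.
  by field; rewrite gt_eqF.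
rewrite distrC => /le_trans; apply.
have -> : n%:R * (C * `|th| ^+ 3 + dl * th ^+ 2) + B * th ^+ 2 =
   (C * l ^+ 2 * `|l|) / Num.sqrt n%:R + dl * l ^+ 2 + (B * l ^+ 2) / n%:R.
  have -> : `|th| ^+ 3 = l ^+ 2 / n%:R * (`|l| / Num.sqrt n%:R).
    rewrite exprSr real_normK ?num_real// thE; congr (_ * _).
    by rewrite normrM normfV (ger0_norm (sqrtr_ge0 _)).
  by rewrite thE; field; rewrite ?gt_eqF// sqrtr_gt0.
have h1 : (C * l ^+ 2 * `|l|) / Num.sqrt n%:R <= e / 4.
  apply: le_trans (ler_norm _) _; rewrite -normrN -sub0r; near: n.
  by apply: (cvgrPdist_le _ _).1; [exact: cvg_invsqrt|rewrite divr_gt0].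
have h2 : (B * l ^+ 2) / n%:R <= e / 4.
  apply: le_trans (ler_norm _) _; rewrite -normrN -sub0r; near: n.
  by apply: (cvgrPdist_le _ _).1; [exact: cvg_divn|rewrite divr_gt0].
have h3 : dl * l ^+ 2 <= e / 2.
  rewrite /dl mulrAC ler_pdivrMr// ler_wpM2l ?divr_ge0 ?(ltW e0)//.
  by rewrite lerDl.
lra.
Unshelve. all: by end_near. Qed.

Lemma norm_expRNB_le (x y : R) : 0 <= x -> 0 <= y ->
  `|expR (- x) - expR (- y)| <= `|x - y|.
Proof.
wlog xy : x y / x <= y.
  move=> H x0 y0; have [xy|yx] := leP x y; first exact: H.
  by rewrite distrC [leRHS]distrC; apply: H => //; exact: ltW.
move=> x0 y0.
have -> : expR (- y) = expR (- x) * expR (x - y).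
  by rewrite -expRD; congr expR; ring.
have h1 : 1 + (x - y) <= expR (x - y) by exact: expR_ge1Dx.
have h2 : expR (x - y) <= 1 by rewrite -expR0 ler_expR subr_le0.
have h3 : expR (- x) <= 1 by rewrite -expR0 ler_expR oppr_le0.
rewrite -[X in X - _]mulr1 -mulrBr normrM (ger0_norm (expR_ge0 _)).
rewrite ger0_norm ?subr_ge0// ler0_norm ?subr_le0// opprB -[leRHS]mul1r.
by apply: ler_pM; rewrite ?expR_ge0 ?subr_ge0//; lra.
Qed.

Lemma norm_sub_le (x y e : R) : x <= y + e -> y <= x + e -> `|x - y| <= e.
Proof. by rewrite ler_norml; lra. Qed.

Lemma norm_sub_sqr_le (v a t A e : R) : 0 <= a -> a <= A -> 0 <= t ->
  0 <= e -> e <= 1 -> `|v - a ^+ 2| <= e -> `|a - t| <= 2 * e ->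
  `|v - t ^+ 2| <= e * (5 + 4 * A).
Proof.
move=> a0 aA t0 e0 e1 va at_.
have -> : v - t ^+ 2 = (v - a ^+ 2) + (a - t) * (a + t) by ring.
apply: (le_trans (ler_normD _ _)); rewrite normrM (ger0_norm (addr_ge0 a0 t0)).
have at' : a + t <= 2 * A + 2 * e by move: at_; rewrite ler_norml; lra.
have h := ler_pM (normr_ge0 _) (addr_ge0 a0 t0) at_ at'.
have : 0 <= e * (1 - e) by rewrite mulr_ge0// subr_ge0.
by move: va h; move: (`|_|) (`|_| * _) => x y; nra.
Qed.

Lemma norm_dist4 (p q r t e1 e2 e3 : R) : `|p - q| <= e1 -> `|q - r| <= e2 ->
  `|t - r| <= e3 -> `|p - t| <= e1 + e2 + e3.
Proof.
move=> h1 h2 h3; have -> : p - t = (p - q) + (q - r) - (t - r) by ring.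
apply: (le_trans (ler_normB _ _)); apply: lerD => //.
by apply: (le_trans (ler_normD _ _)); exact: lerD.
Qed.

(** Because the variance bound holds for every [n], replacing [h] by a coboundary changes the scaled
    sums by a small amount in [L^2] uniformly in [n]. The two boundary terms of the coboundary are
    bounded and disappear after division by [sqrt n]. *)
Lemma partial_sum_cos_cvg h (v C l c : R) : dense_coboundaries ->
  sqint pi h -> mean pi h = 0 -> 0 <= C ->
  (forall f, sqint pi f -> mean pi f = 0 ->
     forall n, avg_variance (acov X f) n <= C * ip pi f f) ->
  avg_variance (acov X h) @ \oo --> v ->
  mean Pr (fun w => cos (l * ((Num.sqrt n%:R)^-1 * partial_sum X h n w) + c)) @[n --> \oo]
    --> expR (- (l ^+ 2 * v / 2)) * cos c.
Proof.
move=> dc h2 mh C0 hC hv.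
have v0 : 0 <= v.
  rewrite -(cvg_lim _ hv)//; apply: limr_ge; first by apply/cvg_ex; exists v.
  apply: nearW => n; have := avg_variance_partial_sum hrev hX n h2 => /esym E.
  by rewrite -(pmulr_rge0 _ (ltr0Sn R n)) E ip_ge0.
pose A := Num.sqrt (C * ip pi h h).
have A0 : 0 <= A by exact: sqrtr_ge0.
apply/cvgrPdist_le => e e0.
(* The three summands are the costs, in units of [eta], of replacing [Z n] by [M n] under the
   cosine, of the limit theorem for the martingale, and of replacing the variance [s] by [v]. *)
pose K := 2 * `|l| + 1 + l ^+ 2 / 2 * (5 + 4 * A).
have K0 : 0 < K.
  by rewrite /K -addrA ltr_wpDl// ?mulr_ge0// ltr_pwDl// mulr_ge0// ?divr_ge0 ?sqr_ge0//; lra.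
pose eta := Num.min 1 (e / K).
have eta0 : 0 < eta by rewrite lt_min ltr01 divr_gt0.
have eta1 : eta <= 1 by rewrite ge_min lexx.
have etaK : eta * K <= e by rewrite -ler_pdivlMr// ge_min lexx orbT.
(* The remainder [f] consists of three pieces of norm at most [dl]: truncation of [h], recentring,
   and coboundary approximation. The scaled sums multiply its norm by at most [sqrt C]; adding 1
   keeps the denominator positive if [C = 0]. *)
pose dl := eta / (3 * (Num.sqrt C + 1)).
have sC := sqrtr_ge0 C.
have dl0 : 0 < dl by rewrite divr_gt0// mulr_gt0//; lra.
have [hb bhb hhb] := bounded_measurable_dense h2 dl0.
have shb := bm_sqint pi bhb.
have mhb : `|mean pi hb| <= dl.
  apply: le_trans (ltW hhb); rewrite -[mean pi hb]opprK normrN -[- mean pi hb]add0r -mh.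
  rewrite -meanB; [|exact: sqint_integr|exact: bm_integr].
  apply: le_trans (norm_mean_nrm (sqintB h2 shb)).
  apply: norm_mean_le => //; first exact: sqint_integr (sqintB h2 shb).
  exact/integr_norm/sqint_integr/(sqintB h2 shb).
pose psi x := hb x - mean pi hb.
have bpsi : bounded_measurable psi by apply: bmB => //; exact: bm_cst.
have mpsi : mean pi psi = 0.
  rewrite meanB ?mean_cst ?subrr//; first exact: bm_integr.
  exact: integr_cst.
have spsi := bm_sqint pi bpsi.
have [g bg gdl] := dc _ bpsi mpsi _ dl0.
have bPg := bm_Pop P bg.
pose k x := g x - Pop P g x.
have bk : bounded_measurable k by exact: bmB.
have sk := bm_sqint pi bk.
pose f x := h x - k x.
have sf : sqint pi f by exact: sqintB.
have mf : mean pi f = 0.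
  by rewrite meanB ?mh ?mean_sub_Pop ?subrr//; [exact: sqint_integr|exact: bm_integr].
have nf : nrm pi f <= 3 * dl.
  have -> : f = (fun x => (h x - hb x) + ((fun=> mean pi hb) x + (psi x - k x))).
    by apply: funext => x; rewrite /f /psi; ring.
  have s1 : sqint pi (fun x => psi x - k x) by exact: sqintB.
  have s2 : sqint pi (fun x => (fun=> mean pi hb) x + (psi x - k x)).
    by apply: sqintD => //; exact: sqint_cst.
  apply: le_trans (nrmD (sqintB h2 shb) s2) _.
  have : nrm pi (fun x => (fun=> mean pi hb) x + (psi x - k x)) <= dl + dl.
    apply: le_trans (nrmD (sqint_cst pi (mean pi hb)) s1) _; apply: lerD => //.
    by rewrite /nrm /ip mean_cst -expr2 sqrtr_sqr.
  by move: (ltW hhb); lra.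
have [_ [b gb]] := bPg.
set s := mdiff_var P pi g; have s0 : 0 <= s := mdiff_var_ge0 bg.
have shX (f0 : T -> R) : sqint pi f0 -> forall j, sqint Pr (f0 \o X j).
  by move=> sf0 j; apply/(chain_sqint hrev hX) => //; case: sf0.
have bd n w : `|Pop P g (X 0%N w) - Pop P g (X n w)| <= `|b| + `|b|.
  apply: (le_trans (ler_normB _ _)).
  by apply: lerD; apply: le_trans (gb _) _; exact: ler_norm.
pose Z n w := (Num.sqrt n%:R)^-1 * partial_sum X h n w.
pose M n w := (Num.sqrt n%:R)^-1 * martingale P X g n w.
have sZ n : sqint Pr (Z n) := sqintZ (Num.sqrt n%:R)^-1 (partial_sum_sqint hrev hX n h2).
have sM n : sqint Pr (M n) :=
  sqintZ (Num.sqrt n%:R)^-1 (bm_sqint Pr (bm_martingale n bg)).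
have ZM n : (0 < n)%N -> nrm Pr (fun w => Z n w - M n w) <=
    eta + (`|b| + `|b|) / Num.sqrt n%:R.
  move=> n0; have n0R : 0 < n%:R :> R by rewrite ltr0n.
  have sn0 : 0 < Num.sqrt n%:R :> R by rewrite sqrtr_gt0.
  have -> : (fun w => Z n w - M n w) = (fun w => (Num.sqrt n%:R)^-1 * partial_sum X f n w +
      (Num.sqrt n%:R)^-1 * (Pop P g (X 0%N w) - Pop P g (X n w))).
    apply: funext => w; rewrite /Z /M -mulrDr -mulrBr; congr (_ * _).
    have -> : partial_sum X f n w = partial_sum X h n w - partial_sum X k n w.
      by rewrite /partial_sum -sumrB.
    by rewrite martingale_partial_sum; ring.
  have sS := partial_sum_sqint hrev hX n sf.
  have sb : sqint Pr (fun w => Pop P g (X 0%N w) - Pop P g (X n w)).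
    by apply: bm_sqint; apply: bmB; exact: chain_bm.
  apply: le_trans (nrmD (sqintZ _ sS) (sqintZ _ sb)) _; apply: lerD.
    rewrite nrmZ// ger0_norm ?invr_ge0 ?sqrtr_ge0// ler_pdivrMl//.
    rewrite -(@ler_pXn2r _ 2)// ?nnegrE ?nrm_ge0 ?mulr_ge0 ?sqrtr_ge0 ?(ltW eta0)//.
    rewrite nrm_sqr exprMn sqr_sqrtr ?ler0n//.
    case: n n0 {n0R sn0 sS sb} => // n _.
    rewrite (avg_variance_partial_sum hrev hX n sf) ler_wpM2l//.
    apply: le_trans (hC f sf mf n) _.
    rewrite -nrm_sqr -{1}(sqr_sqrtr C0) -exprMn lerXn2r// ?nnegrE ?mulr_ge0 ?nrm_ge0 ?(ltW eta0)//.
    apply: le_trans (ler_wpM2l sC nf) _.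
    have -> : eta = (Num.sqrt C + 1) * (3 * dl) by rewrite /dl; field; rewrite gt_eqF//; lra.
    by rewrite ler_wpM2r ?mulr_ge0 ?(ltW dl0)//; lra.
  rewrite nrmZ// ger0_norm ?invr_ge0 ?sqrtr_ge0// mulrC ler_wpM2r ?invr_ge0 ?sqrtr_ge0//.
  rewrite -(@ler_pXn2r _ 2)// ?nnegrE ?nrm_ge0 ?addr_ge0// nrm_sqr.
  rewrite -[leRHS](mean_cst Pr); apply: le_mean; first exact: sqintM.
    exact: integr_cst.
  move=> w; rewrite -expr2 -[leLHS]real_normK ?num_real//.
  by rewrite lerXn2r ?nnegrE ?addr_ge0// bd.
have nM n : (0 < n)%N -> nrm Pr (M n) = Num.sqrt s.
  move=> n0; have sMg := bm_sqint Pr (bm_martingale n bg).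
  rewrite /nrm /M (ipZl _ sMg (sqintZ _ sMg)) (ipZr _ sMg sMg); congr Num.sqrt.
  rewrite martingale_sqr// mulrA -expr2 exprVn sqr_sqrtr ?ler0n//.
  by rewrite mulKf// pnatr_eq0 -lt0n.
have nZ n : (0 < n)%N -> nrm Pr (Z n) ^+ 2 = avg_variance (acov X h) n.-1.
  case: n => // n _; rewrite nrm_sqr.
  have sS := partial_sum_sqint hrev hX n.+1 h2.
  rewrite /Z (ipZl _ sS (sqintZ _ sS)) (ipZr _ sS sS).
  rewrite (avg_variance_partial_sum hrev hX n h2) mulrA -expr2 exprVn sqr_sqrtr ?ler0n//.
  by rewrite mulKf.
near=> n.
have n0 : (0 < n)%N by near: n; exact: nbhs_infty_gt.
have bn : (`|b| + `|b|) / Num.sqrt n%:R <= eta.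
  apply: le_trans (ler_norm _) _; rewrite -normrN -sub0r; near: n.
  by apply: (cvgrPdist_le _ _).1; [exact: cvg_invsqrt|].
have vn : `|v - avg_variance (acov X h) n.-1| <= eta.
  near: n; have /cvgrPdist_le/(_ _ eta0) [N _ HN] := hv.
  by exists N.+1 => // -[|m]//= Nm; exact: HN.
have mn : `|expR (- (l ^+ 2 * s / 2)) * cos c -
   mean Pr (fun w => cos (l / Num.sqrt n%:R * martingale P X g n w + c))| <= eta.
  near: n; apply: (cvgrPdist_le _ _).1 => //.
  exact: martingale_cos_cvg.
have ZMn : nrm Pr (fun w => Z n w - M n w) <= 2 * eta.
  by apply: (le_trans (ZM n n0)); rewrite mulr_natl mulr2n lerD2l.
have h1 : `|mean Pr (fun w => cos (l * Z n w + c)) - mean Pr (fun w => cos (l * M n w + c))|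
    <= `|l| * (2 * eta).
  have mc (F : W -> R) : sqint Pr F -> bounded_measurable (fun w => cos (l * F w + c)).
    move=> [mF _]; apply: bm_comp_continuous; [exact: continuous_cos|exact: cos_max|].
    by apply: measurable_funD => //; exact: measurable_funM.
  rewrite -meanB; [|by apply: bm_integr; exact: mc|by apply: bm_integr; exact: mc].
  apply: le_trans (ler_wpM2l (normr_ge0 l) ZMn).
  have sZM := sqintB (sZ n) (sM n).
  apply: le_trans (ler_wpM2l (normr_ge0 l) (norm_mean_nrm sZM)).
  rewrite -meanZ; last exact/integr_norm/sqint_integr.
  apply: norm_mean_le.
  - by apply: bm_integr; apply: bmB; exact: mc.
  - exact/integrZ/integr_norm/sqint_integr.
  - move=> w; apply: le_trans (norm_cosB_le _ _) _.
    by rewrite -normrM le_eqVlt; apply/orP; left; apply/eqP; congr (`|_|); ring.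
(* Both variances are seen at the same [n]: [Z n] has squared norm within [eta] of [v], [M n] has
   norm exactly [sqrt s], and the two norms differ by at most [2 eta]. *)
have h3 : `|v - s| <= eta * (5 + 4 * A).
  have ss := sqrtr_ge0 s.
  rewrite -(sqr_sqrtr s0).
  apply: (norm_sub_sqr_le (nrm_ge0 Pr (Z n)) _ ss (ltW eta0) eta1).
  - rewrite -(@ler_pXn2r _ 2)// ?nnegrE ?nrm_ge0// nZ// sqr_sqrtr ?mulr_ge0 ?ip_ge0//.
    exact: hC.
  - by rewrite nZ.
  rewrite -(nM n n0); apply: norm_sub_le.
    rewrite {1}(_ : Z n = (fun w => M n w + (Z n w - M n w))); last first.
      by apply: funext => w; rewrite addrC subrK.
    by apply: le_trans (nrmD (sM n) (sqintB (sZ n) (sM n))) _; rewrite lerD2l.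
  rewrite {1}(_ : M n = (fun w => Z n w - (Z n w - M n w))); last first.
    by apply: funext => w; rewrite subKr.
  by apply: le_trans (nrmB (sZ n) (sqintB (sZ n) (sM n))) _; rewrite lerD2l.
have h4 : `|expR (- (l ^+ 2 * v / 2)) * cos c - expR (- (l ^+ 2 * s / 2)) * cos c| <=
   l ^+ 2 / 2 * (eta * (5 + 4 * A)).
  rewrite -mulrBl normrM.
  apply: le_trans (ler_piMr (normr_ge0 _) (cos_max c)) _.
  apply: le_trans (norm_expRNB_le _ _) _.
  - by rewrite divr_ge0// mulr_ge0// sqr_ge0.
  - by rewrite divr_ge0// mulr_ge0// sqr_ge0.
  have -> : l ^+ 2 * v / 2 - l ^+ 2 * s / 2 = l ^+ 2 / 2 * (v - s) by field.
  by rewrite normrM ger0_norm ?divr_ge0 ?sqr_ge0// ler_wpM2l// divr_ge0// sqr_ge0.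
have eM : mean Pr (fun w => cos (l / Num.sqrt n%:R * martingale P X g n w + c)) =
   mean Pr (fun w => cos (l * M n w + c)).
  by apply: eq_mean => w; rewrite mulrA.
rewrite eM in mn.
apply: le_trans etaK.
apply: le_trans (norm_dist4 h4 mn h1) _.
by rewrite le_eqVlt; apply/orP; left; apply/eqP; rewrite /K; ring.
Unshelve. all: by end_near. Qed.

End CharacteristicFunctionLimit.

(** * From characteristic functions to weak convergence *)

Section WeakConvergence.
Context (R : realType).

Lemma uniform_continuity_segment (G : R -> R) (a b e : R) : continuous G -> 0 < e ->
  exists2 dl : R, 0 < dl & forall x y, a <= x <= b -> `|x - y| < dl -> `|G x - G y| < e.
Proof.
move=> cG e0.
have /compact_near_coveringP nc := @segment_compact R a b.
have e2 : 0 < e / 2 by rewrite divr_gt0.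
pose Q (dl x : R) := forall y, `|x - y| < dl -> `|G x - G y| < e.
have H : \forall dl \near 0^'+, `[a, b] `<=` Q dl.
  apply: nc => x _.
  have /cvgrPdist_lt/(_ _ e2) := cG x.
  move=> [dl /= dl0 Hdl].
  have dl2 : 0 < dl / 2 by rewrite divr_gt0.
  exists (ball x (dl / 2), [set t | 0 < t < dl / 2]).
    split; first by exact: nbhsx_ballx.
    by apply: filterS2 (nbhs_right_gt 0) (nbhs_right_lt dl2) => t /= -> ->.
  move=> [x' t] /= [xx' /andP[t0 tdl]] y x'y.
  have h1 : `|G x - G x'| < e / 2.
    by apply: Hdl => /=; apply: lt_le_trans xx' _; lra.
  have h2 : `|G x - G y| < e / 2.
    apply: Hdl => /=; rewrite (_ : x - y = (x - x') + (x' - y)); last by ring.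
    apply: le_lt_trans (ler_normD _ _) _.
    by have := ltrD xx' (lt_trans x'y tdl); lra.
  rewrite (_ : G x' - G y = (G x - G y) - (G x - G x')); last by ring.
  by apply: le_lt_trans (ler_normB _ _) _; lra.
near (0 : R)^'+ => dl.
exists dl; first by near: dl; exact: nbhs_right_gt.
move=> x y xab; by apply: (near H dl) => //=.
Unshelve. all: by end_near. Qed.

(* The Bernstein operator [\sum_(k <= n) 'C(n, k) t^k (1 - t)^(n - k) F k],
   by conditioning on the first of [n] Bernoulli trials. *)
Fixpoint bernstein (n : nat) (F : nat -> R) (t : R) : R :=
  if n is n'.+1 then t * bernstein n' (F \o S) t + (1 - t) * bernstein n' F t
  else F 0%N.

Lemma le_bernstein n F H t : 0 <= t <= 1 -> (forall k, (k <= n)%N -> F k <= H k) ->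
  bernstein n F t <= bernstein n H t.
Proof.
move=> /andP[t0 t1]; elim: n F H => [|n ih] F H FH /=; first exact: FH.
apply: lerD; apply: ler_wpM2l; rewrite ?subr_ge0//; apply: ih => k kn.
- exact: FH.
- by apply: FH; exact: leqW.
Qed.

(** Variance plus squared bias of a binomial variable. The centre [x] is kept free because a success
    in the first trial shifts it to [x - 1]. *)
Lemma bernstein_quadratic n (A K x t : R) :
  bernstein n (fun k => A + K * (k%:R - x) ^+ 2) t =
  A + K * (n%:R * t * (1 - t) + (n%:R * t - x) ^+ 2).
Proof.
elim: n x => [|n ih] x /=; first by ring.
have -> : (fun k => A + K * (k%:R - x) ^+ 2) \o S =
    (fun k => A + K * (k%:R - (x - 1)) ^+ 2).
  by apply: funext => k /=; rewrite -natr1; ring.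
by rewrite !ih -natr1; ring.
Qed.

Lemma bernstein_approx (G : R -> R) (b e : R) : continuous G -> (forall x, `|G x| <= b) ->
  0 < e -> exists n, forall t, 0 <= t <= 1 ->
  `|bernstein n (fun k => G (k%:R / n%:R)) t - G t| <= e.
Proof.
move=> cG Gb e0; have e2 : 0 < e / 2 by rewrite divr_gt0.
have [dl dl0 Hdl] := uniform_continuity_segment 0 1 cG e2.
have b0 : 0 <= b := le_trans (normr_ge0 _) (Gb 0).
(* Chebyshev's argument: at distance at least [dl] the trivial bound [2 b] is at most [K] times the
   squared distance, whose binomial mean is [t (1 - t) / n]. *)
pose K := 2 * b / dl ^+ 2.
have K0 : 0 <= K by rewrite divr_ge0 ?sqr_ge0// mulr_ge0.
pose n := (Num.trunc (2 * K / e)).+1.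
have n0 : 0 < n%:R :> R by rewrite ltr0n.
have nK : 2 * K / e < n%:R by exact: truncnS_gt.
exists n => t t01; have /andP[t0 t1] := t01.
have Hk k : `|G (k%:R / n%:R) - G t| <= e / 2 + K / n%:R ^+ 2 * (k%:R - n%:R * t) ^+ 2.
  have -> : K / n%:R ^+ 2 * (k%:R - n%:R * t) ^+ 2 = K * (t - k%:R / n%:R) ^+ 2.
    by field; rewrite gt_eqF.
  have [h|h] := ltP `|t - k%:R / n%:R| dl.
    rewrite distrC; apply: le_trans (ltW (Hdl _ _ t01 h)) _.
    by rewrite lerDl mulr_ge0// sqr_ge0.
  apply: (@le_trans _ _ (2 * b)).
    apply: le_trans (ler_normB _ _) _; have -> : 2 * b = b + b by ring.
    by apply: lerD; exact: Gb.
  apply: (@le_trans _ _ (K * (t - k%:R / n%:R) ^+ 2)); last by rewrite lerDr ltW.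
  rewrite -real_normK ?num_real// /K mulrAC ler_pdivlMr ?exprn_gt0//.
  by rewrite ler_wpM2l ?mulr_ge0// lerXn2r ?nnegrE// ltW.
have Q A K' : bernstein n (fun k => A + K' * (k%:R - n%:R * t) ^+ 2) t =
    A + K' * (n%:R * t * (1 - t)).
  by rewrite bernstein_quadratic subrr expr0n/= addr0.
have T : K / n%:R ^+ 2 * (n%:R * t * (1 - t)) <= e / 2.
  have -> : K / n%:R ^+ 2 * (n%:R * t * (1 - t)) = K / n%:R * (t * (1 - t)).
    by field; rewrite gt_eqF.
  have h1 : K / n%:R <= e / 2.
    rewrite ler_pdivrMr//; move: nK; rewrite ltr_pdivrMr//; lra.
  have h2 : t * (1 - t) <= 1 by have := sqr_ge0 t; lra.
  apply: le_trans h1; rewrite ler_piMr// divr_ge0//; exact: ltW.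
have U := @le_bernstein n (fun k => G (k%:R / n%:R))
  (fun k => (G t + e / 2) + (K / n%:R ^+ 2) * (k%:R - n%:R * t) ^+ 2) t t01.
have L := @le_bernstein n
  (fun k => (G t - e / 2) + (- (K / n%:R ^+ 2)) * (k%:R - n%:R * t) ^+ 2)
  (fun k => G (k%:R / n%:R)) t t01.
rewrite !Q in U L.
have {}U := U (fun k _ => ltac:(have := Hk k; rewrite ler_norml; lra)).
have {}L := L (fun k _ => ltac:(have := Hk k; rewrite ler_norml mulNr; lra)).
rewrite mulNr in L.
by rewrite ler_norml; apply/andP; split; lra.
Qed.

Context (d : measure_display) (W : measurableType d) (Pr : probability W R).
Variable Q : probability (measurableTypeR R) R.
Variable Z : nat -> W -> R.
Hypothesis mZ : forall n, measurable_fun setT (Z n).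
Hypothesis cosZ : forall l c, mean Pr (fun w => cos (l * Z n w + c)) @[n --> \oo] -->
  mean Q (fun x : R => cos (l * x + c)).

(** Testing [phi] against all the waves [cos (l * x + c)] gives a class stable under multiplication
    by [sin (th * x)], since products of waves are sums of waves. Plain convergence of means would
    not support the induction on Bernstein polynomials. *)
Definition cos_convergent (phi : R -> R) : Prop :=
  bounded_measurable (phi : measurableTypeR R -> R) /\
  forall l c, mean Pr (fun w => phi (Z n w) * cos (l * Z n w + c)) @[n --> \oo] -->
    mean Q (fun x : R => phi x * cos (l * x + c)).

Let bcos l c : bounded_measurable ((fun x => cos (l * x + c)) : measurableTypeR R -> R).
Proof.
apply: bm_comp_continuous; [exact: continuous_cos|exact: cos_max|].
by apply: measurable_funD => //; exact: measurable_funM.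
Qed.

Lemma bm_compZ n (phi : R -> R) : bounded_measurable (phi : measurableTypeR R -> R) ->
  bounded_measurable (fun w => phi (Z n w)).
Proof.
move=> [mphi [b pb]]; split; last by exists b => w; exact: pb.
exact: measurableT_comp (mZ n).
Qed.

Lemma cos_convergent_cvg phi : cos_convergent phi ->
  mean Pr (phi \o Z n) @[n --> \oo] --> mean Q phi.
Proof.
move=> [_ /(_ 0 0)]; under eq_fun do under eq_mean do rewrite mul0r addr0 cos0 mulr1.
by under [mean Q _]eq_mean do rewrite mul0r addr0 cos0 mulr1.
Qed.

Lemma cos_convergent_cst a : cos_convergent (fun=> a).
Proof.
split=> [|l c]; first exact: bm_cst.
rewrite meanZ; last exact/bm_integr/bcos.
have E n := meanZ a (bm_integr Pr (bm_compZ n (bcos l c))).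
rewrite (funext E).
by apply: cvgM; [exact: cvg_cst|exact: cosZ].
Qed.

Lemma cos_convergentD phi psi : cos_convergent phi -> cos_convergent psi ->
  cos_convergent (fun x => phi x + psi x).
Proof.
move=> [b1 h1] [b2 h2]; split=> [|l c]; first exact: bmD.
have i1 := bm_integr Q (bmM b1 (bcos l c)); have i2 := bm_integr Q (bmM b2 (bcos l c)).
under [mean Q _]eq_mean do rewrite mulrDl; rewrite (meanD i1 i2).
have E n : mean Pr (fun w => (phi (Z n w) + psi (Z n w)) * cos (l * Z n w + c)) =
  mean Pr (fun w => phi (Z n w) * cos (l * Z n w + c)) +
  mean Pr (fun w => psi (Z n w) * cos (l * Z n w + c)).
  have j1 := bm_integr Pr (bm_compZ n (bmM b1 (bcos l c))).
  have j2 := bm_integr Pr (bm_compZ n (bmM b2 (bcos l c))).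
  by rewrite -(meanD j1 j2); apply: eq_mean => w; rewrite mulrDl.
rewrite (funext E).
exact: cvgD.
Qed.

Lemma cos_convergentZ a phi : cos_convergent phi -> cos_convergent (fun x => a * phi x).
Proof.
move=> [b1 h1]; split=> [|l c]; first by apply: bmM => //; exact: bm_cst.
have i1 := bm_integr Q (bmM b1 (bcos l c)).
under [mean Q _]eq_mean do rewrite -mulrA; rewrite (meanZ a i1).
have E n : mean Pr (fun w => a * phi (Z n w) * cos (l * Z n w + c)) =
  a * mean Pr (fun w => phi (Z n w) * cos (l * Z n w + c)).
  have j1 := bm_integr Pr (bm_compZ n (bmM b1 (bcos l c))).
  by rewrite -(meanZ a j1); apply: eq_mean => w; rewrite mulrA.
rewrite (funext E).
by apply: cvgM => //; exact: cvg_cst.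
Qed.

Lemma sin_cos_prod (x th l c : R) : sin (th * x) * cos (l * x + c) =
  2^-1 * cos ((th + l) * x + (c - pi / 2)) -
  2^-1 * cos ((l - th) * x + (c - pi / 2)).
Proof.
have -> : (th + l) * x + (c - pi / 2) = (th * x + (l * x + c)) - pi / 2 by ring.
have -> : (l - th) * x + (c - pi / 2) = ((l * x + c) - th * x) - pi / 2 by ring.
by rewrite !cosBpihalf sinD sinB; field.
Qed.

Lemma cos_convergent_sin th phi : cos_convergent phi ->
  cos_convergent (fun x => phi x * sin (th * x)).
Proof.
move=> [b1 h1]; split=> [|l c].
  apply: bmM => //; apply: bm_comp_continuous; [exact: continuous_sin|exact: sin_max|].
  exact: measurable_funM.
set c' := c - pi / 2.
have E (x : R) : phi x * sin (th * x) * cos (l * x + c) =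
  2^-1 * (phi x * cos ((th + l) * x + c')) - 2^-1 * (phi x * cos ((l - th) * x + c')).
  by rewrite -mulrA sin_cos_prod /c'; ring.
have bb l' := bmM b1 (bcos l' c').
have bb2 l' : bounded_measurable ((fun x => 2^-1 * (phi x * cos (l' * x + c'))) : measurableTypeR R -> R).
  by apply: bmM => //; exact: bm_cst.
under [mean Q _]eq_mean do rewrite E.
rewrite (meanB (bm_integr Q (bb2 _)) (bm_integr Q (bb2 _))).
rewrite !(meanZ _ (bm_integr Q (bb _))).
have EZ n : mean Pr (fun w => phi (Z n w) * sin (th * Z n w) * cos (l * Z n w + c)) =
  2^-1 * mean Pr (fun w => phi (Z n w) * cos ((th + l) * Z n w + c')) -
  2^-1 * mean Pr (fun w => phi (Z n w) * cos ((l - th) * Z n w + c')).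
  rewrite -!(meanZ _ (bm_integr Pr (bm_compZ n (bb _)))).
  rewrite -(meanB (bm_integr Pr (bm_compZ n (bb2 _))) (bm_integr Pr (bm_compZ n (bb2 _)))).
  by apply: eq_mean => w; rewrite E.
rewrite (funext EZ).
apply: cvgB; apply: cvgM; try exact: cvg_cst; exact: h1.
Qed.

Lemma cos_convergent_bernstein n F th :
  cos_convergent (fun x => bernstein n F ((1 + sin (th * x)) / 2)).
Proof.
elim: n F => [|n ih] F /=; first exact: cos_convergent_cst.
rewrite (_ : (fun x => _) = (fun x =>
  (2^-1 * bernstein n (F \o S) ((1 + sin (th * x)) / 2) +
   2^-1 * (bernstein n (F \o S) ((1 + sin (th * x)) / 2) * sin (th * x))) +
  (2^-1 * bernstein n F ((1 + sin (th * x)) / 2) +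
   (- 2^-1) * (bernstein n F ((1 + sin (th * x)) / 2) * sin (th * x))))); last first.
  by apply: funext => x; field.
by apply: cos_convergentD; apply: cos_convergentD; apply: cos_convergentZ => //;
  exact: cos_convergent_sin.
Qed.

(** Clipping at [a < 1] keeps the argument of [asin] inside the open interval on which
    [continuous_asin] applies. *)
Lemma asin_clip_continuous (a : R) : 0 < a < 1 ->
  continuous (fun t : R => asin (Num.max (- a) (Num.min (2 * t - 1) a)) : R).
Proof.
move=> /andP[a0 a1] t.
apply: (@continuous_comp _ _ _ (fun t : R => Num.max (- a) (Num.min (2 * t - 1) a)) asin).
  have c1 : {for t, continuous (fun t : R => 2 * t - 1 : R^o)}.
    apply: cvgB; last exact: cvg_cst.
    by apply: cvgM; [exact: cvg_cst|exact: cvg_id].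
  have ca b : {for t, continuous ((fun=> b) : R -> R^o)} by exact: cvg_cst.
  exact: (continuous_max (ca (- a)) (continuous_min c1 (ca a))).
apply: continuous_asin; apply/andP; split.
  by rewrite lt_max; apply/orP; left; lra.
by rewrite gt_max gt_min a1 orbT andbT; lra.
Qed.

(* A continuous [f] is uniformly close, on [-M, M], to a polynomial in
   [sin (pi x / 4M)] that stays bounded outside [-M, M]. *)
Lemma trig_approx (f : R -> R) (b e M : R) :
  continuous f -> (forall x, `|f x| <= b) -> 0 < e -> 0 < M ->
  exists n F th, forall x : R,
    `|bernstein n F ((1 + sin (th * x)) / 2) - f x| <= e + 2 * b * (x / M) ^+ 2.
Proof.
move=> cf fb e0 M0; have p0 := @pi_gt0 R.
pose th := pi / 4 / M; have th0 : 0 < th by rewrite !divr_gt0.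
pose a : R := sin (pi / 4).
have i0 : (0 : R) \in `[- (pi / 2), pi / 2] by rewrite in_itv/=; lra.
have i4 : (pi / 4 : R) \in `[- (pi / 2), pi / 2] by rewrite in_itv/=; lra.
have i2 : (pi / 2 : R) \in `[- (pi / 2), pi / 2] by rewrite in_itv/=; lra.
have a01 : 0 < a < 1.
  by rewrite -{1}(@sin0 R) -(@sin_pihalf R) /a !ltr_sin//; lra.
have b0 : 0 <= b := le_trans (normr_ge0 _) (fb 0).
(* On [[-M, M]] the angle [th * x] stays within [pi / 4] of 0, so the clipping is inactive and
   [asin] inverts [sin]: [G] at [(1 + sin (th * x)) / 2] is [f x]. Elsewhere [G] is still bounded by
   [b], and [2 b] is at most [2 b (x / M)^2]. *)
pose G (t : R) := f (asin (Num.max (- a) (Num.min (2 * t - 1) a)) / th).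
have cG : continuous G.
  have c1 : continuous (fun t : R => asin (Num.max (- a) (Num.min (2 * t - 1) a)) / th : R).
    by move=> t; apply: cvgM; [exact: asin_clip_continuous|exact: cvg_cst].
  by move=> t; apply: (continuous_comp (c1 t)); exact: cf.
have [n Hn] := bernstein_approx cG (fun x => fb _) e0.
exists n, (fun k => G (k%:R / n%:R)), th => x.
pose t := (1 + sin (th * x)) / 2.
have t01 : 0 <= t <= 1.
  by have := sin_geN1 (th * x); have := sin_le1 (th * x); rewrite /t; lra.
have GE : `|x| <= M -> G t = f x.
  rewrite ler_norml => /andP[x1 x2]; rewrite /G.
  have tM : th * M = pi / 4 by rewrite /th divfK// gt_eqF.
  have h1 : th * x <= pi / 4 by rewrite -tM ler_wpM2l// ltW.
  have h2 : - (pi / 4) <= th * x by rewrite -tM -mulrN ler_wpM2l// ltW.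
  have iN4 : (- (pi / 4) : R) \in `[- (pi / 2), pi / 2] by rewrite in_itv/=; lra.
  have ix : th * x \in `[- (pi / 2), pi / 2] by rewrite in_itv/=; lra.
  have -> : 2 * t - 1 = sin (th * x) by rewrite /t; field.
  have s1 : sin (th * x) <= a by rewrite leNgt ltr_sin// -leNgt.
  have s2 : - a <= sin (th * x) by rewrite -sinN leNgt ltr_sin// -leNgt.
  rewrite (min_idPl s1) (max_idPr s2) sinK//; congr f.
  by rewrite mulrAC divff ?mul1r// gt_eqF.
have [xM|xM] := leP `|x| M.
  rewrite -GE//; apply: le_trans (Hn t t01) _.
  by rewrite lerDl; apply: mulr_ge0; [exact: mulr_ge0|exact: sqr_ge0].
rewrite (_ : _ - f x =
  (bernstein n (fun k => G (k%:R / n%:R)) t - G t) + (G t - f x)); last by ring.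
apply: le_trans (ler_normD _ _) _; apply: lerD; first exact: Hn.
apply: (@le_trans _ _ (2 * b)).
  apply: le_trans (ler_normB _ _) _; have -> : 2 * b = b + b by ring.
  by apply: lerD; exact: fb.
rewrite ler_peMr ?mulr_ge0//.
rewrite -real_normK ?num_real// normrM normfV (gtr0_norm M0).
by rewrite -{1}(expr1n _ 2) lerXn2r ?nnegrE ?divr_ge0 ?(ltW M0)// ler_pdivlMr// mul1r ltW.
Qed.

Variable C : R.
Hypothesis sZ : forall n, sqint Pr (Z n).
Hypothesis ZC : forall n, ip Pr (Z n) (Z n) <= C.
Hypothesis sQ : sqint Q (id : measurableTypeR R -> R).

Lemma mean_trig_approx (d0 : measure_display) (T0 : measurableType d0)
    (mu : probability T0 R) (Y : T0 -> R) (phi f : R -> R) e K :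
  sqint mu Y -> bounded_measurable (phi \o Y) -> bounded_measurable (f \o Y) ->
  (forall x, `|phi x - f x| <= e + K * x ^+ 2) ->
  `|mean mu (phi \o Y) - mean mu (f \o Y)| <= e + K * ip mu Y Y.
Proof.
move=> sY bp bf H.
have iY : integr mu (fun x => Y x * Y x) by exact: sqintM.
have iE : integr mu (fun x => e + K * (Y x * Y x)).
  by apply: integrD; [exact: integr_cst|exact: integrZ].
rewrite -(meanB (bm_integr mu bp) (bm_integr mu bf)).
have -> : e + K * ip mu Y Y = mean mu (fun x => e + K * (Y x * Y x)).
  by rewrite meanD ?mean_cst ?meanZ//; [exact: integr_cst|exact: integrZ].
apply: norm_mean_le => //; first by apply: bm_integr; exact: bmB.
by move=> x; rewrite -expr2; exact: H.
Qed.

(** The quadratic error of [trig_approx] integrates to a multiple of the second moment, which is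
    bounded by [C] along [Z n] and finite for [Q]; a large [M] makes it negligible. *)
Lemma weak_convergence (f : R -> R) (b : R) : continuous f -> (forall x, `|f x| <= b) ->
  mean Pr (f \o Z n) @[n --> \oo] --> mean Q f.
Proof.
move=> cf fb; apply/cvgrPdist_le => e e0.
have b0 : 0 <= b := le_trans (normr_ge0 _) (fb 0).
pose D := `|C| + ip Q (id : measurableTypeR R -> R) id + 1.
have D0 : 0 < D by rewrite /D ltr_wpDl// addr_ge0 ?ip_ge0.
(* [D] dominates all second moments, and this [M] makes [2 b D / M^2] at most [e / 8]. Five errors
   of this size occur in the end. *)
pose M := Num.sqrt (8 * (2 * b + 1) * D / e).
have M20 : 0 < 8 * (2 * b + 1) * D / e by rewrite divr_gt0// !mulr_gt0//; lra.
have M0 : 0 < M by rewrite sqrtr_gt0.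
have M2 : M ^+ 2 = 8 * (2 * b + 1) * D / e by rewrite sqr_sqrtr ?ltW.
have e4 : 0 < e / 8 by rewrite divr_gt0.
have [N [F [th H]]] := trig_approx cf fb e4 M0.
pose phi (x : R) := bernstein N F ((1 + sin (th * x)) / 2).
have gphi : cos_convergent phi := cos_convergent_bernstein N F th.
have bphi := gphi.1.
have bf : bounded_measurable (f : measurableTypeR R -> R).
  by split; [exact: continuous_measurable_fun|exists b].
pose K := 2 * b / M ^+ 2.
have K0 : 0 <= K by rewrite divr_ge0 ?sqr_ge0// mulr_ge0.
have H' x : `|phi x - f x| <= e / 8 + K * x ^+ 2.
  apply: le_trans (H x) _; rewrite lerD2l le_eqVlt; apply/orP; left; apply/eqP.
  by rewrite /K; field; rewrite gt_eqF.
have KD : K * D <= e / 8.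
  rewrite /K M2 [X in X * D](_ : _ = (2 * b * e) / (8 * (2 * b + 1) * D)); last first.
    by field; rewrite !gt_eqF//; lra.
  rewrite mulrAC ler_pdivrMr ?mulr_gt0//; last by lra.
  have -> : e / 8 * (8 * (2 * b + 1) * D) = (2 * b * e + e) * D by field.
  apply: ler_wpM2r; first exact: ltW.
  by rewrite lerDl ltW.
have KE x : x <= D -> K * x <= e / 8 by move=> xD; apply: le_trans KD; rewrite ler_wpM2l.
near=> n.
have h1 : `|mean Q phi - mean Pr (phi \o Z n)| <= e / 8.
  by near: n; apply: (cvgrPdist_le _ _).1 => //; exact: cos_convergent_cvg.
have h2 := mean_trig_approx sQ bphi bf H'.
have h3 := mean_trig_approx (sZ n) (bm_compZ n bphi) (bm_compZ n bf) H'.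
have k2 : K * ip Q (id : measurableTypeR R -> R) id <= e / 8.
  by apply: KE; rewrite /D; have := normr_ge0 C; lra.
have k3 : K * ip Pr (Z n) (Z n) <= e / 8.
  apply: KE; apply: (le_trans (ZC n)); rewrite /D.
  by have := ler_norm C; have := ip_ge0 Q (id : measurableTypeR R -> R); lra.
rewrite (_ : mean Q f - mean Pr (f \o Z n) = - (mean Q (phi \o id) - mean Q (f \o id)) +
  (mean Q phi - mean Pr (phi \o Z n)) + (mean Pr (phi \o Z n) - mean Pr (f \o Z n)));
  last by ring.
apply: le_trans (ler_normD _ _) _.
apply: (@le_trans _ _ ((e / 8 + e / 8 + e / 8) + (e / 8 + e / 8))); last first.
  by lra.
apply: lerD; last by apply: le_trans h3 _; rewrite lerD2l.
apply: le_trans (ler_normD _ _) _; apply: lerD => //.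
by rewrite normrN; apply: le_trans h2 _; rewrite lerD2l.
Unshelve. all: by end_near. Qed.

End WeakConvergence.

(** * The normal characteristic function *)

Section GaussianCharacteristicFunction.
Context (R : realType) (s : R).
Hypothesis s0 : 0 < s.
Local Notation mu := (@lebesgue_measure R).
Local Notation p := (normal_pdf 0 s).

Let sn0 : s != 0. Proof. by rewrite gt_eqF. Qed.

Lemma normal_pdf_exp (t x : R) : t != 0 ->
  normal_pdf 0 t x = normal_peak t * expR (- (x ^+ 2 / (2 * t ^+ 2))).
Proof.
move=> t0; rewrite normal_pdfE// /normal_fun subr0; congr (_ * expR _).
by rewrite mulNr -mulr_natl.
Qed.

(** Half of the exponent absorbs [x^2], by [y exp(-y) <= 1]; the other half is a normal density of
    twice the variance. Second moments thus become integrable by comparison. *)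
Lemma normal_pdf_sqr_le : exists2 K : R, 0 <= K & forall x : R,
  x ^+ 2 * p x <= K * normal_pdf 0 (Num.sqrt 2 * s) x.
Proof.
have t0 : Num.sqrt 2 * s != 0 by rewrite mulf_neq0// gt_eqF// sqrtr_gt0.
have pk := normal_peak_gt0 t0; have pk' := normal_peak_gt0 sn0.
exists (4 * s ^+ 2 * (normal_peak s / normal_peak (Num.sqrt 2 * s))).
  by apply: mulr_ge0; [rewrite mulr_ge0// sqr_ge0|rewrite divr_ge0// ltW].
move=> x; rewrite !normal_pdf_exp//.
rewrite exprMn sqr_sqrtr//.
have -> : x ^+ 2 / (2 * s ^+ 2) = x ^+ 2 / (2 * (2 * s ^+ 2)) + x ^+ 2 / (2 * (2 * s ^+ 2)).
  by field.
rewrite opprD expRD; set y := x ^+ 2 / (2 * (2 * s ^+ 2)).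
have xy : x ^+ 2 = 4 * s ^+ 2 * y by rewrite /y; field.
have y1 : y * expR (- y) <= 1.
  rewrite expRN ler_pdivrMr ?expR_gt0// mul1r.
  by apply: le_trans (expR_ge1Dx y); rewrite lerDr.
have -> : 4 * s ^+ 2 * (normal_peak s / normal_peak (Num.sqrt 2 * s)) *
   (normal_peak (Num.sqrt 2 * s) * expR (- y)) =
   4 * s ^+ 2 * normal_peak s * expR (- y).
  by field; rewrite gt_eqF.
rewrite xy.
have -> : 4 * s ^+ 2 * y * (normal_peak s * (expR (- y) * expR (- y))) =
  4 * s ^+ 2 * normal_peak s * expR (- y) * (y * expR (- y)) by ring.
rewrite ler_piMr// !mulr_ge0 ?expR_ge0 ?sqr_ge0//; exact: ltW.
Qed.

Lemma le_integrable_pdf (f g : R -> R) : measurable_fun setT f ->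
  mu.-integrable setT (EFin \o g) -> (forall x, `|f x| <= g x) ->
  mu.-integrable setT (EFin \o f).
Proof.
move=> mf ig fg; apply: le_integrable ig => //; first exact/measurable_EFinP.
by move=> x _ /=; rewrite lee_fin (le_trans (fg x))// ler_norm.
Qed.

Lemma integrable_bm_pdf (f : R -> R) (b : R) : measurable_fun setT f ->
  (forall x, `|f x| <= b) -> mu.-integrable setT (EFin \o (fun x => f x * p x)).
Proof.
move=> mf fb; apply: (@le_integrable_pdf _ (fun x => b * p x)).
- by apply: measurable_funM => //; exact: measurable_normal_pdf.
- exact: (integrableZl measurableT b (integrable_normal_pdf 0 s)).
- by move=> x; rewrite normrM ler_pM// ger0_norm// normal_pdf_ge0.
Qed.

Lemma integrable_sqr_pdf : mu.-integrable setT (EFin \o (fun x : R => x ^+ 2 * p x)).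
Proof.
have [K K0 HK] := normal_pdf_sqr_le.
apply: (@le_integrable_pdf _ (fun x => K * normal_pdf 0 (Num.sqrt 2 * s) x)).
- apply: measurable_funM; last exact: measurable_normal_pdf.
  exact: measurable_funX.
- exact: (integrableZl measurableT K (integrable_normal_pdf 0 (Num.sqrt 2 * s))).
- by move=> x; rewrite ger0_norm// mulr_ge0 ?sqr_ge0 ?normal_pdf_ge0.
Qed.

Lemma integrable_norm_pdf : mu.-integrable setT (EFin \o (fun x : R => (1 + x ^+ 2) * p x)).
Proof.
have := integrableD measurableT (integrable_normal_pdf 0 s) integrable_sqr_pdf.
by congr (_.-integrable _ _); apply: funext => x /=; rewrite mulrDl mul1r.
Qed.

Lemma integrable_x_pdf (f : R -> R) : measurable_fun setT f ->
  (forall x, `|f x| <= 1) -> mu.-integrable setT (EFin \o (fun x : R => x * f x * p x)).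
Proof.
move=> mf f1; apply: (le_integrable_pdf _ integrable_norm_pdf).
  apply: measurable_funM; last exact: measurable_normal_pdf.
  exact: measurable_funM.
move=> x; rewrite !normrM (ger0_norm (normal_pdf_ge0 _ _ _)).
rewrite ler_wpM2r ?normal_pdf_ge0//.
apply: (@le_trans _ _ `|x|); first by rewrite ler_piMr.
by rewrite -[x ^+ 2]real_normK ?num_real//; have := sqr_ge0 (`|x| - 1); have := normr_ge0 x; nra.
Qed.

Lemma is_derive_normal_pdf (x : R) : is_derive x 1 p (- (x / s ^+ 2) * p x).
Proof.
have -> : p = (fun x => normal_peak s * expR (- (x ^+ 2 / (2 * s ^+ 2)))).
  by apply: funext => z; rewrite normal_pdf_exp.
by apply: is_derive_eq; rewrite /GRing.scale/= mulr0 add0r !mulr1; field.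
Qed.

Lemma measurable_cos_affine (l c : R) : measurable_fun setT (fun x => cos (l * x + c)).
Proof.
apply: measurableT_comp; first exact: (continuous_measurable_fun (@continuous_cos R)).
by apply: measurable_funD => //; exact: measurable_funM.
Qed.

Lemma measurable_sin_affine (l c : R) : measurable_fun setT (fun x => sin (l * x + c)).
Proof.
apply: measurableT_comp; first exact: (continuous_measurable_fun (@continuous_sin R)).
by apply: measurable_funD => //; exact: measurable_funM.
Qed.

Definition gauss_cf (c t : R) : R := \int[mu]_x (cos (t * x + c) * p x).

Lemma cvg_Rintegral_symmetric_itv (f : R -> R) : mu.-integrable setT (EFin \o f) ->
  \int[mu]_(x in `[- n%:R, n%:R]) f x @[n --> \oo] --> \int[mu]_x f x.
Proof.
move=> fi; have mf : measurable_fun setT f by move: fi => /measurable_int/measurable_EFinP.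
apply: fine_cvg; rewrite /Rintegral fineK; last exact: integrable_fin_num.
have mI n : measurable (`[- n%:R, n%:R] : set R) by exact: measurable_itv.
under eq_fun do rewrite integral_mkcond.
apply: (@dominated_cvg _ _ _ mu _ measurableT (fun n => (EFin \o f) \_ `[- n%:R, n%:R])
  (EFin \o f) (fun x => `|(f x)%:E|%E)) => //.
- by move=> n; apply/(measurable_restrictT _ (mI n)); apply: measurable_funTS; exact/measurable_EFinP.
- move=> x _; apply: cvg_near_cst; near=> n.
  rewrite patchE mem_set//= in_itv/= -ler_norml; near: n; exact: nbhs_infty_ger.
- exact: integrable_abse.
- move=> n x _; rewrite patchE; case: ifPn => // _.
  by rewrite abse0.
Unshelve. all: by end_near. Qed.

(* Stein's identity: the integrand is the derivative of [s^2 sin(t x + c) p x]. *)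
Lemma gauss_stein (c t : R) :
  \int[mu]_x (x * sin (t * x + c) * p x) = t * s ^+ 2 * gauss_cf c t.
Proof.
pose F x := s ^+ 2 * (sin (t * x + c) * p x).
pose f x := t * s ^+ 2 * (cos (t * x + c) * p x) - x * sin (t * x + c) * p x.
have dF (x : R) : is_derive x 1 F (f x).
  have ds : is_derive x 1 (fun x => sin (t * x + c)) (t * cos (t * x + c)).
    by apply: is_derive_eq; rewrite /GRing.scale/= addr0 mulr1 mulrC.
  have dp := is_derive_normal_pdf x.
  by apply: is_derive_eq; rewrite /GRing.scale/= /f; field.
have cF : continuous F.
  by move=> x; apply: differentiable_continuous; apply/derivable1_diffP; exact: ex_derive.
have cp : continuous p by apply: continuous_normal_pdf.
have ca (x : R) : {for x, continuous (fun x => t * x + c)}.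
  apply: cvgD; last exact: cvg_cst.
  by apply: cvgM; [exact: cvg_cst|exact: cvg_id].
have cf : continuous f.
  move=> x; apply: cvgB.
    apply: cvgM; first exact: cvg_cst.
    apply: cvgM; last exact: cp.
    by apply: (continuous_comp (ca x)); exact: continuous_cos.
  apply: cvgM; last exact: cp.
  apply: cvgM; first exact: cvg_id.
  by apply: (continuous_comp (ca x)); exact: continuous_sin.
have i1 : mu.-integrable setT (EFin \o (fun x : R => cos (t * x + c) * p x)).
  by apply: (@integrable_bm_pdf _ 1); [exact: measurable_cos_affine|move=> x; exact: cos_max].
have i2 : mu.-integrable setT (EFin \o (fun x : R => x * sin (t * x + c) * p x)).
  by apply: integrable_x_pdf; [exact: measurable_sin_affine|move=> x; exact: sin_max].
have i3 : mu.-integrable setT (EFin \o (fun x : R => t * s ^+ 2 * (cos (t * x + c) * p x))).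
  exact: (integrableZl measurableT (t * s ^+ 2) i1).
have i4 : mu.-integrable setT (EFin \o f).
  exact: (integrableB measurableT i3 i2).
suff : \int[mu]_x f x = 0.
  rewrite RintegralB// RintegralZl// => /eqP; rewrite subr_eq0 => /eqP.
  by rewrite /gauss_cf => <-.
have E n : (0 < n)%N -> \int[mu]_(x in `[- n%:R, n%:R]) f x = F n%:R - F (- n%:R).
  move=> n0; rewrite /Rintegral (@continuous_FTC2 _ f F)//.
  - by rewrite gtrN// ltr0n.
  - exact: continuous_subspaceT.
  - split; first by move=> x _; exact: ex_derive.
    + exact: cvg_at_right_filter (cF _).
    + exact: cvg_at_left_filter (cF _).
  - by move=> x _; rewrite derive1E; exact: derive_val.
have L1 : \int[mu]_(x in `[- n%:R, n%:R]) f x @[n --> \oo] --> \int[mu]_x f x.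
  exact: cvg_Rintegral_symmetric_itv.
have L2 : (F n%:R - F (- n%:R)) @[n --> \oo] --> 0.
  (* The boundary values are estimated by [exp(-y) <= 1 / y] with [y = n^2 / (2 s^2)], and then
     [1 / n^2 <= 1 / n]; each is at most [C / (2 n)]. *)
  pose C := 4 * s ^+ 4 * normal_peak s.
  apply/norm_cvg0P; apply: (squeeze_cvgr _ (cvg_cst 0) (cvg_divn C)).
  near=> n; have n1 : 1 <= n%:R :> R by near: n; exact: nbhs_infty_ger.
  rewrite normr_ge0/=.
  have pn (x : R) : x ^+ 2 = n%:R ^+ 2 -> `|F x| <= C / 2 / n%:R.
    move=> xn; rewrite /F normrM (ger0_norm (sqr_ge0 s)) normrM.
    rewrite (ger0_norm (normal_pdf_ge0 _ _ _)) normal_pdf_exp// xn.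
    have e1 : expR (- (n%:R ^+ 2 / (2 * s ^+ 2))) <= 2 * s ^+ 2 / n%:R.
      have y0 : 0 < n%:R ^+ 2 / (2 * s ^+ 2) by rewrite divr_gt0 ?mulr_gt0 ?exprn_gt0//; lra.
      have h := expR_ge1Dx (n%:R ^+ 2 / (2 * s ^+ 2)).
      rewrite expRN; apply: (@le_trans _ _ (n%:R ^+ 2 / (2 * s ^+ 2))^-1).
        by rewrite lef_pV2 ?posrE ?expR_gt0//; lra.
      have n0 : 0 < n%:R :> R by lra.
      have n2 : (n%:R ^+ 2)^-1 <= n%:R^-1 :> R.
        by rewrite lef_pV2 ?posrE ?exprn_gt0//; nra.
      by rewrite invf_div; apply: ler_wpM2l n2; rewrite mulr_ge0// sqr_ge0.
    have -> : C / 2 / n%:R = s ^+ 2 * (1 * (normal_peak s * (2 * s ^+ 2 / n%:R))).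
      by rewrite /C; field; lra.
    apply: ler_wpM2l; first exact: sqr_ge0.
    apply: ler_pM => //; first by rewrite mulr_ge0 ?expR_ge0// normal_peak_ge0.
      exact: sin_max.
    by rewrite ler_wpM2l// normal_peak_ge0.
  apply: (le_trans (ler_normB _ _)).
  have -> : C / n%:R = C / 2 / n%:R + C / 2 / n%:R by field; lra.
  by apply: lerD; apply: pn => //; rewrite sqrrN.
apply: (cvg_unique _ L1) => //=.
apply: cvg_trans L2; apply: near_eq_cvg; near=> n.
rewrite E//; near: n; exact: nbhs_infty_gt.
Unshelve. all: by end_near. Qed.

(** Differentiation under the integral sign, dominated by [(1 + x^2) p x], gives minus the integral
    in [gauss_stein]; the outcome is a first-order linear equation in [t]. *)
Lemma is_derive_gauss_cf (c t : R) : is_derive t 1 (gauss_cf c) (- (t * s ^+ 2) * gauss_cf c t).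
Proof.
pose f (u x : R) := cos (u * x + c) * p x.
have df (u x : R) : is_derive u 1 (fun u => f u x) (- (x * sin (u * x + c) * p x)).
  by apply: is_derive_eq; rewrite /GRing.scale/=; ring.
have I : `]t - 1, t + 1[%classic t by rewrite /= in_itv/=; lra.
have int_f u : `]t - 1, t + 1[%classic u -> mu.-integrable setT (EFin \o f u).
  by move=> _; apply: (@integrable_bm_pdf _ 1); [exact: measurable_cos_affine|move=> x; exact: cos_max].
have der (u x : R) : `]t - 1, t + 1[%classic u -> setT x -> derivable (f^~ x) u 1.
  by move=> _ _; exact: (@ex_derive _ _ _ _ _ _ _ (df u x)).
have p1 u x : partial1of2 f u x = - (x * sin (u * x + c) * p x).
  by rewrite partial1of2E; exact: (@derive_val _ _ _ _ _ _ _ (df u x)).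
have G0 (x : R) : 0 <= (1 + x ^+ 2) * p x.
  by rewrite mulr_ge0 ?normal_pdf_ge0// addr_ge0// sqr_ge0.
have ub (u x : R) : `]t - 1, t + 1[%classic u -> setT x ->
    `|partial1of2 f u x| <= (1 + x ^+ 2) * p x.
  move=> _ _; rewrite p1 normrN !normrM (ger0_norm (normal_pdf_ge0 _ _ _)).
  rewrite ler_wpM2r ?normal_pdf_ge0//.
  apply: (@le_trans _ _ `|x|); first by rewrite ler_piMr// sin_max.
  by rewrite -[x ^+ 2]real_normK ?num_real//; have := sqr_ge0 (`|x| - 1); have := normr_ge0 x; nra.
have D := derivable_under_integral measurableT I int_f der G0 integrable_norm_pdf ub.
have V := differentiation_under_integral measurableT I int_f der G0 integrable_norm_pdf ub.
apply: DeriveDef; first exact: D.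
rewrite -derive1E [LHS]V.
under eq_Rintegral do rewrite p1 -mulN1r.
rewrite RintegralZl//; first by rewrite gauss_stein; ring.
by apply: integrable_x_pdf; [exact: measurable_sin_affine|move=> x; exact: sin_max].
Qed.

Lemma gauss_cfE (c t : R) : gauss_cf c t = expR (- (t ^+ 2 * s ^+ 2 / 2)) * cos c.
Proof.
(* The integrating factor of the equation: [g] has derivative 0 and is compared with its value at
   0. *)
pose g t := expR (t ^+ 2 * s ^+ 2 / 2) * gauss_cf c t.
have dg (u : R) : is_derive u 1 g 0.
  have dc := is_derive_gauss_cf c u.
  by apply: is_derive_eq; rewrite /GRing.scale/= !mulr0 add0r !mulr1; field.
have [z _] := mean_value t dg; rewrite mul0r => /eqP; rewrite subr_eq0 => /eqP.
have -> : g 0 = cos c.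
  rewrite /g expr0n/= !mul0r expR0 mul1r /gauss_cf.
  under eq_Rintegral do rewrite mul0r add0r.
  rewrite RintegralZl//; last exact: integrable_normal_pdf.
  by rewrite /Rintegral integral_normal_pdf mulr1.
by rewrite /g expRN => <-; rewrite mulKf// gt_eqF// expR_gt0.
Qed.

Local Notation Q := (normal_prob 0 s : probability (measurableTypeR R) R).

Lemma mean_normal_bm (f : measurableTypeR R -> R) : bounded_measurable f ->
  mean Q f = \int[mu]_x (f x * p x).
Proof.
have I (f0 : R -> R) : bounded_measurable (f0 : measurableTypeR R -> R) ->
    mu.-integrable setT (EFin \o (fun x => f0 x * p x)).
  by move=> [mf [b fb]]; exact: integrable_bm_pdf mf fb.
move: f; apply: (@bounded_functional_ext R _ (measurableTypeR R) (mean Q)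
    (fun f => \int[mu]_x (f x * p x))).
- split.
  + by move=> f g bf bg; rewrite meanD//; exact: bm_integr.
  + by move=> a f bf; rewrite meanZ//; exact: bm_integr.
  + by exists 1 => f g e bf bg fg; rewrite mul1r; exact: mean_unif.
- split.
  + move=> f g bf bg; rewrite -RintegralD//; [|exact: I|exact: I].
    by apply: eq_Rintegral => x _; rewrite mulrDl.
  + move=> a f bf; rewrite -RintegralZl//; last exact: I.
    by apply: eq_Rintegral => x _; rewrite mulrA.
  + exists 1 => f g e bf bg fg; rewrite mul1r.
    rewrite -RintegralB//; [|exact: I|exact: I].
    have Ifg := I _ (bmB bf bg).
    under eq_Rintegral do rewrite -mulrBl.
    apply: le_trans (le_normr_Rintegral measurableT Ifg) _.
    have -> : e = \int[mu]_x (e * p x).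
      rewrite RintegralZl//; last exact: integrable_normal_pdf.
      by rewrite /Rintegral integral_normal_pdf mulr1.
    apply: le_Rintegral => //.
    * exact: integrable_norm Ifg.
    * exact: (integrableZl measurableT e (integrable_normal_pdf 0 s)).
    * move=> x _; rewrite normrM (ger0_norm (normal_pdf_ge0 _ _ _)).
      by rewrite ler_wpM2r// normal_pdf_ge0.
move=> A mA; rewrite mean_indic//; congr fine; rewrite /normal_prob [LHS]integral_mkcond.
apply: eq_integral => x _; rewrite patchE indicE; case: ifPn => _ /=.
  by rewrite mul1r.
by rewrite mul0r.
Qed.

Lemma mean_normal_cos (l c : R) :
  mean Q (fun x : R => cos (l * x + c)) = expR (- (l ^+ 2 * s ^+ 2 / 2)) * cos c.
Proof.
rewrite mean_normal_bm; first exact: gauss_cfE.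
split; first exact: measurable_cos_affine.
by exists 1 => x; exact: cos_max.
Qed.

(** The density formula [mean_normal_bm] covers bounded functions; Fatou's lemma along truncations
    carries the second moment bound over to the identity. *)
Lemma sqint_normal : sqint Q (id : measurableTypeR R -> R).
Proof.
have mc n : bounded_measurable ((clip n \o id) : measurableTypeR R -> R).
  by apply: bm_clip; exact: measurable_id.
pose c := \int[mu]_x (x ^+ 2 * p x).
have c0 : 0 <= c by apply: Rintegral_ge0 => x _; rewrite mulr_ge0 ?sqr_ge0 ?normal_pdf_ge0.
have K n : mean Q (fun x => clip n x ^+ 2) <= c.
  rewrite mean_normal_bm; last exact: bmX2 (mc n).
  apply: le_Rintegral => //.
  - by have [m [b hb]] := bmX2 (mc n); exact: integrable_bm_pdf m hb.
  - exact: integrable_sqr_pdf.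
  - move=> x _; rewrite ler_wpM2r ?normal_pdf_ge0//.
    rewrite -[leLHS]real_normK ?num_real// -[leRHS]real_normK ?num_real//.
    by rewrite lerXn2r ?nnegrE// clip_norm_le.
apply: (integral_sqr_sqint (c := Num.sqrt c) _ _ (sqrtr_ge0 c)).1.
  exact: measurable_id.
rewrite sqr_sqrtr//.
have E (x : R) : (x ^+ 2)%:E = limn_einf (fun n => (clip n x ^+ 2)%:E).
  apply/esym; apply: (cvg_limn_einf_sup _).1; apply: cvg_near_cst.
  near=> n; rewrite clip_id//; near: n; exact: nbhs_infty_ger.
under eq_integral do rewrite E.
apply: le_trans (fatou Q measurableT _ _) _.
- by move=> n; apply/measurable_EFinP/measurable_funX; case: (mc n).
- by move=> n x _; rewrite lee_fin sqr_ge0.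
apply: (limn_einf_le (k := 0)) => n _.
by rewrite meanE ?lee_fin//; apply: bm_integr; exact: bmX2 (mc n).
Unshelve. all: by end_near. Qed.

End GaussianCharacteristicFunction.

Section CenteredNormal.
Context (R : realType) (v : R).
Hypothesis v0 : 0 <= v.

Lemma mean_centered_normal_cos (l c : R) :
  mean (centered_normal v) (fun x : R => cos (l * x + c)) =
  expR (- (l ^+ 2 * v / 2)) * cos c.
Proof.
rewrite /centered_normal; case: eqVneq => [->|vn0].
  rewrite mean_fine integral_dirac//=; last first.
    by apply/measurable_EFinP; exact: measurable_cos_affine.
  by rewrite indicT/= mul1r !mulr0 add0r mul0r oppr0 expR0 mul1r.
by rewrite mean_normal_cos ?sqr_sqrtr// sqrtr_gt0 lt0r vn0.
Qed.

Lemma sqint_centered_normal : sqint (centered_normal v) (id : measurableTypeR R -> R).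
Proof.
rewrite /centered_normal; case: eqVneq => [_|vn0].
  have m2 : measurable_fun [set: measurableTypeR R] (fun x : R => (x ^+ 2)%:E).
    by apply/measurable_EFinP; exact: measurable_funX.
  split; first exact: measurable_id.
  apply/integrableP; split; first exact: m2.
  rewrite integral_dirac//=; last first.
    have /measurable_EFinP m2' := m2.
    by apply/measurable_EFinP; exact: measurableT_comp m2'.
  by rewrite ?diracT ?indicT ?mul1e ltry.
by apply: sqint_normal; rewrite sqrtr_gt0 lt0r vn0.
Qed.

End CenteredNormal.

(** * The two implications *)

Section UniformBoundedness.
Context (R : realType) (d : measure_display) (T : measurableType d).
Variable pi : probability T R.
Implicit Types f g : T -> R.
Variables (p : nat -> (T -> R) -> R) (N : nat -> R).
Hypothesis pD : forall n f g, sqint pi f -> sqint pi g ->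
  p n (fun x => f x + g x) <= p n f + p n g.
Hypothesis pZ : forall n c f, sqint pi f -> p n (fun x => c * f x) = `|c| * p n f.
Hypothesis N0 : forall n, 0 <= N n.
Hypothesis pN : forall n f, sqint pi f -> p n f <= N n * nrm pi f.

Let pB n f g : sqint pi f -> sqint pi g ->
  p n (fun x => f x - g x) <= p n f + p n g.
Proof.
move=> f2 g2; have := pZ n (- 1) g2; rewrite normrN1 mul1r => <-.
rewrite (_ : (fun x => f x - g x) = (fun x => f x + (- 1) * g x)).
  by apply: pD => //; exact: sqintZ.
by apply: funext => x; rewrite mulN1r.
Qed.

(** Nonnegative witnesses make the sums of humps nondecreasing, so that their limit is a monotone
    one. One of the positive and negative parts of [f] carries at least half of [p n f], which
    explains the factor 2 in the proof. *)
Let nonneg_witness K : ~ (exists K, forall n f, sqint pi f -> p n f <= K * nrm pi f) ->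
  exists n g, [/\ sqint pi g, forall x, 0 <= g x, nrm pi g = 1 & K < p n g].
Proof.
move=> H.
have [n [f [f2 Kf]]] : exists n f, sqint pi f /\ 2 * `|K| * nrm pi f < p n f.
  apply: contrapT => H'; apply: H; exists (2 * `|K|) => n f f2.
  by rewrite leNgt; apply/negP => h; apply: H'; exists n, f.
have f0 := nrm_ge0 pi f.
have [g [g2 g0 gf pg]] : exists g, [/\ sqint pi g, forall x, 0 <= g x,
    nrm pi g <= nrm pi f & `|K| * nrm pi f < p n g].
  pose fp x := Num.max (f x) 0; pose fm x := Num.max (- f x) 0.
  have mf := sqint_meas f2.
  have mfp : measurable_fun setT fp by exact: measurable_maxr.
  have mfm : measurable_fun setT fm.
    by apply: measurable_maxr => //; exact: measurableT_comp.
  have fp_le x : `|fp x| <= `|f x|.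
    by rewrite /fp maxElt; case: ltP => h; rewrite ?normr0.
  have fm_le x : `|fm x| <= `|f x|.
    by rewrite /fm maxElt; case: ltP => h; rewrite ?normr0 ?normrN.
  have fp2 := le_sqint mfp fp_le f2; have fm2 := le_sqint mfm fm_le f2.
  have nle h : sqint pi h -> (forall x, `|h x| <= `|f x|) -> nrm pi h <= nrm pi f.
    move=> h2 hf; rewrite ler_sqrt ?ip_ge0//; apply: le_mean; try exact: sqintM.
    move=> x; rewrite -!expr2 -[leLHS]real_normK ?num_real// -[leRHS]real_normK ?num_real//.
    by rewrite lerXn2r ?nnegrE.
  have E : f = (fun x => fp x - fm x).
    by apply: funext => x; rewrite /fp /fm !maxElt; have [h1|h1] := ltP (f x) 0;
    have [h2|h2] := ltP (- f x) 0; lra.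
  have := pB n fp2 fm2; rewrite -E => h.
  have [h1|h1] := ltP (`|K| * nrm pi f) (p n fp).
    by exists fp; split => //; [move=> x; rewrite le_max lexx orbT|exact: nle].
  exists fm; split => //; [by move=> x; rewrite le_max lexx orbT|exact: nle|].
  by move: Kf h h1; rewrite -mulrA; lra.
have pg0 : 0 < p n g by apply: le_lt_trans pg; rewrite mulr_ge0.
have ng : 0 < nrm pi g.
  rewrite lt0r nrm_ge0 andbT; apply/eqP => ng.
  by have := pN n g2; rewrite ng mulr0 leNgt pg0.
exists n, (fun x => (nrm pi g)^-1 * g x); split.
- exact: sqintZ.
- by move=> x; rewrite mulr_ge0// invr_ge0 ltW.
- by rewrite nrmZ// ger0_norm ?invr_ge0 ?ltW// mulVf// gt_eqF.
rewrite pZ// ger0_norm ?invr_ge0; last exact: ltW.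
rewrite mulrC ltr_pdivlMr//; apply: le_lt_trans pg.
apply: le_trans (ler_wpM2r (nrm_ge0 pi g) (ler_norm K)) _.
by rewrite ler_wpM2l.
Qed.

(* Gliding hump: if no uniform bound exists, small nonnegative increments [x_k]
   can be chosen so that [p (n_k) (x_0 + ... + x_k)] exceeds [1 / delta_k], where
   the later increments, of total norm at most [2 delta_(k+1)], change this value
   by at most [1]. *)
Lemma uniform_boundedness :
  (forall f, sqint pi f -> exists B, forall n, p n f <= B) ->
  exists K, forall n f, sqint pi f -> p n f <= K * nrm pi f.
Proof.
move=> pb; apply: contrapT => H.
have step (u : (T -> R) * R) : exists y : (T -> R) * nat, sqint pi u.1 -> 0 < u.2 ->
    [/\ sqint pi y.1, forall x, 0 <= y.1 x, nrm pi y.1 <= u.2 &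
     u.2^-1 <= p y.2 (fun x => u.1 x + y.1 x)].
  case: u => F dl /=; have [F2|nF] := pselect (sqint pi F); last first.
    by exists (F, 0%N) => /nF.
  have [dl0|_] := ltP 0 dl; last by exists (F, 0%N).
  (* Scaled to norm [dl], the hump has seminorm above [2 / dl]. By the triangle inequality [F] and
     [F + x] cannot both have seminorm below [1 / dl]; if [F] itself is large, the hump 0 will
     do. *)
  have [n [g [g2 g0 ng pg]]] := nonneg_witness (2 / dl ^+ 2) H.
  pose x t := dl * g t.
  have x2 : sqint pi x by exact: sqintZ.
  have px : 2 / dl < p n x.
    rewrite /x pZ// gtr0_norm// -ltr_pdivrMl//.
    by apply: le_lt_trans pg; rewrite le_eqVlt; apply/orP; left; apply/eqP; field; rewrite gt_eqF.
  have E : x = (fun t => (F t + x t) - F t) by apply: funext => t; rewrite addrC addKr.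
  have := pB n (sqintD F2 x2) F2; rewrite -E => h.
  have [h1|h1] := leP dl^-1 (p n F).
    exists (fun=> 0, n) => _ _; split => /=.
    - exact: sqint_cst.
    - by [].
    - by rewrite /nrm /ip mean_cst mulr0 sqrtr0 ltW.
    - by under eq_fun do rewrite addr0.
  exists (x, n) => _ _; split => //=.
  - by move=> t; rewrite mulr_ge0// ltW.
  - by rewrite nrmZ// ng mulr1 gtr0_norm.
  - by move: px h h1; lra.
have [y Hy] := choice step.
(* Division by [2 (1 + N n)] both halves the step size, making the later humps summable, and ensures
   that their total effect on [p n] is at most the current [dl]. *)
pose nxt (u : (T -> R) * R) : (T -> R) * R :=
  (fun x => u.1 x + (y u).1 x, u.2 / (2 * (1 + N (y u).2))).
pose st k := iter k nxt (fun=> 0, 1).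
pose F k := (st k).1; pose dl k := (st k).2.
have Nk k : 0 < 2 * (1 + N (y (st k)).2) by have := N0 (y (st k)).2; lra.
have inv k : sqint pi (F k) /\ 0 < dl k.
  elim: k => [|k [F2 dl0]]; first by split; [exact: sqint_cst|].
  have [y2 _ _ _] := Hy (st k) F2 dl0.
  by split; [exact: (sqintD F2 y2)|exact: (divr_gt0 dl0 (Nk k))].
have F2 k := (inv k).1; have dl0 k := (inv k).2.
have yk k := Hy (st k) (F2 k) (dl0 k).
have FS k : F k.+1 = (fun x => F k x + (y (st k)).1 x) by [].
have dlS k : dl k.+1 * (2 * (1 + N (y (st k)).2)) = dl k.
  exact: (divfK (lt0r_neq0 (Nk k)) (dl k)).
have dl2 k : 2 * dl k.+1 <= dl k.
  rewrite -(dlS k) mulrC ler_wpM2l ?(ltW (dl0 _))//.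
  by have := N0 (y (st k)).2; lra.
have dlN k : N (y (st k)).2 * (2 * dl k.+1) <= dl k.
  rewrite -(dlS k); have := dl0 k.+1; have := N0 (y (st k)).2.
  move: (N _) (dl k.+1) => a b a0 b0; nra.
have dlk k : dl k * k.+1%:R <= 1.
  elim: k => [|k ih]; first by rewrite mulr1.
  apply: le_trans ih; rewrite -!natr1; have := dl2 k; have := dl0 k.+1.
  have : 0 <= k%:R :> R by [].
  move: (k%:R) (dl k) (dl k.+1) => a b c a0 c0 cb; nra.
have FF k m : (k <= m)%N -> nrm pi (fun x => F m x - F k x) <= 2 * dl k - 2 * dl m.
  move=> /subnK <-; elim: (m - k)%N => [|j ih].
    rewrite add0n subrr /nrm /ip; under eq_mean do rewrite subrr mul0r.
    by rewrite mean_cst sqrtr0.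
  have [y2 _ ny _] := yk (j + k)%N.
  rewrite addSn FS.
  have -> : (fun x => F (j + k)%N x + (y (st (j + k))).1 x - F k x) =
      (fun x => (F (j + k)%N x - F k x) + (y (st (j + k))).1 x).
    by apply: funext => x; ring.
  apply: le_trans (nrmD (sqintB (F2 _) (F2 _)) y2) _.
  by have := dl2 (j + k)%N; move: ih ny; rewrite -/(dl _); lra.
have [h h2 hF] : exists2 h, sqint pi h & forall k, nrm pi (fun x => h x - F k x) <= 2 * dl k.
  apply: sqint_nondecreasing_limit => //.
  - move=> x; apply/nondecreasing_seqP => k; rewrite FS lerDl.
    by have [_ + _ _] := yk k; exact.
  - by move=> k; rewrite mulr_ge0// ltW.
  - by move=> k m km; apply: le_trans (FF k m km) _; rewrite gerBl mulr_ge0// ltW.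
have [B HB] := pb h h2.
(* At the index chosen for step [k], the sum [F k.+1] has seminorm at least [1 / dl k >= k + 1] and
   [h] differs from it by at most 1 in that seminorm, so [k + 1 <= B + 1]. *)
have key k : k%:R <= B.
  pose n := (y (st k)).2.
  have [_ _ _ h1] := yk k; rewrite -/n -/(F k.+1) -/(dl k) in h1.
  have h3 : p n (fun x => h x - F k.+1 x) <= 1.
    apply: le_trans (pN n (sqintB h2 (F2 k.+1))) _.
    apply: (@le_trans _ _ (N n * (2 * dl k.+1))); first by rewrite ler_wpM2l.
    apply: le_trans (dlN k) _; apply: le_trans (dlk k); rewrite ler_peMr//.
      exact: ltW.
    by rewrite ler1n.
  have E : F k.+1 = (fun x => h x - (h x - F k.+1 x)).
    by apply: funext => x; rewrite subKr.
  have := pB n h2 (sqintB h2 (F2 k.+1)); rewrite -E => h4.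
  have h5 : k.+1%:R <= (dl k)^-1 by rewrite -[leRHS]mul1r ler_pdivlMr// mulrC.
  have := HB n; move: h5 h1 h3 h4; rewrite FS -natr1; lra.
have := key (Num.trunc B).+1; rewrite leNgt truncnS_gt.
by [].
Qed.

End UniformBoundedness.

Section CentralLimit.
Context (R : realType) (d d' : measure_display).
Context (T : measurableType d) (W : measurableType d').
Variables (P : R.-pker T ~> T) (pi : probability T R) (Pr : probability W R).
Variable X : nat -> {RV Pr >-> T}.
Hypotheses (hrev : reversible P pi) (hX : markov_chain P pi X).
Implicit Types f g h : T -> R.

Definition center h (x : T) : R := h x - mean pi h.

Lemma sqint_center h : sqint pi h -> sqint pi (center h).
Proof. by move=> h2; apply: sqintB => //; exact: sqint_cst. Qed.

Lemma mean_center h : integr pi h -> mean pi (center h) = 0.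
Proof. by move=> hi; rewrite meanB ?mean_cst ?subrr//; exact: integr_cst. Qed.

Lemma nrm_center_le h : sqint pi h -> nrm pi (center h) <= nrm pi h.
Proof.
move=> h2; rewrite ler_sqrt ?ip_ge0// (ipBB h2 (sqint_cst pi _)).
have -> : ip pi h (fun=> mean pi h) = mean pi h ^+ 2.
  rewrite /ip; under eq_mean do rewrite mulrC.
  by rewrite meanZ ?expr2//; exact: sqint_integr.
rewrite {2}/ip mean_cst -expr2; have := sqr_ge0 (mean pi h); lra.
Qed.

Lemma centerD f g : integr pi f -> integr pi g ->
  center (fun x => f x + g x) = (fun x => center f x + center g x).
Proof. by move=> fi gi; apply: funext => x; rewrite /center meanD//; ring. Qed.

Lemma centerZ c f : integr pi f -> center (fun x => c * f x) = (fun x => c * center f x).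
Proof. by move=> fi; apply: funext => x; rewrite /center meanZ//; ring. Qed.

Lemma center_center f : integr pi f -> center (center f) = center f.
Proof. by move=> fi; apply: funext => x; rewrite {1}/center mean_center// subr0. Qed.

Lemma variance_X0 h : sqint pi h ->
  ('V_Pr[fun w => h (X 0%N w)] = (ip pi (center h) (center h))%:E)%E.
Proof.
move=> h2; have hX2 : sqint Pr (h \o X 0%N).
  by apply/(chain_sqint hrev hX) => //; exact: sqint_meas h2.
rewrite /variance (sqint_cov hX2 hX2) (chain_mean hrev hX 0 (sqint_integr h2)).
by rewrite -(chain_ip hrev hX 0 (sqint_center h2) (sqint_center h2)).
Qed.

Lemma covariance_X h k : sqint pi h ->
  (covariance Pr (fun w => h (X 0%N w)) (fun w => h (X k w)) = (acov X (center h) k)%:E)%E.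
Proof.
move=> h2; have hX2 j : sqint Pr (h \o X j).
  by apply/(chain_sqint hrev hX) => //; exact: sqint_meas h2.
rewrite (sqint_cov (hX2 0%N) (hX2 k)).
by rewrite !(chain_mean hrev hX _ (sqint_integr h2)).
Qed.

Lemma variance_partial_sum h n : sqint pi h ->
  ('V_Pr[fun w => (\sum_(1 <= i < n.+1) h (X i w))%R] =
   (ip Pr (partial_sum X (center h) n) (partial_sum X (center h) n))%:E)%E.
Proof.
move=> h2; have hX2 j : sqint Pr (h \o X j).
  by apply/(chain_sqint hrev hX) => //; exact: sqint_meas h2.
have S2 : sqint Pr (partial_sum X h n) by exact: (partial_sum_sqint hrev hX).
rewrite /variance (sqint_cov S2 S2).
have mS : mean Pr (partial_sum X h n) = n%:R * mean pi h.
  elim: n {S2} => [|n ih].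
    rewrite mul0r -[RHS](mean_cst Pr); apply: eq_mean => w.
    by rewrite /partial_sum big_geq.
  have -> : partial_sum X h n.+1 = (fun w => partial_sum X h n w + h (X n.+1 w)).
    by apply: funext => w; exact: partial_sumS.
  rewrite meanD; [|exact: sqint_integr (partial_sum_sqint hrev hX n h2)|
                   exact: sqint_integr (hX2 n.+1)].
  by rewrite ih (chain_mean hrev hX n.+1 (sqint_integr h2)) -natr1 mulrDl mul1r.
congr ((ip Pr _ _)%:E); apply: funext => w; rewrite mS /partial_sum sumrB;
  by rewrite sumr_const_nat subn1/= mulr_natl.
Qed.

Lemma avg_variance_cvg_asymptotic h (l : \bar R) : sqint pi h ->
  (avg_variance (acov X (center h)) n)%:E @[n --> \oo] --> l ->
  asymptotic_variance X h = l.
Proof.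
move=> h2 hl; apply/cvg_lim => //.
rewrite -cvg_shiftS; apply: cvg_trans hl; apply: near_eq_cvg; apply: nearW => n /=.
rewrite variance_partial_sum// (avg_variance_partial_sum hrev hX n (sqint_center h2)).
by rewrite -EFinM mulKf.
Qed.

(** [asymptotic_variance] is a [limn], so a limit must first be known to exist. The dichotomy of
    [avg_variance_cvg] provides one, and the variance bound excludes [+oo]. The constant is
    [|K| + 2] because the average variances exceed their limit by at most twice [acov X f 0]. *)
Lemma variance_bounding_acov : variance_bounding X -> exists2 C : R, 0 <= C &
  forall f, sqint pi f -> mean pi f = 0 -> exists s, [/\ series_sum (fun k => acov X f k.+1) s,
    avg_variance (acov X f) @ \oo --> acov X f 0 + 2 * s,
    forall n, avg_variance (acov X f) n <= C * ip pi f f &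
    exists B, forall n, 0 <= series (acov X f) n <= B].
Proof.
move=> [K HK]; exists (`|K| + 2) => [|f f2 f0]; first by rewrite addr_ge0.
have fc : center f = f by apply: funext => x; rewrite /center f0 subr0.
have a0 := acov0 hrev hX f2; have i0 := ip_ge0 pi f.
have V : (asymptotic_variance X f <= K%:E * (ip pi f f)%:E)%E.
  by have := HK f (sqint_meas f2); rewrite variance_X0// fc.
have [hy|[s [h1 h2 h3 h4]]] := avg_variance_cvg (even_odd_monotone_acov hrev hX f2).
  have E : asymptotic_variance X f = +oo%E.
    by apply: avg_variance_cvg_asymptotic => //; rewrite fc; apply/cvgeryP.
  by move: V; rewrite E -EFinM leye_eq.
exists s; split => //; last by eexists; exact: h4.
move=> n; apply: le_trans (h3 n) _.
have : acov X f 0 + 2 * s <= K * ip pi f f.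
  have E : asymptotic_variance X f = (acov X f 0 + 2 * s)%:E.
    apply: avg_variance_cvg_asymptotic => //; rewrite fc.
    by apply: cvg_EFin => //; exact: nearW.
  by move: V; rewrite E.
rewrite a0 => h; have := ler_wpM2r i0 (ler_norm K); rewrite mulrDl; lra.
Qed.

Lemma bounded_funP (U : Type) (f : U -> R) : bounded_fun f -> exists b, forall x, `|f x| <= b.
Proof.
move=> [M [Mr HM]]; exists (M + 1) => x.
by apply: (HM (M + 1)) => //; rewrite ltrDl.
Qed.

Lemma variance_bounding_clt h : variance_bounding X -> sqint pi h -> usual_clt pi X h.
Proof.
move=> /variance_bounding_acov[C C0 hC] h2.
split; first exact: sqint_integr.
have hc2 := sqint_center h2; have hc0 := mean_center (sqint_integr h2).
have [s [s1 s2 s3 _]] := hC _ hc2 hc0.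
pose v := acov X (center h) 0 + 2 * s.
have {}s2 : avg_variance (acov X (center h)) @ \oo --> v := s2.
have v0 : 0 <= v.
  rewrite -(cvg_lim _ s2)//; apply: limr_ge; first by apply/cvg_ex; exists v.
  apply: nearW => n; have := avg_variance_partial_sum hrev hX n hc2 => /esym E.
  by rewrite -(pmulr_rge0 _ (ltr0Sn R n)) E ip_ge0.
exists v, s; split.
- rewrite (_ : (fun i => _) = (fun k => acov X (center h) k.+1))//.
  by apply: funext => i; rewrite covariance_X.
- by rewrite variance_X0// -(acov0 hrev hX hc2) -EFinM -EFinD.
have dc : dense_coboundaries P pi.
  move=> psi bpsi mpsi e e0.
  have [_ [_ _ _ [B HB]]] := hC _ (bm_sqint pi bpsi) mpsi.
  exact: (coboundary_approx hrev hX bpsi HB e0).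
pose Z n w := (Num.sqrt n%:R)^-1 * partial_sum X (center h) n w.
have sS n := partial_sum_sqint hrev hX n hc2.
have sZ n : sqint Pr (Z n) := sqintZ (Num.sqrt n%:R)^-1 (sS n).
have ZE : (fun (n : nat) (w : W) => (Num.sqrt n%:R)^-1 *
     \sum_(1 <= i < n.+1) (h (X i w) - (\int[pi]_x h x)%R)) = Z.
  apply: funext => n; apply: funext => w; rewrite /Z /partial_sum; congr (_ * _).
  by apply: eq_bigr => i _; rewrite /center mean_fine.
have ZC n : ip Pr (Z n) (Z n) <= C * ip pi (center h) (center h).
  rewrite /Z (ipZl _ (sS n) (sqintZ _ (sS n))) (ipZr _ (sS n) (sS n)).
  rewrite mulrA -expr2 exprVn sqr_sqrtr ?ler0n//.
  case: n => [|n]; first by rewrite invr0 mul0r mulr_ge0// ip_ge0.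
  by rewrite (avg_variance_partial_sum hrev hX n hc2) mulKf.
rewrite ZE => f cf /bounded_funP[b fb].
have cosZ l c : mean Pr (fun w => cos (l * Z n w + c)) @[n --> \oo] -->
    mean (centered_normal v) (fun x : R => cos (l * x + c)).
  rewrite mean_centered_normal_cos//.
  have hC' f0 : sqint pi f0 -> mean pi f0 = 0 ->
      forall n, avg_variance (acov X f0) n <= C * ip pi f0 f0.
    by move=> sf0 mf0 n; have [? [_ _ + _]] := hC f0 sf0 mf0; exact.
  exact: (@partial_sum_cos_cvg _ _ _ _ _ P pi Pr X hrev hX _ _ C l c dc hc2 hc0 C0 hC' s2).
have mZ n := sqint_meas (sZ n).
have := weak_convergence mZ cosZ sZ ZC (sqint_centered_normal v0) cf fb.
have bf : bounded_measurable (f : measurableTypeR R -> R).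
  by split; [exact: continuous_measurable_fun|exists b].
rewrite (meanE (bm_integr _ bf)) => H.
have E n : 'E_Pr[f \o Z n]%E = (mean Pr (f \o Z n))%:E.
  by rewrite expectation.unlock (meanE (bm_integr Pr (bm_compZ mZ n bf))).
rewrite (funext E); apply: cvg_EFin; first exact: nearW.
exact: H.
Qed.

Definition scaled_nrm n f : R :=
  nrm Pr (fun w => (Num.sqrt n%:R)^-1 * partial_sum X (center f) n w).

Let sps n f : sqint pi f -> sqint Pr (partial_sum X (center f) n).
Proof. by move=> f2; exact: (partial_sum_sqint hrev hX n (sqint_center f2)). Qed.

Lemma scaled_nrmS n f : sqint pi f ->
  scaled_nrm n.+1 f ^+ 2 = avg_variance (acov X (center f)) n.
Proof.
move=> f2; have S2 := sps n.+1 f2.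
rewrite nrm_sqr (ipZl _ S2 (sqintZ _ S2)) (ipZr _ S2 S2).
rewrite mulrA -expr2 exprVn sqr_sqrtr ?ler0n//.
by rewrite (avg_variance_partial_sum hrev hX n (sqint_center f2)) mulKf.
Qed.

Lemma scaled_nrmD n f g : sqint pi f -> sqint pi g ->
  scaled_nrm n (fun x => f x + g x) <= scaled_nrm n f + scaled_nrm n g.
Proof.
move=> f2 g2; apply: le_trans (nrmD (sqintZ _ (sps n f2)) (sqintZ _ (sps n g2))).
rewrite /scaled_nrm centerD; [|exact: sqint_integr|exact: sqint_integr].
rewrite le_eqVlt; apply/orP; left; apply/eqP; congr nrm; apply: funext => w.
by rewrite -mulrDr /partial_sum big_split.
Qed.

Lemma scaled_nrmZ n c f : sqint pi f ->
  scaled_nrm n (fun x => c * f x) = `|c| * scaled_nrm n f.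
Proof.
move=> f2; rewrite -(nrmZ c (sqintZ _ (sps n f2))) /scaled_nrm centerZ; last exact: sqint_integr.
by congr nrm; apply: funext => w; rewrite /partial_sum -mulr_sumr; ring.
Qed.

Lemma scaled_nrm_le n f : sqint pi f -> scaled_nrm n f <= Num.sqrt n%:R * nrm pi f.
Proof.
move=> f2; rewrite /scaled_nrm nrmZ; last exact: sps.
rewrite ger0_norm ?invr_ge0 ?sqrtr_ge0//.
apply: (@le_trans _ _ ((Num.sqrt n%:R)^-1 * (n%:R * nrm pi f))).
  rewrite ler_wpM2l ?invr_ge0 ?sqrtr_ge0//.
  apply: le_trans (partial_sum_nrm hrev hX n (sqint_center f2)) _.
  by rewrite ler_wpM2l// nrm_center_le.
rewrite mulrA ler_wpM2r ?nrm_ge0//.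
case: n => [|n]; first by rewrite mulr0 sqrtr_ge0.
by rewrite -{2}(sqr_sqrtr (ler0n R n.+1)) expr2 mulrA mulVf ?mul1r// gt_eqF// sqrtr_gt0 ltr0n.
Qed.

(** The variance centres at [fine] of the expectation, which is a default value if the latter is not
    finite. This is harmless: a finite second moment about any real [c] already forces square
    integrability. *)
Lemma variance_notsqint h : measurable_fun setT h -> ~ sqint pi h ->
  ('V_Pr[fun w => h (X 0%N w)] = +oo)%E.
Proof.
move=> mh nh; apply/eqP; rewrite -leye_eq leNgt; apply/negP => Vfin; apply: nh.
apply/(chain_sqint hrev hX 0 mh).
have mhX : measurable_fun setT (h \o X 0%N) by exact: chain_comp_meas.
move: Vfin; rewrite /variance covariance.unlock; set c := fine _.
rewrite expectation.unlock => Vfin.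
pose g w := h (X 0%N w) - c.
have mg : measurable_fun setT g by exact: measurable_funB.
have g2 : sqint Pr g.
  split => //; apply/integrableP; split; first by apply/measurable_EFinP; exact: measurable_funX.
  under eq_integral do rewrite /= ger0_norm ?sqr_ge0//.
  exact: Vfin.
have := sqintD g2 (sqint_cst Pr c); congr sqint.
by apply: funext => w; rewrite /g subrK.
Qed.

Lemma clt_variance_bounding :
  (forall h, measurable_fun setT h -> (\int[pi]_x ((h x) ^+ 2)%:E < +oo)%E ->
     usual_clt pi X h) -> variance_bounding X.
Proof.
move=> clt.
have cv f : sqint pi f -> exists l : R, avg_variance (acov X (center f)) @ \oo --> l.
  move=> f2; have [|_ [v [s [[_ s2] _ _]]]] := clt f (sqint_meas f2).
    have := f2.2 => /integrableP[_]; under eq_integral do rewrite /= ger0_norm ?sqr_ge0//.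
    by [].
  exists (acov X (center f) 0 + 2 * s).
  apply: cvgD; first exact: cvg_cst.
  apply: cvgM; first exact: cvg_cst.
  move: s2; rewrite (_ : (fun i => _) = (fun k => acov X (center f) k.+1))//.
  by apply: funext => i; rewrite covariance_X.
have pb f : sqint pi f -> exists B, forall n, scaled_nrm n f <= B.
  move=> f2; have [l hl] := cv f f2.
  have /bounded_funP[b hb] : bounded_fun (avg_variance (acov X (center f))).
    by apply: cvg_seq_bounded; apply/cvg_ex; exists l.
  have b0 : 0 <= b := le_trans (normr_ge0 _) (hb 0%N).
  exists (1 + b) => -[|n].
    by apply: le_trans (scaled_nrm_le 0 f2) _; rewrite sqrtr0 mul0r addr_ge0.
  rewrite -(@ler_pXn2r _ 2)// ?nnegrE ?nrm_ge0 ?addr_ge0// scaled_nrmS//.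
  apply: le_trans (ler_norm _) _; apply: le_trans (hb n) _.
  by rewrite sqrrD expr1n mul1r mulr2n; have := sqr_ge0 b; lra.
have [K HK] := uniform_boundedness scaled_nrmD scaled_nrmZ (fun n => sqrtr_ge0 n%:R)
  scaled_nrm_le pb.
(* The constant must be strictly positive: for [h] outside [L^2] the right-hand side has to be
   [+oo], whereas 0 times [+oo] is 0. *)
exists (K ^+ 2 + 1) => h mh.
have K1 : 0 < K ^+ 2 + 1 by rewrite ltr_wpDl// sqr_ge0.
have [h2|nh] := pselect (sqint pi h); last first.
  by rewrite (variance_notsqint mh nh) gt0_muley ?leey// lte_fin.
have [l hl] := cv h h2.
have -> : asymptotic_variance X h = l%:E.
  by apply: avg_variance_cvg_asymptotic => //; apply: cvg_EFin => //; exact: nearW.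
rewrite variance_X0// -EFinM lee_fin -(cvg_lim _ hl)//.
apply: limr_le; first by apply/cvg_ex; exists l.
apply: nearW => n.
have hc2 := sqint_center h2.
(* The uniform bound is applied to [center h], whose squared norm is the variance of [h]; centring
   once more changes nothing. *)
have := HK n.+1 _ hc2; rewrite -(@ler_pXn2r _ 2)// ?nnegrE ?nrm_ge0//; last first.
  by apply: le_trans (HK n.+1 _ hc2); exact: nrm_ge0.
rewrite scaled_nrmS// center_center; last exact: sqint_integr.
move=> /le_trans; apply; rewrite exprMn nrm_sqr ler_wpM2r ?ip_ge0//.
by rewrite lerDl.
Qed.

End CentralLimit.

Theorem theorem7 (R : realType) (d d' : measure_display)
    (T : measurableType d) (W : measurableType d')
    (P : R.-pker T ~> T) (pi : probability T R)
    (Pr : probability W R) (X : nat -> {RV Pr >-> T})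
    (hpi : unique_stationary P pi) (hrev : reversible P pi)
    (hX : markov_chain P pi X) :
  variance_bounding X <->
  (forall h : T -> R, measurable_fun setT h ->
     (\int[pi]_x ((h x) ^+ 2)%:E < +oo)%E ->
     usual_clt pi X h).
Proof.
split=> [vb h mh h2|clt]; last exact: (clt_variance_bounding hrev hX clt).
have h2' : sqint pi h.
  split => //; apply/integrableP.
  split; first by apply/measurable_EFinP; exact: measurable_funX.
  by under eq_integral do rewrite /= ger0_norm ?sqr_ge0//.
exact: (variance_bounding_clt hrev hX vb h2').
Qed.
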